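(* Let $\mathscr{A}$ be a non-empty dg-category over $\mathbf{k}$. The following are equivalent: (1) $\mathscr{A}$ is pretriangulated. (2) For every finite direct category $I$, the dg-category $\mathscr{A}$ has all $W$-weighted homotopy limits $\mathrm{holim}^W F$, where $F\colon\mathbf{k}[I]\to\mathscr{A}$ is a quasi-functor and $W\in\mathrm{pretr}(\mathbf{k}[I]^{\mathrm{op}})$. (3) For every finite direct category $I$, the dg-category $\mathscr{A}$ has all $W$-weighted homotopy colimits $\mathrm{hocolim}^W F$, where $F\colon\mathbf{k}[I]\to\mathscr{A}$ is a quasi-functor and $W\in\mathrm{pretr}(\mathbf{k}[I])$.
   Context: Fix a commutative ring $\mathbf{k}$; everything is $\mathbf{k}$-linear and complexes are cochain complexes. Right (left) $\mathscr{A}$-dg-modules are dg-functors from $\mathscr{A}^{\mathrm{op}}$ (from $\mathscr{A}$) to complexes of $\mathbf{k}$-modules; left $\mathscr{A}$-modules are right $\mathscr{A}^{\mathrm{op}}$-modules. An $\mathscr{A}$-$\mathscr{B}$-dg-bimodule is a dg-functor $F$ from $\mathscr{B}^{\mathrm{op}}\otimes\mathscr{A}$ to complexes; $F_A=F(-,A)$ is a right $\mathscr{B}$-module. $\mathsf{D}(\mathscr{A})$ is the localization of the homotopy category of right $\mathscr{A}$-dg-modules at termwise quasi-isomorphisms. Every dg-category is assumed h-projective (h-projective hom-complexes over $\mathbf{k}$) or implicitly replaced by an h-projective resolution; then $\mathsf{D}(\mathscr{A},\mathscr{B})$ is the localization of the homotopy category of $\mathscr{A}$-$\mathscr{B}$-dg-bimodules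 at quasi-isomorphisms. A quasi-functor $F\colon\mathscr{A}\to\mathscr{B}$ is an object of $\mathsf{D}(\mathscr{A},\mathscr{B})$ with each $F_A$ isomorphic in $\mathsf{D}(\mathscr{B})$ to some representable $\mathscr{B}(-,B)$. Its opposite is $F^{\mathrm{op}}=\mathbb{R}\underline{\mathrm{Hom}}_{\mathscr{B}}(F,h_{\mathscr{B}})\colon\mathscr{A}^{\mathrm{op}}\to\mathscr{B}^{\mathrm{op}}$, with $h_{\mathscr{B}}=\mathscr{B}(-,-)$ the diagonal bimodule. Weighted homotopy (co)limits. For a quasi-functor $F\colon\mathscr{I}\to\mathscr{A}$ and $W\in\mathsf{D}(\mathscr{I}^{\mathrm{op}})$, a $W$-weighted homotopy limit of $F$ is $X\in\mathscr{A}$ with an isomorphism $\mathscr{A}(-,X)\cong\mathbb{R}\underline{\mathrm{Hom}}_{\mathscr{I}}(W,F)$ in $\mathsf{D}(\mathscr{A})$. For $W\in\mathsf{D}(\mathscr{I})$, a $W$-weighted homotopy colimit of $F$ is $X\in\mathscr{A}$ with an isomorphism $\mathscr{A}(X,-)\cong\mathbb{R}\underline{\mathrm{Hom}}_{\mathscr{I}^{\mathrm{op}}}(W,F^{\mathrm{op}})$ in $\mathsf{D}(\mathscr{A}^{\mathrm{op}})$. Pretriangulated. A non-empty dg-category $\mathscr{A}$ is pretriangulated if for all $A\in\mathscr{A}$, $n\in\mathbb{Z}$ there is $A[n]\in\mathscr{A}$ with $\mathscr{A}(-,A[n])\cong\mathscr{A}(-,A)[n]$ in $\mathsf{D}(\mathscr{A})$,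 and for every closed degree $0$ morphism $f\colon A\to B$ there is $\mathrm{cone}(f)\in\mathscr{A}$ with $\mathscr{A}(-,\mathrm{cone}(f))\cong\mathrm{cone}(f_*\colon\mathscr{A}(-,A)\to\mathscr{A}(-,B))$ in $\mathsf{D}(\mathscr{A})$. The pretriangulated hull $\mathrm{pretr}(\mathscr{B})$ of a dg-category $\mathscr{B}$ is the closure of the representable right $\mathscr{B}$-dg-modules, inside the dg-category of right $\mathscr{B}$-dg-modules, under shifts and mapping cones of closed degree $0$ morphisms, up to closed degree $0$ isomorphism. A finite category $I$ (finitely many objects and morphisms) is finite direct if there are an integer $n\ge0$ and $d\colon\mathrm{Ob}(I)\to\{0,\dots,n\}$ with $d(i)<d(j)$ for every non-identity morphism $i\to j$. $\mathbf{k}[I]$ is the free $\mathbf{k}$-linear category on $I$, viewed as a dg-category in degree $0$. *)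

(* Defs.v *)
From HB Require Import structures.
From mathcomp Require Import all_boot all_order all_algebra.
From mathcomp Require Import boolp zify ring.

Set Implicit Arguments.
Unset Strict Implicit.
Unset Printing Implicit Defensive.
Import GRing.Theory.
Local Open Scope ring_scope.

(* Every operation that changes degrees takes the degrees of its source and
   target together with a proof of the relation between them (e.g. [p + q = r]),
   so that no cast along equalities of integers is ever needed.  Equality of
   integers is decidable, hence such proofs are unique. *)

Section Signs.
Variable k : comPzRingType.

(* The Koszul sign $(-1)^p$; defined through [absz] because [k] is only assumed
   to be a ring, possibly trivial. *)
Definition sg (p : int) : k := (-1) ^+ `|p|%N.

Lemma sg_odd (p : int) : sg p = (-1) ^+ odd `|p|%N.
Proof. by rewrite signr_odd. Qed.

Lemma sgD p q : sg (p + q) = sg p * sg q.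
Proof.
rewrite !sg_odd -signr_addb; congr (_ ^+ _).
by case: p q => [p|p] [q|q]; lia.
Qed.

Lemma sgN p : sg (- p) = sg p.
Proof. by rewrite /sg abszN. Qed.

Lemma sg0 : sg 0 = 1. Proof. by []. Qed.

Lemma sg1 : sg 1 = -1. Proof. by rewrite /sg expr1. Qed.

Lemma sgP p : sg p = 1 \/ sg p = -1.
Proof. by rewrite sg_odd; case: odd; [right|left]. Qed.

Definition sgE := (mulrDl, mulrDr, mul1r, mulr1, mul0r, mulr0, sgD, sg1, sg0).

Lemma sgMC p q : sg (p * q) = sg (q * p).
Proof. by rewrite mulrC. Qed.

End Signs.

Section LinearFacts.
Variables (k : pzRingType) (U V : lmodType k) (h : U -> V) (hlin : linear h).

Lemma linD x y : h (x + y) = h x + h y.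
Proof. by have := hlin 1 x y; rewrite !scale1r. Qed.

Lemma lin0 : h 0 = 0.
Proof. by apply: (addrI (h 0)); rewrite -linD !addr0. Qed.

Lemma linZ a x : h (a *: x) = a *: h x.
Proof. by have := hlin a x 0; rewrite lin0 !addr0. Qed.

Lemma linN x : h (- x) = - h x.
Proof. by rewrite -scaleN1r linZ scaleN1r. Qed.

Lemma linB x y : h (x - y) = h x - h y.
Proof. by rewrite linD linN. Qed.
End LinearFacts.

Record cochain (k : comPzRingType) := Cochain {
  cx :> int -> lmodType k;
  cd : forall p q : int, p + 1 = q -> cx p -> cx q;
  cd_lin : forall p q (e : p + 1 = q), linear (cd e);
  cdd : forall p q r (e : p + 1 = q) (e' : q + 1 = r) (x : cx p),
    cd e' (cd e x) = 0 }.

Arguments cd {k} c {p q} e x.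
Arguments cd_lin {k} c {p q} e.

Section Cohomology.
Variables (k : comPzRingType) (K : cochain k).

Definition cocycle (p : int) (x : K p) : Prop := cd K (erefl (p + 1)) x = 0.

Definition coboundary (p : int) (x : K p) : Prop :=
  exists q (e : q + 1 = p) (y : K q), cd K e y = x.

Definition acyclic : Prop := forall (p : int) (x : K p), cocycle x -> coboundary x.
End Cohomology.

(* Graded maps of degree [n], with no compatibility with the differentials. *)
Record gmap (k : comPzRingType) (K N : cochain k) (n : int) := GMap {
  gm :> forall p q : int, p + n = q -> K p -> N q;
  gm_lin : forall p q (e : p + n = q), linear (gm e) }.

Arguments gm {k K N n} g {p q} e x.

Section GMap.
Variable k : comPzRingType.
Implicit Types K N L : cochain k.

Lemma gmapP K N n (f g : gmap K N n) :
  (forall p q (e : p + n = q) x, gm f e x = gm g e x) -> f = g.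
Proof.
case: f g => [f flin] [g glin] /= fg.
have {}fg : f = g.
  by do 3 (apply: functional_extensionality_dep => ?); apply: funext => ?.
by subst g; congr GMap; apply: Prop_irrelevance.
Qed.

HB.instance Definition _ K N n := gen_eqMixin (gmap K N n).
HB.instance Definition _ K N n := gen_choiceMixin (gmap K N n).

Section Lmod.
Variables (K N : cochain k) (n : int).
Implicit Types f g : gmap K N n.

Definition gm0 : gmap K N n.
Proof.
by exists (fun p q e x => 0) => p q e a x y; rewrite scaler0 addr0.
Defined.

Definition gmN f : gmap K N n.
Proof.
exists (fun p q e x => - gm f e x) => p q e a x y.
by rewrite gm_lin opprD scalerN.
Defined.

Definition gmD f g : gmap K N n.
Proof.
exists (fun p q e x => gm f e x + gm g e x) => p q e a x y.
by rewrite !gm_lin scalerDr addrACA.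
Defined.

Definition gmZ (c : k) f : gmap K N n.
Proof.
exists (fun p q e x => c *: gm f e x) => p q e a x y.
by rewrite gm_lin scalerDr !scalerA mulrC.
Defined.

Fact gmDA : associative gmD.
Proof. by move=> f g h; apply: gmapP => * /=; rewrite addrA. Qed.
Fact gmDC : commutative gmD.
Proof. by move=> f g; apply: gmapP => * /=; rewrite addrC. Qed.
Fact gm0D : left_id gm0 gmD.
Proof. by move=> f; apply: gmapP => * /=; rewrite add0r. Qed.
Fact gmND : left_inverse gm0 gmN gmD.
Proof. by move=> f; apply: gmapP => * /=; rewrite addNr. Qed.

HB.instance Definition _ := GRing.isZmodule.Build (gmap K N n) gmDA gmDC gm0D gmND.

Fact gmZA a b f : gmZ a (gmZ b f) = gmZ (a * b) f.
Proof. by apply: gmapP => * /=; rewrite scalerA. Qed.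
Fact gmZ1 : left_id 1 gmZ.
Proof. by move=> f; apply: gmapP => * /=; rewrite scale1r. Qed.
Fact gmZDr : right_distributive gmZ +%R.
Proof. by move=> a f g; apply: gmapP => * /=; rewrite scalerDr. Qed.
Fact gmZDl f : {morph gmZ^~ f : a b / a + b}.
Proof. by move=> a b; apply: gmapP => * /=; rewrite scalerDl. Qed.

HB.instance Definition _ :=
  GRing.Zmodule_isLmodule.Build k (gmap K N n) gmZA gmZ1 gmZDr gmZDl.

Lemma gm0E p q (e : p + n = q) x : gm (0 : gmap K N n) e x = 0.
Proof. by []. Qed.
Lemma gmDE f g p q (e : p + n = q) x : gm (f + g) e x = gm f e x + gm g e x.
Proof. by []. Qed.
Lemma gmZE a f p q (e : p + n = q) x : gm (a *: f) e x = a *: gm f e x.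
Proof. by []. Qed.
End Lmod.

(* The differential $Df = d \circ f - (-1)^n f \circ d$ of the hom complex. *)
Fact gdiff_e1 p n n' q : n + 1 = n' -> p + n' = q -> p + n + 1 = q :> int.
Proof. lia. Qed.
Fact gdiff_e2 p n n' q : n + 1 = n' -> p + n' = q -> p + 1 + n = q :> int.
Proof. lia. Qed.

Definition gdiff K N n n' (en : n + 1 = n') (f : gmap K N n) : gmap K N n'.
Proof.
exists (fun p q e x =>
  cd N (gdiff_e1 en e) (gm f (erefl (p + n)) x)
    - sg k n *: gm f (gdiff_e2 en e) (cd K (erefl (p + 1)) x)).
move=> p q e a x y.
rewrite !(gm_lin, cd_lin) !scalerDr opprD !scalerN addrACA !scalerA.
by rewrite [a * _]mulrC.
Defined.

Lemma gdiffE K N n n' (en : n + 1 = n') (f : gmap K N n) p q (e : p + n' = q)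
    p' q' (e1 : p + n = q') (e2 : q' + 1 = q) (e3 : p + 1 = p')
    (e4 : p' + n = q) x :
  gm (gdiff en f) e x = cd N e2 (gm f e1 x) - sg k n *: gm f e4 (cd K e3 x).
Proof.
case: q' / e1 e2 => e2; case: p' / e3 e4 => e4 /=.
by rewrite (eq_irrelevance (gdiff_e1 en e) e2) (eq_irrelevance (gdiff_e2 en e) e4).
Qed.

Fact gcomp_e m n r p q : n + m = r -> p + r = q -> p + m + n = q :> int.
Proof. lia. Qed.

Definition gcomp K N L m n r (er : n + m = r)
  (g : gmap N L n) (f : gmap K N m) : gmap K L r.
Proof.
exists (fun p q e x => gm g (gcomp_e er e) (gm f (erefl (p + m)) x)).
by move=> p q e a x y; rewrite !gm_lin.
Defined.

Lemma gcompE K N L m n r (er : n + m = r) (g : gmap N L n) (f : gmap K N m)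
    p q (e : p + r = q) q' (e1 : p + m = q') (e2 : q' + n = q) x :
  gm (gcomp er g f) e x = gm g e2 (gm f e1 x).
Proof.
case: q' / e1 e2 => e2 /=.
by rewrite (eq_irrelevance (gcomp_e er e) e2).
Qed.

Definition gid K : gmap K K 0.
Proof.
exists (fun p q e => match etrans (esym (addr0 p)) e in _ = q return K p -> K q
                     with erefl => fun x => x end).
by move=> p q e; move: (etrans _ e) => {}e; case: q / e.
Defined.

Lemma gidE K p (e : p + 0 = p) x : gm (gid K) e x = x.
Proof. by rewrite /= (eq_irrelevance (etrans _ e) erefl). Qed.
End GMap.

(* A complex of [k]-modules is h-projective when the hom complex to every
   acyclic complex is acyclic. *)
Definition hproj_cochain (k : comPzRingType) (K : cochain k) : Prop :=
  forall N : cochain k, acyclic N ->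
  forall n n' n'' (e : n + 1 = n') (e' : n' + 1 = n'') (f : gmap K N n'),
    gdiff e' f = 0 -> exists g : gmap K N n, gdiff e g = f.

(* [f] induces bijections on all cohomology modules. *)
Definition cochain_qis (k : comPzRingType) (K N : cochain k) (f : gmap K N 0) : Prop :=
  forall p : int,
    (forall x : K p, cocycle x -> coboundary (gm f (addr0 p) x) -> coboundary x) /\
    (forall y : N p, cocycle y ->
       exists2 x : K p, cocycle x & coboundary (y - gm f (addr0 p) x)).

Section GDiff.
Variable k : comPzRingType.
Implicit Types K N L : cochain k.

Lemma gdiff_lin K N n n' (en : n + 1 = n') : linear (@gdiff k K N n n' en).
Proof.
move=> a f g; apply: gmapP => p q e x.
rewrite !(gmDE, gmZE, gdiffE en _ e erefl (gdiff_e1 en e) erefl (gdiff_e2 en e)).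
rewrite !cd_lin !scalerDr !scalerN opprD addrACA !scalerA.
by rewrite [sg k n * _]mulrC.
Qed.

Lemma gdiffK K N n n' n'' (e1 : n + 1 = n') (e2 : n' + 1 = n'') (f : gmap K N n) :
  gdiff e2 (gdiff e1 f) = 0.
Proof.
apply: gmapP => p q e x.
have E1 : p + n' + 1 = q by lia.
have E2 : p + 1 + n' = q by lia.
have E3 : p + n + 1 = p + n' by lia.
have E4 : p + 1 + n = p + n' by lia.
have E5 : p + 1 + n + 1 = q by lia.
have E6 : p + 1 + 1 + n = q by lia.
rewrite (gdiffE e2 _ e erefl E1 erefl E2).
rewrite (gdiffE e1 f erefl erefl E3 erefl E4).
rewrite (gdiffE e1 f E2 E4 E1 erefl E6) cdd (lin0 (gm_lin f E6)) scaler0 subr0.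
rewrite (linB (cd_lin N E1)) cdd sub0r (linZ (cd_lin N E1)).
have -> : sg k n' = - sg k n by rewrite -e1 sgD sg1 mulrN1.
by rewrite scaleNr opprK gm0E addNr.
Qed.

Lemma gdiff_comp K N L m n r m' n' r' (er : n + m = r) (em : m + 1 = m')
    (en : n + 1 = n') (er' : r + 1 = r') (e1 : n' + m = r') (e2 : n + m' = r')
    (g : gmap N L n) (f : gmap K N m) :
  gdiff er' (gcomp er g f)
    = gcomp e1 (gdiff en g) f + sg k n *: gcomp e2 g (gdiff em f).
Proof.
apply: gmapP => p q e x.
have E1 : p + r + 1 = q by lia.
have E2 : p + 1 + r = q by lia.
have E3 : p + m + n = p + r by lia.
have E4 : p + 1 + m + n = q by lia.
have E5 : p + m + n' = q by lia.
have E6 : p + m' + n = q by lia.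
have E7 : p + m + 1 + n = q by lia.
have E8 : p + m + 1 = p + m' by lia.
have E9 : p + 1 + m = p + m' by lia.
rewrite gmDE gmZE (gdiffE er' _ e erefl E1 erefl E2).
rewrite (gcompE er g f erefl erefl E3) (gcompE er g f E2 erefl E4).
rewrite (gcompE e1 _ f e erefl E5) (gcompE e2 g _ e erefl E6).
rewrite (gdiffE en g E5 E3 E1 E8 E6).
rewrite (gdiffE em f erefl erefl E8 erefl E9).
rewrite (linB (gm_lin g E6)) (linZ (gm_lin g E6)).
have -> : gm g E4 (gm f erefl (cd K (erefl (p + 1)) x))
          = gm g E6 (gm f E9 (cd K erefl x)).
  have E : p + 1 + m = p + m' := E9.
  by case: (p + m') / E9 E6 {E5 E8 E E7} => E6; rewrite (eq_irrelevance E4 E6).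
have -> : sg k r = sg k n * sg k m by rewrite -er sgD.
by rewrite scalerBr scalerA addrA subrK.
Qed.

Lemma gdiff_id K n (e : 0 + 1 = n) : gdiff e (gid K) = 0.
Proof.
apply: gmapP => p q e' x.
have E : p + 1 = q by lia.
rewrite (gdiffE e _ e' (addr0 p) E E (addr0 q)) !gidE gm0E.
by rewrite sg0 scale1r subrr.
Qed.
End GDiff.

Record dgcat (k : comPzRingType) := DGCat {
  ob :> Type;
  hom : ob -> ob -> cochain k;
  idm : forall X, hom X X 0;
  comp : forall X Y Z (p q r : int), p + q = r -> hom Y Z p -> hom X Y q -> hom X Z r;
  comp_linr : forall X Y Z p q r (e : p + q = r) (g : hom Y Z p),
    linear (@comp X Y Z p q r e g);
  comp_linl : forall X Y Z p q r (e : p + q = r) (f : hom X Y q),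
    linear (fun g => @comp X Y Z p q r e g f);
  compA : forall W X Y Z p q r pq qr s (e1 : p + q = pq) (e2 : q + r = qr)
      (e3 : pq + r = s) (e4 : p + qr = s)
      (h : hom Y Z p) (g : hom X Y q) (f : hom W X r),
    comp e3 (comp e1 h g) f = comp e4 h (comp e2 g f);
  comp1m : forall X Y p (e : 0 + p = p) (f : hom X Y p), comp e (idm Y) f = f;
  compm1 : forall X Y p (e : p + 0 = p) (f : hom X Y p), comp e f (idm X) = f;
  compd : forall X Y Z p q r p' q' r' (e : p + q = r) (ep : p + 1 = p')
      (eq : q + 1 = q') (er : r + 1 = r') (e1 : p' + q = r') (e2 : p + q' = r')
      (g : hom Y Z p) (f : hom X Y q),
    cd _ er (comp e g f)
      = comp e1 (cd _ ep g) f + sg k p *: comp e2 g (cd _ eq f) }.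

Arguments hom {k} d X Y.
Arguments idm {k} d X.
Arguments comp {k} d {X Y Z p q r} e g f.

Definition hproj_dgcat (k : comPzRingType) (A : dgcat k) : Prop :=
  forall X Y : A, hproj_cochain (hom A X Y).

Ltac sgcase :=
  repeat match goal with |- context [sg ?k ?p] =>
    let H := fresh in case: (sgP k p) => H; rewrite ?H; clear H end;
  rewrite ?(scale1r, scaleN1r, opprK, mul1r, mulr1, mulN1r, mulrN1, mulrN, mulNr).

Section Opposite.
Variables (k : comPzRingType) (A : dgcat k).

Fact op_e (p q r : int) : p + q = r -> q + p = r.
Proof. by rewrite addrC. Qed.

Definition opcomp (X Y Z : A) (p q r : int) (e : p + q = r)
    (g : hom A Z Y p) (f : hom A Y X q) : hom A Z X r :=
  sg k (p * q) *: comp A (op_e e) f g.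

Definition opcat : dgcat k.
Proof.
refine (@DGCat k A (fun X Y => hom A Y X) (idm A) opcomp _ _ _ _ _ _).
- move=> X Y Z p q r e g a f f'; rewrite /opcomp comp_linl scalerDr !scalerA.
  by rewrite [a * _]mulrC.
- move=> X Y Z p q r e f a g g'; rewrite /opcomp comp_linr scalerDr !scalerA.
  by rewrite [a * _]mulrC.
- move=> W X Y Z p q r pq qr s e1 e2 e3 e4 h g f; rewrite /opcomp.
  rewrite (linZ (comp_linr _ _)) (linZ (comp_linl _ _)) !scalerA.
  rewrite -(compA (op_e e2) (op_e e1) (op_e e4) (op_e e3)); congr (_ *: _).
  by case: _ / e1 {e3}; case: _ / e2 {e4}; rewrite !sgE; ring.
- by move=> X Y p e f; rewrite /opcomp mul0r scale1r compm1.
- by move=> X Y p e f; rewrite /opcomp mulr0 scale1r comp1m.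
- move=> X Y Z p q r p' q' r' e ep eq er e1 e2 g f; rewrite /opcomp.
  rewrite (linZ (cd_lin _ _)) (compd _ eq ep er (op_e e2) (op_e e1)).
  rewrite scalerDr !scalerA addrC.
  have -> : sg k (p' * q) = sg k (p * q) * sg k q by rewrite -ep !sgE.
  have -> : sg k (p * q') = sg k (p * q) * sg k p by rewrite -eq !sgE.
  congr (_ + _ *: _).
  by case: (sgP k p) => ->; rewrite ?mulrN1 ?mulN1r ?opprK ?mulr1 ?mul1r.
Defined.
End Opposite.

(* The axioms making a family of complexes [M] indexed by the objects of [C],
   with the operations [f, x |-> f x], a dg-functor from [C] to complexes. *)
Record is_action (k : comPzRingType) (C : dgcat k) (M : C -> cochain k)
    (act : forall (X Y : C) (p q r : int), p + q = r -> hom C X Y p -> M X q -> M Y r)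
    : Prop := IsAction {
  ax_linr : forall X Y p q r (e : p + q = r) (f : hom C X Y p), linear (@act X Y p q r e f);
  ax_linl : forall X Y p q r (e : p + q = r) (x : M X q),
    linear (fun f => @act X Y p q r e f x);
  ax_comp : forall X Y Z p q r pq qr s (e1 : p + q = pq) (e2 : q + r = qr)
      (e3 : pq + r = s) (e4 : p + qr = s) (g : hom C Y Z p) (f : hom C X Y q) (x : M X r),
    act _ _ _ _ _ e3 (comp C e1 g f) x = act _ _ _ _ _ e4 g (act _ _ _ _ _ e2 f x);
  ax_id : forall X p (e : 0 + p = p) (x : M X p), act _ _ _ _ _ e (idm C X) x = x;
  ax_d : forall X Y p q r p' q' r' (e : p + q = r) (ep : p + 1 = p')
      (eq : q + 1 = q') (er : r + 1 = r') (e1 : p' + q = r') (e2 : p + q' = r')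
      (f : hom C X Y p) (x : M X q),
    cd _ er (act _ _ _ _ _ e f x)
      = act _ _ _ _ _ e1 (cd _ ep f) x + sg k p *: act _ _ _ _ _ e2 f (cd _ eq x) }.

(* [dgmod C] is the type of dg-functors from [C] to complexes, that is, of left
   [C]-dg-modules; right [A]-dg-modules are the objects of [dgmod (opcat A)].
   As left modules over [A] are right modules over its opposite, the derived
   category of the opposite of [A] is the one of [dgmod A]. *)
Record dgmod (k : comPzRingType) (C : dgcat k) := DGMod {
  md :> C -> cochain k;
  act : forall (X Y : C) (p q r : int), p + q = r -> hom C X Y p -> md X q -> md Y r;
  actP : is_action act }.

Arguments act {k C} d {X Y p q r} e f x.

(* [dgbimod C D] is the type of dg-functors from the tensor product of [C] and
   [D] to complexes, presented by the two actions, which commute up to the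
   Koszul sign.  An [A]-[B]-dg-bimodule is an object of [dgbimod (opcat B) A]. *)
Record dgbimod (k : comPzRingType) (C D : dgcat k) := DGBimod {
  bm :> C -> D -> cochain k;
  actl : forall (Y : D) (X X' : C) (p q r : int), p + q = r ->
    hom C X X' p -> bm X Y q -> bm X' Y r;
  actr : forall (X : C) (Y Y' : D) (p q r : int), p + q = r ->
    hom D Y Y' p -> bm X Y q -> bm X Y' r;
  actlP : forall Y, is_action (@actl Y);
  actrP : forall X, is_action (@actr X);
  actlr : forall (X X' : C) (Y Y' : D) (p q n qn pn s : int)
      (e1 : q + n = qn) (e2 : p + qn = s) (e3 : p + n = pn) (e4 : q + pn = s)
      (f : hom C X X' p) (g : hom D Y Y' q) (x : bm X Y n),
    actl e2 f (actr e1 g x) = sg k (p * q) *: actr e4 g (actl e3 f x) }.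

Arguments actl {k C D} d {Y X X' p q r} e f x.
Arguments actr {k C D} d {X Y Y' p q r} e g x.

Section Slices.
Variables (k : comPzRingType) (C D : dgcat k) (F : dgbimod C D).

(* $F(X,-)$ and $F(-,Y)$. *)
Definition slicel (X : C) : dgmod D := DGMod (actrP F X).
Definition slicer (Y : D) : dgmod C := DGMod (actlP F Y).
End Slices.

(* The diagonal bimodule $h_C = C(-,-)$. *)
Definition diag (k : comPzRingType) (C : dgcat k) : dgbimod (opcat C) C.
Proof.
refine (@DGBimod k (opcat C) C (fun X Y => hom C X Y)
  (fun Y X X' p q r e f x => @opcomp k C Y X X' p q r e f x)
  (fun X Y Y' p q r e g x => comp C e g x) _ _ _).
- move=> Y; split.
  + by move=> *; exact: (@comp_linr k (opcat C)).
  + by move=> *; exact: (@comp_linl k (opcat C)).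
  + by move=> *; exact: (@compA k (opcat C)).
  + by move=> *; exact: (@comp1m k (opcat C)).
  + by move=> *; exact: (@compd k (opcat C)).
- move=> X; split.
  + by move=> *; exact: comp_linr.
  + by move=> *; exact: comp_linl.
  + by move=> *; exact: compA.
  + by move=> *; exact: comp1m.
  + by move=> *; exact: compd.
- move=> X X' Y Y' p q n qn pn s e1 e2 e3 e4 f g x; rewrite /opcomp.
  rewrite (linZ (comp_linr _ _)) scalerA (compA e1 (op_e e3) (op_e e2) e4).
  by congr (_ *: _); rewrite -e1 !sgE.
Defined.

(* Degree [n] morphisms of dg-modules: $\phi(f x) = (-1)^{n|f|} f \phi(x)$. *)
Record modhom (k : comPzRingType) (C : dgcat k) (M N : dgmod C) (n : int) := ModHom {
  mh :> forall X, gmap (M X) (N X) n;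
  mh_act : forall X Y p q r s t (e : p + q = r) (e1 : r + n = s) (e2 : q + n = t)
      (e3 : p + t = s) (f : hom C X Y p) (x : M X q),
    gm (mh Y) e1 (act M e f x) = sg k (n * p) *: act N e3 f (gm (mh X) e2 x) }.

Section ModHom.
Variables (k : comPzRingType) (C : dgcat k).
Implicit Types M N L : dgmod C.

Lemma modhomP M N n (f g : modhom M N n) : (forall X, f X = g X) -> f = g.
Proof.
case: f g => [f fact] [g gact] /= fg.
have {}fg : f = g by apply: functional_extensionality_dep.
by subst g; congr ModHom; apply: Prop_irrelevance.
Qed.

HB.instance Definition _ M N n := gen_eqMixin (modhom M N n).
HB.instance Definition _ M N n := gen_choiceMixin (modhom M N n).

Section Lmod.
Variables (M N : dgmod C) (n : int).
Implicit Types f g : modhom M N n.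

Definition mh0 : modhom M N n.
Proof.
exists (fun X => 0) => X Y p q r s t e e1 e2 e3 f x.
by rewrite !gm0E (lin0 (ax_linr (actP N) e3 f)) scaler0.
Defined.

Definition mhN f : modhom M N n.
Proof.
exists (fun X => - f X) => X Y p q r s t e e1 e2 e3 u x /=.
by rewrite (linN (ax_linr (actP N) e3 u)) scalerN (mh_act f e e1 e2 e3).
Defined.

Definition mhD f g : modhom M N n.
Proof.
exists (fun X => f X + g X) => X Y p q r s t e e1 e2 e3 u x.
rewrite !gmDE (linD (ax_linr (actP N) e3 u)) scalerDr.
by rewrite (mh_act f e e1 e2 e3) (mh_act g e e1 e2 e3).
Defined.

Definition mhZ (c : k) f : modhom M N n.
Proof.
exists (fun X => c *: f X) => X Y p q r s t e e1 e2 e3 u x.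
rewrite !gmZE (linZ (ax_linr (actP N) e3 u)) (mh_act f e e1 e2 e3).
by rewrite !scalerA mulrC.
Defined.

Fact mhDA : associative mhD.
Proof. by move=> f g h; apply: modhomP => X /=; rewrite addrA. Qed.
Fact mhDC : commutative mhD.
Proof. by move=> f g; apply: modhomP => X /=; rewrite addrC. Qed.
Fact mh0D : left_id mh0 mhD.
Proof. by move=> f; apply: modhomP => X /=; rewrite add0r. Qed.
Fact mhND : left_inverse mh0 mhN mhD.
Proof. by move=> f; apply: modhomP => X /=; rewrite addNr. Qed.

HB.instance Definition _ := GRing.isZmodule.Build (modhom M N n) mhDA mhDC mh0D mhND.

Fact mhZA a b f : mhZ a (mhZ b f) = mhZ (a * b) f.
Proof. by apply: modhomP => X /=; rewrite scalerA. Qed.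
Fact mhZ1 : left_id 1 mhZ.
Proof. by move=> f; apply: modhomP => X /=; rewrite scale1r. Qed.
Fact mhZDr : right_distributive mhZ +%R.
Proof. by move=> a f g; apply: modhomP => X /=; rewrite scalerDr. Qed.
Fact mhZDl f : {morph mhZ^~ f : a b / a + b}.
Proof. by move=> a b; apply: modhomP => X /=; rewrite scalerDl. Qed.

HB.instance Definition _ :=
  GRing.Zmodule_isLmodule.Build k (modhom M N n) mhZA mhZ1 mhZDr mhZDl.

Lemma mhDE f g X : (f + g) X = f X + g X. Proof. by []. Qed.
Lemma mhZE a f X : (a *: f) X = a *: f X. Proof. by []. Qed.
Lemma mh0E X : (0 : modhom M N n) X = 0. Proof. by []. Qed.
End Lmod.

Definition mdiff M N n n' (en : n + 1 = n') (f : modhom M N n) : modhom M N n'.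
Proof.
exists (fun X => gdiff en (f X)) => X Y p q r s t e e1 e2 e3 u x.
have E1 : r + n + 1 = s by lia.
have E2 : r + 1 + n = s by lia.
have E3 : q + n + 1 = t by lia.
have E4 : q + 1 + n = t by lia.
have F1 : p + (q + n) = r + n by lia.
have F2 : p + 1 + (q + n) = s by lia.
have F3 : p + 1 + q = r + 1 by lia.
have F4 : p + (q + 1) = r + 1 by lia.
rewrite (gdiffE en (f Y) e1 erefl E1 erefl E2) (gdiffE en (f X) e2 erefl E3 erefl E4).
rewrite (mh_act f e erefl erefl F1) (linZ (cd_lin _ _)).
rewrite (ax_d (actP N) F1 erefl E3 E1 F2 e3).
rewrite (ax_d (actP M) e erefl erefl erefl F3 F4).
rewrite (linD (gm_lin _ _)) (linZ (gm_lin _ _)).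
rewrite (mh_act f F3 E2 erefl F2) (mh_act f F4 E2 E4 e3).
rewrite (linB (ax_linr (actP N) e3 u)) (linZ (ax_linr (actP N) e3 u)).
rewrite -en !sgE !scalerDr !scalerA !scalerN !scalerA.
rewrite opprD !addrA.
set a := act N F2 _ _; set b := act N e3 u _; set c := act N e3 u _.
by sgcase; rewrite [X in X + _ = _]addrAC ?(subrr, addNr) add0r.
Defined.

Fact homM_lin M N n n' (en : n + 1 = n') : linear (@mdiff M N n n' en).
Proof. by move=> a f g; apply: modhomP => X; exact: gdiff_lin. Qed.

Fact homM_dd M N n n' n'' (e1 : n + 1 = n') (e2 : n' + 1 = n'') (f : modhom M N n) :
  mdiff e2 (mdiff e1 f) = 0.
Proof. by apply: modhomP => X; exact: gdiffK. Qed.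

(* The hom complex $\underline{Hom}_C(M,N)$. *)
Definition homM M N : cochain k :=
  @Cochain k (fun n => modhom M N n) (@mdiff M N) (@homM_lin M N) (@homM_dd M N).

Definition mcomp M N L m n r (er : n + m = r)
  (g : modhom N L n) (f : modhom M N m) : modhom M L r.
Proof.
exists (fun X => gcomp er (g X) (f X)) => X Y p q v s t e e1 e2 e3 u x.
have E1 : v + m + n = s by lia.
have E2 : q + m + n = t by lia.
have F : p + (q + m) = v + m by lia.
rewrite (gcompE er (g Y) (f Y) e1 erefl E1) (gcompE er (g X) (f X) e2 erefl E2).
rewrite (mh_act f e erefl erefl F) (linZ (gm_lin _ _)) (mh_act g F E1 E2 e3).
by rewrite scalerA -er !sgE mulrC.
Defined.

Definition mid M : modhom M M 0.
Proof.
exists (fun X => gid (M X)) => X Y p q v s t e e1 e2 e3 u x.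
have Es : v = s by lia.
have Et : q = t by lia.
by move: e1 e2 e3; subst s t => e1 e2 e3; rewrite !gidE mul0r scale1r (eq_irrelevance e e3).
Defined.

Lemma mcompA M N L K m n l mn nl s (e1 : l + n = nl) (e2 : n + m = mn)
    (e3 : nl + m = s) (e4 : l + mn = s)
    (h : modhom L K l) (g : modhom N L n) (f : modhom M N m) :
  mcomp e3 (mcomp e1 h g) f = mcomp e4 h (mcomp e2 g f).
Proof.
apply: modhomP => X; apply: gmapP => p q e x.
set a := gm (f X) erefl x.
have E1 : p + m + n = p + mn by lia.
have E2 : p + mn + l = q by lia.
have E3 : p + m + nl = q by lia.
have E4 : p + m + n + l = q by lia.
have -> : gm (mcomp e3 (mcomp e1 h g) f X) e x = gm (h X) E2 (gm (g X) E1 a).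
  rewrite (gcompE e3 _ (f X) e erefl E3) (gcompE e1 (h X) (g X) E3 E1 E2).
  by [].
rewrite (gcompE e4 (h X) _ e erefl E2) (gcompE e2 (g X) (f X) erefl erefl E1).
by [].
Qed.

Lemma mcomp_linr M N L m n r (er : n + m = r) (g : modhom N L n) :
  linear (fun f : modhom M N m => mcomp er g f).
Proof.
move=> a f f'; apply: modhomP => X; apply: gmapP => p q e x.
exact: (gm_lin (g X) (gcomp_e er e) a).
Qed.

Lemma mcomp_linl M N L m n r (er : n + m = r) (f : modhom M N m) :
  linear (fun g : modhom N L n => mcomp er g f).
Proof. by move=> a g g'; apply: modhomP => X; apply: gmapP. Qed.

Lemma mcomp1m M N m (e : 0 + m = m) (f : modhom M N m) : mcomp e (mid N) f = f.
Proof.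
apply: modhomP => X; apply: gmapP => p q e' x.
by rewrite (gcompE e _ (f X) e' e' (addr0 q)) gidE.
Qed.

Lemma mcompm1 M N m (e : m + 0 = m) (f : modhom M N m) : mcomp e f (mid M) = f.
Proof.
apply: modhomP => X; apply: gmapP => p q e' x.
by rewrite (gcompE e (f X) _ e' (addr0 p) e') gidE.
Qed.

Lemma mdiff_comp M N L m n r m' n' r' (er : n + m = r) (em : m + 1 = m')
    (en : n + 1 = n') (er' : r + 1 = r') (e1 : n' + m = r') (e2 : n + m' = r')
    (g : modhom N L n) (f : modhom M N m) :
  mdiff er' (mcomp er g f)
    = mcomp e1 (mdiff en g) f + sg k n *: mcomp e2 g (mdiff em f).
Proof. by apply: modhomP => X; exact: gdiff_comp. Qed.

Lemma mdiff_id M n (e : 0 + 1 = n) : mdiff e (mid M) = 0.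
Proof. by apply: modhomP => X; exact: gdiff_id. Qed.
End ModHom.

(* The morphisms of dg-modules $F(X,-) \to F(X',-)$ and $F(-,Y) \to F(-,Y')$
   given by morphisms $X \to X'$ and $Y \to Y'$. *)
Section ActionMorphisms.
Variables (k : comPzRingType) (C D : dgcat k) (F : dgbimod C D).

Definition morl (X X' : C) (p : int) (f : hom C X X' p) :
  modhom (slicel F X) (slicel F X') p.
Proof.
exists (fun Y => @GMap k (F X Y) (F X' Y) p (fun q r e x => actl F (op_e e) f x)
          (fun q r e => ax_linr (actlP F Y) (op_e e) f)).
by move=> Y Y' q n qn s pn e1 e2 e3 e4 g x /=; exact: actlr.
Defined.

Definition morr (Y Y' : D) (p : int) (g : hom D Y Y' p) :
  modhom (slicer F Y) (slicer F Y') p.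
Proof.
exists (fun X => @GMap k (F X Y) (F X Y') p (fun q r e x => actr F (op_e e) g x)
          (fun q r e => ax_linr (actrP F X) (op_e e) g)).
move=> X X' q n qn s pn e1 e2 e3 e4 f x /=.
rewrite (actlr (op_e e3) e4 e1 (op_e e2)) scalerA sgMC.
by case: (sgP k (q * p)) => ->; rewrite ?mulrNN mulr1 scale1r.
Defined.

Lemma morl_lin X X' p : linear (@morl X X' p).
Proof.
move=> a f g; apply: modhomP => Y; apply: gmapP => q r e x.
exact: (ax_linl (actlP F Y) (op_e e) x).
Qed.

Lemma morr_lin Y Y' p : linear (@morr Y Y' p).
Proof.
move=> a f g; apply: modhomP => X; apply: gmapP => q r e x.
exact: (ax_linl (actrP F X) (op_e e) x).
Qed.

Lemma morl_comp X X' X'' p q r (e : p + q = r) (g : hom C X' X'' p) (f : hom C X X' q) :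
  morl (comp C e g f) = mcomp e (morl g) (morl f).
Proof.
apply: modhomP => Y; apply: gmapP => n s e' x; exact: (ax_comp (actlP F Y)).
Qed.

Lemma morr_comp Y Y' Y'' p q r (e : p + q = r) (g : hom D Y' Y'' p) (f : hom D Y Y' q) :
  morr (comp D e g f) = mcomp e (morr g) (morr f).
Proof.
apply: modhomP => X; apply: gmapP => n s e' x; exact: (ax_comp (actrP F X)).
Qed.

Lemma morl_id X : morl (idm C X) = mid (slicel F X).
Proof.
apply: modhomP => Y; apply: gmapP => p q e x.
have E : p = q by lia.
by move: e; subst q => e; rewrite gidE; exact: (ax_id (actlP F Y)).
Qed.

Lemma morr_id Y : morr (idm D Y) = mid (slicer F Y).
Proof.
apply: modhomP => X; apply: gmapP => p q e x.
have E : p = q by lia.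
by move: e; subst q => e; rewrite gidE; exact: (ax_id (actrP F X)).
Qed.

Lemma morl_d X X' p p' (e : p + 1 = p') (f : hom C X X' p) :
  mdiff e (morl f) = morl (cd _ e f).
Proof.
apply: modhomP => Y; apply: gmapP => q r e' x.
have E1 : q + p + 1 = r by lia.
have E2 : q + 1 + p = r by lia.
rewrite (gdiffE e _ e' erefl E1 erefl E2) /=.
rewrite (ax_d (actlP F Y) (op_e erefl) e erefl E1 (op_e e') (op_e E2)).
by rewrite addrK.
Qed.

Lemma morr_d Y Y' p p' (e : p + 1 = p') (f : hom D Y Y' p) :
  mdiff e (morr f) = morr (cd _ e f).
Proof.
apply: modhomP => X; apply: gmapP => q r e' x.
have E1 : q + p + 1 = r by lia.
have E2 : q + 1 + p = r by lia.
rewrite (gdiffE e _ e' erefl E1 erefl E2) /=.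
rewrite (ax_d (actrP F X) (op_e erefl) e erefl E1 (op_e e') (op_e E2)).
by rewrite addrK.
Qed.
End ActionMorphisms.

(* The [C]-module $X \mapsto \underline{Hom}_D(W, F(X,-))$. *)
Definition hom_weight (k : comPzRingType) (C D : dgcat k)
  (W : dgmod D) (F : dgbimod C D) : dgmod C.
Proof.
refine (@DGMod k C (fun X => homM W (slicel F X))
  (fun X X' p q r e f phi => mcomp e (morl F f) phi) _); split.
- by move=> *; exact: mcomp_linr.
- by move=> X X' p q r e phi a f g; rewrite morl_lin mcomp_linl.
- by move=> X X' X'' p q r pq qr s e1 e2 e3 e4 g f phi; rewrite morl_comp (mcompA _ e2 _ e4).
- by move=> X p e phi; rewrite morl_id mcomp1m.
- move=> X X' p q r p' q' r' e ep eq er e1 e2 f phi.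
  by rewrite /= -morl_d; exact: mdiff_comp.
Defined.

(* The bimodule $(X,Y) \mapsto \underline{Hom}_C(P(-,Y), T(-,X))$. *)
Definition hom_bimod (k : comPzRingType) (C D E : dgcat k)
  (P : dgbimod C D) (T : dgbimod C E) : dgbimod E (opcat D).
Proof.
refine (@DGBimod k E (opcat D) (fun X Y => homM (slicer P Y) (slicer T X))
  (fun Y X X' p q r e f phi => mcomp e (morr T f) phi)
  (fun X Y Y' p q r e g phi => sg k (p * q) *: mcomp (op_e e) phi (@morr k C D P Y' Y p g))
  _ _ _).
- move=> Y; split.
  + by move=> *; exact: mcomp_linr.
  + by move=> X X' p q r e phi a f g; rewrite morr_lin mcomp_linl.
  + by move=> X X' X'' p q r pq qr s e1 e2 e3 e4 g f phi; rewrite morr_comp (mcompA _ e2 _ e4).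
  + by move=> X p e phi; rewrite morr_id mcomp1m.
  + move=> X X' p q r p' q' r' e ep eq er e1 e2 f phi.
    by rewrite /= -morr_d; exact: mdiff_comp.
- move=> X; split.
  + move=> Y Y' p q r e g a phi psi; rewrite mcomp_linl scalerDr !scalerA.
    by rewrite [a * _]mulrC.
  + move=> Y Y' p q r e phi a g h; rewrite morr_lin mcomp_linr scalerDr !scalerA.
    by rewrite [a * _]mulrC.
  + move=> Y Y' Y'' p q r pq qr s e1 e2 e3 e4 g f phi.
    rewrite /= /opcomp (linZ (@morr_lin _ _ _ P _ _ _)) morr_comp.
    rewrite (linZ (mcomp_linr _ _)) (linZ (mcomp_linl _ _)) !scalerA.
    rewrite (mcompA (op_e e2) (op_e e1) (op_e e4) (op_e e3)); congr (_ *: _).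
    by case: _ / e1 {e3}; case: _ / e2 {e4}; rewrite !sgE; ring.
  + move=> Y p e phi; rewrite mul0r scale1r.
    by rewrite (_ : morr P _ = mid _) ?mcompm1 //; exact: morr_id.
  + move=> Y Y' p q r p' q' r' e ep eq er e1 e2 g phi.
    rewrite /= (linZ (@homM_lin _ _ _ _ _ _ _)).
    rewrite (mdiff_comp _ ep eq er (op_e e2) (op_e e1)) morr_d.
    rewrite scalerDr !scalerA addrC.
    have -> : sg k (p' * q) = sg k (p * q) * sg k q by rewrite -ep !sgE.
    have -> : sg k (p * q') = sg k (p * q) * sg k p by rewrite -eq !sgE.
    congr (_ + _ *: _).
    by case: (sgP k p) => ->; rewrite ?mulrN1 ?mulN1r ?opprK ?mulr1 ?mul1r.
- move=> X X' Y Y' p q n qn pn s e1 e2 e3 e4 f g phi.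
  rewrite (linZ (mcomp_linr _ _)) scalerA (mcompA e3 (op_e e1) (op_e e4) e2).
  congr (_ *: _); rewrite -e3 !sgE (sgMC k q p).
  by case: (sgP k (p * q)) => ->; ring.
Defined.

(* $A(-,X)$ and $A(X,-)$. *)
Definition rep (k : comPzRingType) (A : dgcat k) (X : A) : dgmod (opcat A) :=
  slicer (diag A) X.
Definition corep (k : comPzRingType) (A : dgcat k) (X : A) : dgmod A :=
  slicel (diag A) X.

Record mor (k : comPzRingType) (C : dgcat k) (M N : dgmod C) := Mor {
  mor_hom :> modhom M N 0;
  mor_closed : @cocycle k (homM M N) 0 mor_hom }.

Section Derived.
Variables (k : comPzRingType) (C : dgcat k).
Implicit Types M N L : dgmod C.

Definition mor_id M : mor M M := Mor (@mdiff_id k C M _ erefl : cocycle (K := homM M M) (mid M)).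

Definition mor_comp M N L (g : mor N L) (f : mor M N) : mor M L.
Proof.
exists (mcomp (addr0 0) g f).
have Hg : mdiff erefl g = 0 := mor_closed g.
have Hf : mdiff erefl f = 0 := mor_closed f.
rewrite /cocycle /= (mdiff_comp (addr0 0) erefl erefl erefl (addr0 _) (add0r _)).
rewrite Hg Hf (lin0 (mcomp_linr _ _)) (lin0 (mcomp_linl (addr0 (0 + 1)) _)).
by rewrite scaler0 addr0.
Defined.

Definition mod_iso M N : Prop :=
  exists (f : mor M N) (g : mor N M), mor_comp g f = mor_id M /\ mor_comp f g = mor_id N.

Definition homotopic M N (f g : mor M N) : Prop :=
  @coboundary k (homM M N) 0 (mor_hom f - mor_hom g).

Definition mod_acyclic M : Prop := forall X, acyclic (M X).

Definition mod_qis M N (f : mor M N) : Prop := forall X, cochain_qis (f X).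

Definition hproj_mod (P : dgmod C) : Prop :=
  forall N, mod_acyclic N -> acyclic (homM P N).

(* The derived category is the localization of the homotopy category at the
   quasi-isomorphisms: its morphisms are the formal composites [dword] of closed
   degree 0 morphisms and of formal inverses of quasi-isomorphisms, modulo the
   smallest congruence [deq] which makes the canonical map a functor on the
   homotopy category and the formal inverses actual inverses. *)
Inductive dword : dgmod C -> dgmod C -> Type :=
| dw_mor M N : mor M N -> dword M N
| dw_inv M N (f : mor M N) : mod_qis f -> dword N M
| dw_comp M N L : dword N L -> dword M N -> dword M L.

Inductive deq : forall M N, dword M N -> dword M N -> Prop :=
| deq_refl M N (u : dword M N) : deq u u
| deq_sym M N (u v : dword M N) : deq u v -> deq v u
| deq_trans M N (u v w : dword M N) : deq u v -> deq v w -> deq u w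
| deq_congr M N L (u u' : dword N L) (v v' : dword M N) :
    deq u u' -> deq v v' -> deq (dw_comp u v) (dw_comp u' v')
| deq_assoc M N L K (u : dword L K) (v : dword N L) (w : dword M N) :
    deq (dw_comp (dw_comp u v) w) (dw_comp u (dw_comp v w))
| deq_idl M N (u : dword M N) : deq (dw_comp (dw_mor (mor_id N)) u) u
| deq_idr M N (u : dword M N) : deq (dw_comp u (dw_mor (mor_id M))) u
| deq_htpy M N (f g : mor M N) : homotopic f g -> deq (dw_mor f) (dw_mor g)
| deq_comp M N L (g : mor N L) (f : mor M N) :
    deq (dw_comp (dw_mor g) (dw_mor f)) (dw_mor (mor_comp g f))
| deq_invl M N (f : mor M N) (qf : mod_qis f) :
    deq (dw_comp (dw_inv qf) (dw_mor f)) (dw_mor (mor_id M))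
| deq_invr M N (f : mor M N) (qf : mod_qis f) :
    deq (dw_comp (dw_mor f) (dw_inv qf)) (dw_mor (mor_id N)).

Definition diso M N : Prop :=
  exists (u : dword M N) (v : dword N M),
    deq (dw_comp v u) (dw_mor (mor_id M)) /\ deq (dw_comp u v) (dw_mor (mor_id N)).
End Derived.

Fact shift_e (n p q r : int) : p + q = r -> p + (q + n) = r + n.
Proof. by move<-; rewrite addrA. Qed.

Fact shift_d (n p q : int) : p + 1 = q -> p + n + 1 = q + n.
Proof. by move<-; rewrite addrAC. Qed.

(* $K[n]^p = K^{p+n}$ with differential $(-1)^n d$. *)
Definition cshift (k : comPzRingType) (K : cochain k) (n : int) : cochain k.
Proof.
refine (@Cochain k (fun p => K (p + n)) (fun p q e x => sg k n *: cd K (shift_d n e) x) _ _).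
- by move=> p q e a x y; rewrite cd_lin scalerDr !scalerA mulrC.
- by move=> p q r e e' x; rewrite (linZ (cd_lin _ _)) cdd !scaler0.
Defined.

(* As the shift functor acts on the hom complexes, $f$ acts on $M[n]$ by
   $(-1)^{n|f|} f$. *)
Definition mshift (k : comPzRingType) (C : dgcat k) (M : dgmod C) (n : int) : dgmod C.
Proof.
refine (@DGMod k C (fun X => cshift (M X) n)
  (fun X Y p q r e f x => sg k (n * p) *: act M (shift_e n e) f x) _); split => /=.
- move=> X Y p q r e f a x y; rewrite (ax_linr (actP M)) scalerDr !scalerA.
  by rewrite [a * _]mulrC.
- move=> X Y p q r e x a f g; rewrite (ax_linl (actP M)) scalerDr !scalerA.
  by rewrite [a * _]mulrC.
- move=> X Y Z p q r pq qr s e1 e2 e3 e4 g f x.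
  rewrite (linZ (ax_linr (actP M) _ _)) scalerA.
  rewrite (ax_comp (actP M) e1 (shift_e n e2) (shift_e n e3) (shift_e n e4)).
  by congr (_ *: _); rewrite -e1 !sgE.
- by move=> X p e x; rewrite mulr0 scale1r (ax_id (actP M)).
- move=> X Y p q r p' q' r' e ep eq er e1 e2 f x.
  rewrite (linZ (cd_lin _ _)) (linZ (ax_linr (actP M) _ _)) !scalerA.
  rewrite (ax_d (actP M) (shift_e n e) ep (shift_d n eq) (shift_d n er)
    (shift_e n e1) (shift_e n e2)) scalerDr !scalerA.
  congr (_ *: _ + _ *: _); last by ring.
  by rewrite -ep !sgE mulrC.
Defined.

Section Cone.
Variables (k : comPzRingType) (C : dgcat k) (M N : dgmod C) (f : mor M N).

Lemma mor_d X p q p' q' (e : p + 1 = q) (ep : p + 0 = p') (eq : q + 0 = q')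
    (e' : p' + 1 = q') (x : M X p) :
  gm (f X) eq (cd _ e x) = cd _ e' (gm (f X) ep x).
Proof.
have Hf : mdiff erefl f = 0 := mor_closed f.
have e1 : p + (0 + 1) = q' by lia.
have : gm (gdiff erefl (f X)) e1 x = 0 by rewrite -[gdiff _ _]/((mdiff erefl f) X) Hf.
by rewrite (gdiffE erefl (f X) e1 ep e' e eq) scale1r => /subr0_eq.
Qed.

Lemma mor_act X Y p q r q' r' (e : p + q = r) (eq : q + 0 = q') (er : r + 0 = r')
    (e' : p + q' = r') (u : hom C X Y p) (x : M X q) :
  gm (f Y) er (act M e u x) = act N e' u (gm (f X) eq x).
Proof. by rewrite (mh_act f e er eq e') mul0r scale1r. Qed.

Fact cone_e (p q : int) : p + 1 = q -> p + 1 + 0 = q.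
Proof. by rewrite addr0. Qed.

(* $cone(f)^p = M^{p+1} \oplus N^p$ with $d(x,y) = (-dx, f(x) + dy)$. *)
Definition ccone (X : C) : cochain k.
Proof.
refine (@Cochain k (fun p => (M X (p + 1)%R * N X p)%type)
  (fun p q e z => (- cd (M X) (shift_d 1 e) z.1,
                   gm (f X) (cone_e e) z.1 + cd (N X) e z.2)) _ _).
- move=> p q e a [x y] [x' y']; congr pair => /=.
  + by rewrite cd_lin opprD scalerN.
  + by rewrite gm_lin cd_lin scalerDr addrACA.
- move=> p q r e e' [x y]; congr pair => /=.
  + by rewrite (linN (cd_lin _ _)) cdd !oppr0.
  + rewrite (linN (gm_lin _ _)) (linD (cd_lin _ _)) cdd addr0.
    by rewrite (mor_d (shift_d 1 e) (cone_e e) (cone_e e') e') addNr.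
Defined.

Definition mcone : dgmod C.
Proof.
refine (@DGMod k C ccone (fun X Y p q r e u z =>
  (sg k p *: act M (shift_e 1 e) u z.1, act N e u z.2)) _); split => /=.
- move=> X Y p q r e u a [x y] [x' y']; congr pair => /=.
  + by rewrite (ax_linr (actP M)) scalerDr !scalerA [a * _]mulrC.
  + by rewrite (ax_linr (actP N)).
- move=> X Y p q r e [x y] a u v; congr pair => /=.
  + by rewrite (ax_linl (actP M)) scalerDr !scalerA [a * _]mulrC.
  + by rewrite (ax_linl (actP N)).
- move=> X Y Z p q r pq qr s e1 e2 e3 e4 u v [x y]; congr pair => /=.
  + rewrite (linZ (ax_linr (actP M) _ _)) scalerA -sgD e1.
    by rewrite (ax_comp (actP M) e1 (shift_e 1 e2) (shift_e 1 e3) (shift_e 1 e4)).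
  + by rewrite (ax_comp (actP N) e1 e2 e3 e4).
- move=> X p e [x y]; congr pair => /=.
  + by rewrite scale1r (ax_id (actP M)).
  + by rewrite (ax_id (actP N)).
- move=> X Y p q r p' q' r' e ep eq er e1 e2 u [x y]; congr pair => /=.
  + rewrite (linZ (cd_lin _ _)) (linN (ax_linr (actP M) _ _)).
    rewrite (ax_d (actP M) (shift_e 1 e) ep (shift_d 1 eq) (shift_d 1 er)
      (shift_e 1 e1) (shift_e 1 e2)).
    have -> : sg k p' = - sg k p by rewrite -ep !sgE mulrN1.
    by rewrite scalerDr scaleNr opprD !scalerN.
  + rewrite (linZ (gm_lin _ _)) (linD (ax_linr (actP N) e2 u)) scalerDr.
    rewrite (mor_act (shift_e 1 e) (cone_e eq) (cone_e er) e2).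
    by rewrite (ax_d (actP N) e ep eq er e1 e2) addrCA.
Defined.
End Cone.

(* $f_* \colon A(-,X) \to A(-,Y)$ for a closed degree 0 morphism $f$. *)
Definition rep_mor (k : comPzRingType) (A : dgcat k) (X Y : A) (f : hom A X Y 0)
  (cf : cocycle f) : mor (rep X) (rep Y).
Proof.
exists (morr (diag A) f); rewrite /cocycle /= morr_d.
have -> : cd _ erefl f = 0 := cf.
exact: (lin0 (@morr_lin _ _ _ (diag A) _ _ _)).
Defined.

Definition pretriangulated (k : comPzRingType) (A : dgcat k) : Prop :=
  inhabited A
  /\ (forall (X : A) (n : int), exists Y : A, diso (rep Y) (mshift (rep X) n))
  /\ (forall (X Y : A) (f : hom A X Y 0) (cf : cocycle f),
        exists Z : A, diso (rep Z) (mcone (rep_mor cf))).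

(* Closure under shifts, cones of closed degree 0 morphisms and closed degree 0
   isomorphisms of a family of dg-modules. *)
Inductive pretr_closure (k : comPzRingType) (C : dgcat k) (T : Type)
    (G : T -> dgmod C) : dgmod C -> Prop :=
| pretr_gen t : pretr_closure G (G t)
| pretr_shift M n : pretr_closure G M -> pretr_closure G (mshift M n)
| pretr_cone M N (f : mor M N) :
    pretr_closure G M -> pretr_closure G N -> pretr_closure G (mcone f)
| pretr_iso M N : mod_iso M N -> pretr_closure G M -> pretr_closure G N.

(* Membership in $pretr(B)$ and in $pretr(B^{op})$; as right modules over the
   opposite of [B] are left [B]-modules, the representables of the latter are the
   $B(X,-)$. *)
Definition in_pretr (k : comPzRingType) (B : dgcat k) (W : dgmod (opcat B)) : Prop :=
  pretr_closure (@rep k B) W.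
Definition in_pretr_op (k : comPzRingType) (B : dgcat k) (W : dgmod B) : Prop :=
  pretr_closure (@corep k B) W.

Record bimodhom (k : comPzRingType) (C D : dgcat k) (M N : dgbimod C D) (n : int) :=
  BimodHom {
  bh :> forall Y, modhom (slicer M Y) (slicer N Y) n;
  bh_act : forall Y Y' p s (e1 : n + p = s) (e2 : p + n = s) (g : hom D Y Y' p),
    mcomp e1 (bh Y') (morr M g) = sg k (n * p) *: mcomp e2 (morr N g) (bh Y) }.

Section Bimodules.
Variables (k : comPzRingType) (C D : dgcat k).
Implicit Types M N P F : dgbimod C D.

(* A bimodule is h-projective when the hom complex to every acyclic bimodule is
   acyclic; the differential of that complex is computed slicewise. *)
Definition hproj_bimod P : Prop :=
  forall N, (forall X Y, acyclic (N X Y)) ->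
  forall n n' n'' (e : n + 1 = n') (e' : n' + 1 = n'') (phi : bimodhom P N n'),
    (forall Y, mdiff e' (phi Y) = 0) ->
    exists psi : bimodhom P N n, forall Y, mdiff e (psi Y) = phi Y.

Definition bimod_resolution P F : Prop :=
  hproj_bimod P /\ exists phi : bimodhom P F 0,
    (forall Y, cocycle (phi Y : homM (slicer P Y) (slicer F Y) 0)) /\
    (forall X Y, cochain_qis (phi Y X)).
End Bimodules.

Definition mod_resolution (k : comPzRingType) (C : dgcat k) (P W : dgmod C) : Prop :=
  hproj_mod P /\ exists e : mor P W, mod_qis e.

(* Objects of $D(A,B)$ that are quasi-functors $A \to B$. *)
Definition quasi_functor (k : comPzRingType) (A B : dgcat k)
  (F : dgbimod (opcat B) A) : Prop :=
  forall X : A, exists Y : B, diso (slicer F X) (rep Y).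

(* [M] is isomorphic in the derived category to
   $\mathbb{R}\underline{Hom}_D(W,F)$, computed by an h-projective resolution
   of [W]. *)
Definition is_rhom (k : comPzRingType) (C D : dgcat k) (W : dgmod D)
  (F : dgbimod C D) (M : dgmod C) : Prop :=
  exists2 P : dgmod D, mod_resolution P W & diso M (hom_weight P F).

(* [G] is $F^{op} = \mathbb{R}\underline{Hom}_B(F,h_B)$, computed by an
   h-projective resolution of the bimodule [F]. *)
Definition is_opposite (k : comPzRingType) (A B : dgcat k)
  (F : dgbimod (opcat B) A) (G : dgbimod B (opcat A)) : Prop :=
  exists2 P, bimod_resolution P F & G = hom_bimod P (diag B).

Definition is_wholim (k : comPzRingType) (I A : dgcat k) (W : dgmod I)
  (F : dgbimod (opcat A) I) (X : A) : Prop := is_rhom W F (rep X).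

Definition is_whocolim (k : comPzRingType) (I A : dgcat k) (W : dgmod (opcat I))
  (F : dgbimod (opcat A) I) (X : A) : Prop :=
  exists2 G, is_opposite F G & is_rhom W G (corep X).

Record fincat := FinCat {
  fob :> finType;
  fhom : fob -> fob -> finType;
  fid : forall i, fhom i i;
  fcomp : forall i j l, fhom j l -> fhom i j -> fhom i l;
  fcompA : forall i j l m (h : fhom l m) (g : fhom j l) (f : fhom i j),
    fcomp (fcomp h g) f = fcomp h (fcomp g f);
  fcomp1m : forall i j (f : fhom i j), fcomp (fid j) f = f;
  fcompm1 : forall i j (f : fhom i j), fcomp f (fid i) = f }.

Arguments fhom : clear implicits.
Arguments fid : clear implicits.

Inductive is_fid (I : fincat) : forall i j : I, fhom I i j -> Prop :=
| IsFid i : is_fid (fid I i).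

Definition finite_direct (I : fincat) : Prop :=
  exists (n : nat) (d : I -> 'I_n.+1),
    forall (i j : I) (f : fhom I i j), ~ is_fid f -> (d i < d j)%N.

Section Linearization.
Variables (k : comPzRingType) (I : fincat).

(* The basis of the degree [p] part of the hom complex: all morphisms if [p] is
   0, and nothing otherwise. *)
Definition lbasis (i j : I) (p : int) : finType := {f : fhom I i j | p == 0}.

Definition lhom (i j : I) : cochain k.
Proof.
refine (@Cochain k (fun p => {ffun lbasis i j p -> k^o}) (fun p q e x => 0) _ _).
- by move=> p q e a x y; rewrite scaler0 addr0.
- by [].
Defined.

Definition lid (i : I) : lhom i i 0 := [ffun u => (val u == fid I i)%:R].

Definition lcomp (i j l : I) (p q r : int) (e : p + q = r)
    (g : lhom j l p) (f : lhom i j q) : lhom i l r :=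
  [ffun w => \sum_(v : lbasis j l p) \sum_(u : lbasis i j q)
               if fcomp (val v) (val u) == val w then g v * f u else 0].

Lemma sum_lbasis (i j : I) (p : int) (p0 : p == 0) (h : fhom I i j) (G : lbasis i j p -> k) x :
  (forall v, val v = h -> G v = x) ->
  \sum_(v : lbasis i j p) (if h == val v then G v else 0) = x.
Proof.
move=> Gx; pose v0 : lbasis i j p := exist _ h p0.
rewrite (bigD1 v0) //= eqxx (Gx v0 erefl) big1 ?addr0 // => v nv.
by case: eqP => // hv; case/eqP: nv; apply: val_inj.
Qed.

Lemma lcomp_linr i j l p q r (e : p + q = r) (g : lhom j l p) :
  linear (fun f : lhom i j q => lcomp e g f).
Proof.
move=> a f f'; apply/ffunP => w; rewrite !ffunE scaler_sumr -big_split /=.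
apply: eq_bigr => v _; rewrite scaler_sumr -big_split /=.
apply: eq_bigr => u _; rewrite !ffunE; case: ifP => _; last by rewrite scaler0 addr0.
by rewrite mulrDr mulrCA.
Qed.

Lemma lcomp_linl i j l p q r (e : p + q = r) (f : lhom i j q) :
  linear (fun g : lhom j l p => lcomp e g f).
Proof.
move=> a g g'; apply/ffunP => w; rewrite !ffunE scaler_sumr -big_split /=.
apply: eq_bigr => v _; rewrite scaler_sumr -big_split /=.
apply: eq_bigr => u _; rewrite !ffunE; case: ifP => _; last by rewrite scaler0 addr0.
by rewrite mulrDl; exact: (congr1 (+%R^~ _) (esym (mulrA _ _ _))).
Qed.

Lemma lcompA i j l m p q r pq qr s (e1 : p + q = pq) (e2 : q + r = qr)
    (e3 : pq + r = s) (e4 : p + qr = s)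
    (h : lhom l m p) (g : lhom j l q) (f : lhom i j r) :
  lcomp e3 (lcomp e1 h g) f = lcomp e4 h (lcomp e2 g f).
Proof.
apply/ffunP => w; rewrite !ffunE.
pose T (a : lbasis l m p) (b : lbasis j l q) (c : lbasis i j r) : k :=
  if fcomp (fcomp (val a) (val b)) (val c) == val w then h a * (g b * f c) else 0.
transitivity (\sum_a \sum_b \sum_c T a b c).
- transitivity (\sum_(c : lbasis i j r) \sum_a \sum_b T a b c); last first.
    by rewrite exchange_big; apply: eq_bigr => a _; rewrite exchange_big.
  rewrite exchange_big; apply: eq_bigr => c _.
  under eq_bigr => v _.
    rewrite ffunE mulr_suml (_ : (if _ then _ else _) =
      \sum_a \sum_b (if fcomp (val a) (val b) == val v then
         (if fcomp (val v) (val c) == val w then h a * (g b * f c) else 0) else 0)); last first.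
      case: ifP => _; last by rewrite big1 // => a _; rewrite big1 // => b _; case: ifP.
      apply: eq_bigr => a _; rewrite mulr_suml; apply: eq_bigr => b _.
      by case: ifP; rewrite ?mul0r ?mulrA.
    over.
  rewrite exchange_big; apply: eq_bigr => a _.
  rewrite exchange_big; apply: eq_bigr => b _.
  apply: sum_lbasis => [|v Ev]; last by rewrite /T Ev.
  by rewrite -e1 (eqP (valP a)) (eqP (valP b)).
- apply: eq_bigr => a _.
  apply/esym; under eq_bigr => v _.
    rewrite ffunE mulr_sumr (_ : (if _ then _ else _) =
      \sum_b \sum_c (if fcomp (val b) (val c) == val v then
         (if fcomp (val a) (val v) == val w then h a * (g b * f c) else 0) else 0)); last first.
      case: ifP => _; last by rewrite big1 // => b _; rewrite big1 // => c _; case: ifP.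
      apply: eq_bigr => b _; rewrite mulr_sumr; apply: eq_bigr => c _.
      by case: ifP; rewrite ?mulr0.
    over.
  rewrite exchange_big; apply: eq_bigr => b _.
  rewrite exchange_big; apply: eq_bigr => c _.
  apply: sum_lbasis => [|v Ev]; last by rewrite /T Ev fcompA.
  by rewrite -e2 (eqP (valP b)) (eqP (valP c)).
Qed.

Lemma lcomp1m i j p (e : 0 + p = p) (f : lhom i j p) : lcomp e (lid j) f = f.
Proof.
apply/ffunP => w; rewrite ffunE exchange_big /=.
rewrite (bigD1 w) //= [X in _ + X]big1 ?addr0 => [|u nu].
- rewrite (bigD1 (exist _ (fid I j) (eqxx 0))) //= fcomp1m eqxx ffunE /= eqxx mul1r.
  rewrite big1 ?addr0 // => v nv; rewrite ffunE -(inj_eq val_inj) /= in nv *.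
  by rewrite (negbTE nv) mul0r if_same.
- apply: big1 => v _; rewrite ffunE; case: (val v =P fid I j) => [->|_]; last by rewrite mul0r if_same.
  by rewrite fcomp1m (inj_eq val_inj) (negbTE nu).
Qed.

Lemma lcompm1 i j p (e : p + 0 = p) (f : lhom i j p) : lcomp e f (lid i) = f.
Proof.
apply/ffunP => w; rewrite ffunE.
rewrite (bigD1 w) //= [X in _ + X]big1 ?addr0 => [|u nu].
- rewrite (bigD1 (exist _ (fid I i) (eqxx 0))) //= fcompm1 eqxx ffunE /= eqxx mulr1.
  rewrite big1 ?addr0 // => v nv; rewrite ffunE -(inj_eq val_inj) /= in nv *.
  by rewrite (negbTE nv) mulr0 if_same.
- apply: big1 => v _; rewrite ffunE; case: (val v =P fid I i) => [->|_]; last by rewrite mulr0 if_same.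
  by rewrite fcompm1 (inj_eq val_inj) (negbTE nu).
Qed.

Definition linearization : dgcat k.
Proof.
refine (@DGCat k I lhom lid lcomp lcomp_linr lcomp_linl lcompA lcomp1m lcompm1 _).
move=> i j l p q r p' q' r' e ep eq er e1 e2 g f /=.
by rewrite (lin0 (lcomp_linl e1 f)) (lin0 (lcomp_linr e2 g)) scaler0 addr0.
Defined.
End Linearization.

(* Main.v *)
(* Everything is reduced to the contravariant functor [hom_weight _ F], which sends
   shifts and cones to shifts and cones, quasi-isomorphisms between h-projective
   modules to quasi-isomorphisms, and a representable to a slice of [F].

   (1) => (2): the class of weights whose [hom_weight] is quasi-isomorphic to a
   representable contains the representables, and is closed under shifts and cones
   because the representables of a pretriangulated dg-category are, up to
   isomorphism in the derived category.  (1) => (3) is the same argument in the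
   opposite category: applying [hom_weight _ F] to the diagonal bimodule shows that
   closure under shifts and cones can be tested on [rep] or on [corep].  The
   opposite of a quasi-functor needs an h-projective resolution of a bimodule over
   a finite direct category.  It is built by attaching one object [i] at a time, in
   increasing degree: a resolution of the mapping cone of the current
   approximation at [i] is left Kan extended along [i].  As nothing maps back from
   [i] to the objects treated before, those are not disturbed.

   (2), (3) => (1): the shift and the cone of [f : X -> Y] are weighted (co)limits
   of [f], seen as a diagram on the arrow category.  For (3) the resolution is not
   under control, but the slices of an h-projective bimodule are h-projective, as
   is seen by testing against coinduced bimodules. *)
Require Import Defs.
From mathcomp Require Import all_boot all_order all_algebra.
From mathcomp Require Import boolp zify ring.
Import Defs.

Set Implicit Arguments.
Unset Strict Implicit.
Unset Printing Implicit Defensive.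
Import GRing.Theory.
Local Open Scope ring_scope.

(** The obstacle is that the derived category is a formal localization: an isomorphism in it is a
    pair of words, from which neither a cone nor a map of hom complexes can be formed. Two facts
    bring such isomorphisms back to actual morphisms. Words induce relations on cohomology that
    respect the congruence, so a morphism that becomes invertible in the localization is a
    quasi-isomorphism. And out of an h-projective module each formal inverse can be replaced by a
    lift, so an isomorphism with h-projective source is the class of a single quasi-isomorphism;
    representables are h-projective. As lifts exist only up to homotopy, the cone must be functorial
    for squares that commute up to homotopy. The weights, being built from representables, are
    h-projective too and are their own resolutions. Bimodules over [k[I]] are handled as [I]-indexed
    diagrams of dg-modules and closed degree 0 maps, where compatibility is checked on the arrows of
    [I] alone. *)

(** * Identities in abelian groups, by reflection *)

Inductive zexp := ZVar of nat | ZZero | ZAdd of zexp & zexp | ZOpp of zexp.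

Section ZmodReflection.
Variables (V : zmodType) (env : seq V).

Fixpoint zeval (e : zexp) : V :=
  match e with
  | ZVar n => env`_n
  | ZZero => 0
  | ZAdd a b => zeval a + zeval b
  | ZOpp a => - zeval a
  end.

(* The numbers of positive and of negative occurrences of a variable. *)
Fixpoint zcount (e : zexp) (n : nat) : nat * nat :=
  match e with
  | ZVar m => ((m == n : nat), 0%N)
  | ZZero => (0%N, 0%N)
  | ZAdd a b => ((zcount a n).1 + (zcount b n).1, (zcount a n).2 + (zcount b n).2)%N
  | ZOpp a => ((zcount a n).2, (zcount a n).1)
  end.

Lemma zevalE e : zeval e =
  \sum_(i < size env) env`_i *+ (zcount e i).1 - \sum_(i < size env) env`_i *+ (zcount e i).2.
Proof.
elim: e => [n||a IHa b IHb|a IHa] /=.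
- rewrite [X in _ - X]big1 ?subr0 => [|i _]; last by rewrite mulr0n.
  have [ltn|gen] := ltnP n (size env).
    rewrite (bigD1 (Ordinal ltn)) //= eqxx mulr1n big1 ?addr0 // => i ni.
    by rewrite (_ : (n == i) = false) ?mulr0n // eq_sym; apply: negbTE.
  rewrite nth_default // big1 // => i _.
  by rewrite (_ : (n == i) = false) ?mulr0n // gtn_eqF // (leq_trans (ltn_ord i)).
- by rewrite !big1 ?subr0 // => i _; rewrite mulr0n.
- rewrite IHa IHb addrACA -opprD -!big_split /=.
  by congr (_ - _); apply: eq_bigr => i _; rewrite mulrnDr.
- by rewrite IHa opprB.
Qed.

(** Moving the negative occurrences to the other side leaves sums of natural multiples, so the test
    only compares natural numbers. *)
Lemma zmod_reflect e1 e2 :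
  all (fun i => (zcount e1 i).1 + (zcount e2 i).2 == (zcount e2 i).1 + (zcount e1 i).2)%N
    (iota 0 (size env)) -> zeval e1 = zeval e2.
Proof.
move=> /allP h; rewrite !zevalE; apply/eqP.
rewrite subr_eq addrAC eq_sym subr_eq eq_sym -!big_split /=; apply/eqP.
apply: eq_bigr => i _; rewrite -!mulrnDr; congr (_ *+ _).
by apply/eqP/h; rewrite mem_iota /=.
Qed.
End ZmodReflection.

(** Comparison by [unify] identifies atoms that agree only up to conversion. *)
Ltac zmod_index x env :=
  match env with
  | ?y :: _ => let _ := match goal with _ => unify x y end in constr:(0%N)
  | _ :: ?l => let n := zmod_index x l in constr:(S n)
  end.

Ltac zmod_atoms t env :=
  lazymatch t with
  | 0%R => env
  | (?a + ?b)%R => let env1 := zmod_atoms a env in zmod_atoms b env1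
  | (- ?a)%R => zmod_atoms a env
  | _ => match env with
         | _ => let _ := zmod_index t env in env
         | _ => constr:(t :: env)
         end
  end.

Ltac zmod_reify t env :=
  lazymatch t with
  | 0%R => constr:(ZZero)
  | (?a + ?b)%R => let ra := zmod_reify a env in let rb := zmod_reify b env in
                   constr:(ZAdd ra rb)
  | (- ?a)%R => let ra := zmod_reify a env in constr:(ZOpp ra)
  | _ => let n := zmod_index t env in constr:(ZVar n)
  end.

(* Decides identities in abelian groups. *)
Ltac zmod :=
  lazymatch goal with
  | |- @eq ?T ?a ?b =>
    let env0 := zmod_atoms a (@nil T) in
    let env := zmod_atoms b env0 in
    let ra := zmod_reify a env in
    let rb := zmod_reify b env in
    exact (@zmod_reflect _ env ra rb (erefl true))
  end.

(** * Cocycles and coboundaries *)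

Section Complexes.
Variables (k : comPzRingType) (K : cochain k).

Lemma cocycleE p (x : K p) q (e : p + 1 = q) : cocycle x -> cd K e x = 0.
Proof. by move=> cx; case: q / e. Qed.

Lemma cocycleI p (x : K p) q (e : p + 1 = q) : cd K e x = 0 -> cocycle x.
Proof. by case: q / e. Qed.

Lemma cocycle0 p : cocycle (0 : K p).
Proof. exact: (lin0 (cd_lin K _)). Qed.

Lemma cocycleD p (x y : K p) : cocycle x -> cocycle y -> cocycle (x + y).
Proof. by move=> cx cy; rewrite /cocycle (linD (cd_lin K _)) cx cy addr0. Qed.

Lemma cocycleN p (x : K p) : cocycle x -> cocycle (- x).
Proof. by move=> cx; rewrite /cocycle (linN (cd_lin K _)) cx oppr0. Qed.

Lemma cocycleB p (x y : K p) : cocycle x -> cocycle y -> cocycle (x - y).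
Proof. by move=> cx cy; apply/cocycleD/cocycleN. Qed.

(** The degree hidden in [coboundary] is determined by [p], so a primitive may be asked for in any
    degree [q] known to precede [p]. *)
Lemma cobP p (x : K p) q (e : q + 1 = p) : coboundary x -> exists y : K q, cd K e y = x.
Proof.
case=> q' [e' [y <-]]; have E : q' = q by lia.
by move: e'; subst q' => e'; exists y; rewrite (eq_irrelevance e' e).
Qed.

Lemma cobI q p (e : q + 1 = p) (y : K q) : coboundary (cd K e y).
Proof. by exists q, e, y. Qed.

Lemma cob0 p : coboundary (0 : K p).
Proof. by exists (p - 1), (subrK _ _), 0; rewrite (lin0 (cd_lin K _)). Qed.

Lemma cobD p (x y : K p) : coboundary x -> coboundary y -> coboundary (x + y).
Proof.
move=> /(cobP (subrK 1 p)) [x' <-] /(cobP (subrK 1 p)) [y' <-].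
by rewrite -(linD (cd_lin K _)); apply: cobI.
Qed.

Lemma cobN p (x : K p) : coboundary x -> coboundary (- x).
Proof.
move=> /(cobP (subrK 1 p)) [x' <-].
by rewrite -(linN (cd_lin K _)); apply: cobI.
Qed.

Lemma cobZ a p (x : K p) : coboundary x -> coboundary (a *: x).
Proof.
move=> /(cobP (subrK 1 p)) [x' <-].
by rewrite -(linZ (cd_lin K _)); apply: cobI.
Qed.

Lemma cobB p (x y : K p) : coboundary x -> coboundary y -> coboundary (x - y).
Proof. by move=> cx cy; apply/cobD/cobN. Qed.

End Complexes.

(** * Degree 0 morphisms of dg-modules, elementwise *)

Section Apply.
Variables (k : comPzRingType) (C : dgcat k).
Implicit Types M N L : dgmod C.

(** A degree 0 map lands in degree [p + 0], which is not convertible to [p]; [ap] hides this. *)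
Definition ap M N (f : modhom M N 0) X p (x : M X p) : N X p := gm (f X) (addr0 p) x.

Lemma apE M N (f : modhom M N 0) X p (e : p + 0 = p) (x : M X p) :
  gm (f X) e x = ap f x.
Proof. by rewrite (eq_irrelevance e (addr0 p)). Qed.

Lemma ap_lin M N (f : modhom M N 0) X p : linear (@ap M N f X p).
Proof. exact: gm_lin. Qed.

Lemma ap_act M N (f : modhom M N 0) X Y p q r (e : p + q = r) (u : hom C X Y p) (x : M X q) :
  ap f (act M e u x) = act N e u (ap f x).
Proof. by rewrite /ap (mh_act f e (addr0 r) (addr0 q) e) mul0r scale1r. Qed.

Lemma ap_d M N (f : mor M N) X p q (e : p + 1 = q) (x : M X p) :
  ap f (cd _ e x) = cd _ e (ap f x).
Proof. exact: mor_d. Qed.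

Lemma ap_comp M N L (g : modhom N L 0) (f : modhom M N 0) (e : 0 + 0 = 0) X p (x : M X p) :
  ap (mcomp e g f) x = ap g (ap f x).
Proof. by rewrite /ap (gcompE e _ _ _ (addr0 p) (addr0 p)). Qed.

Lemma ap_mor_comp M N L (g : mor N L) (f : mor M N) X p (x : M X p) :
  ap (mor_comp g f) x = ap g (ap f x).
Proof. exact: ap_comp. Qed.

Lemma ap_id M X p (x : M X p) : ap (mid M) x = x.
Proof. exact: gidE. Qed.

Lemma ap_mor_id M X p (x : M X p) : ap (mor_id M) x = x.
Proof. exact: gidE. Qed.

Lemma apP M N (f g : modhom M N 0) :
  (forall X p (x : M X p), ap f x = ap g x) -> f = g.
Proof.
move=> fg; apply: modhomP => X; apply: gmapP => p q e x.
have E : p = q by lia.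
by move: e; subst q => e; rewrite !apE.
Qed.

Lemma morP M N (f g : mor M N) :
  (forall X p (x : M X p), ap f x = ap g x) -> f = g.
Proof.
move=> /apP; case: f g => [f cf] [g cg] /= fg; subst g.
by congr Mor; apply: Prop_irrelevance.
Qed.

Definition transp (K : cochain k) p q (e : p = q) (x : K p) : K q :=
  match e in _ = q' return K q' with erefl => x end.

Section MkMor.
Variables (M N : dgmod C) (h : forall X p, M X p -> N X p).
Hypothesis h_lin : forall X p, linear (@h X p).
Hypothesis h_act : forall X Y p q r (e : p + q = r) (u : hom C X Y p) (x : M X q),
  h (act M e u x) = act N e u (h x).

Definition mkgm X p q (e : p + 0 = q) (x : M X p) : N X q :=
  transp (etrans (esym (addr0 p)) e) (h x).

Lemma mkgmE X p (e : p + 0 = p) (x : M X p) : mkgm e x = h x.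
Proof. by rewrite /mkgm (eq_irrelevance (etrans _ e) erefl). Qed.

(* [mkmodhom] and [mkmor] are opaque, so that simplification does not unfold the
   morphisms defined with them. *)
Lemma mkmodhom_sig : {g : modhom M N 0 | forall X p (x : M X p), ap g x = h x}.
Proof.
unshelve eexists.
  unshelve eexists (fun X => @GMap k (M X) (N X) 0 (@mkgm X) _).
  - move=> p q e; have E : p = q by lia.
    by move: e; subst q => e a x y; rewrite !mkgmE h_lin.
  - move=> X Y p q r s t e e1 e2 e3 f x.
    have Es : r = s by lia.
    have Et : q = t by lia.
    move: e1 e2 e3; subst s t => e1 e2 e3.
    by rewrite /= !mkgmE mul0r scale1r h_act (eq_irrelevance e e3).
by move=> X p x; exact: mkgmE.
Qed.

Definition mkmodhom : modhom M N 0 := sval mkmodhom_sig.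

Lemma ap_mkmodhom X p (x : M X p) : ap mkmodhom x = h x.
Proof. exact: (svalP mkmodhom_sig). Qed.

Hypothesis h_d : forall X p q (e : p + 1 = q) (x : M X p), h (cd _ e x) = cd _ e (h x).

Fact mkmor_closed : @cocycle k (homM M N) 0 mkmodhom.
Proof.
apply: modhomP => X; apply: gmapP => p q e x.
have E : p + 1 = q by lia.
rewrite (gdiffE erefl (mkmodhom X) e (addr0 p) E E (addr0 q)).
by rewrite !apE !ap_mkmodhom h_d sg0 scale1r subrr.
Qed.

Lemma mkmor_sig : {g : mor M N | forall X p (x : M X p), ap g x = h x}.
Proof. by exists (Mor mkmor_closed); exact: ap_mkmodhom. Qed.

Definition mkmor : mor M N := sval mkmor_sig.

Lemma ap_mkmor X p (x : M X p) : ap mkmor x = h x.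
Proof. exact: (svalP mkmor_sig). Qed.
End MkMor.

End Apply.

(** * Quasi-isomorphisms and homotopies *)

Section Qis.
Variables (k : comPzRingType) (C : dgcat k).
Implicit Types M N L : dgmod C.

Lemma ap_cocycle M N (f : mor M N) X p (x : M X p) : cocycle x -> cocycle (ap f x).
Proof. by move=> cx; rewrite /cocycle -ap_d cx (lin0 (ap_lin f (X := X) (p := _))). Qed.

Lemma ap_cob M N (f : mor M N) X p (x : M X p) : coboundary x -> coboundary (ap f x).
Proof. by move=> [q [e [y <-]]]; rewrite ap_d; apply: cobI. Qed.

Definition linB_ap M N (f : modhom M N 0) X p := linB (@ap_lin k C M N f X p).
Definition linD_ap M N (f : modhom M N 0) X p := linD (@ap_lin k C M N f X p).
Definition linN_ap M N (f : modhom M N 0) X p := linN (@ap_lin k C M N f X p).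
Definition lin0_ap M N (f : modhom M N 0) X p := lin0 (@ap_lin k C M N f X p).
Definition linZ_ap M N (f : modhom M N 0) X p := linZ (@ap_lin k C M N f X p).

Lemma qis_inj M N (f : mor M N) : mod_qis f ->
  forall X p (x : M X p), cocycle x -> coboundary (ap f x) -> coboundary x.
Proof. by move=> qf X p x; have [] := qf X p => + _; apply. Qed.

Lemma qis_surj M N (f : mor M N) : mod_qis f ->
  forall X p (y : N X p), cocycle y -> exists2 x : M X p, cocycle x & coboundary (y - ap f x).
Proof. by move=> qf X p y; have [] := qf X p => _; apply. Qed.

Lemma qis_comp M N L (g : mor N L) (f : mor M N) :
  mod_qis f -> mod_qis g -> mod_qis (mor_comp g f).
Proof.
move=> qf qg X p; split=> [x cx|z cz].
- rewrite -/(ap _ x) ap_mor_comp => /(qis_inj qg) h.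
  by apply: (qis_inj qf cx); apply: h; apply: ap_cocycle.
- have [y cy [qy]] := qis_surj qg cz.
  have [x cx ?] := qis_surj qf cy; move=> hz.
  exists x => //; rewrite -/(ap _ x) ap_mor_comp.
  have -> : z - ap g (ap f x) = (z - ap g y) + ap g (y - ap f x).
    by rewrite linB_ap addrA subrK.
  by apply: cobD; [exists qy | apply: ap_cob].
Qed.

Lemma qis_cancel M N L (g : mor N L) (f : mor M N) :
  mod_qis f -> mod_qis (mor_comp g f) -> mod_qis g.
Proof.
move=> qf qgf X p; split=> [y cy|z cz]; rewrite -?/(ap _ _).
- move=> hy; have [x cx hx] := qis_surj qf cy.
  have hgx : coboundary (ap (mor_comp g f) x).
    rewrite ap_mor_comp -(subKr (ap g y) (ap g (ap f x))) -linB_ap.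
    by apply: cobB => //; apply: ap_cob.
  rewrite -(subrK (ap f x) y); apply: cobD => //.
  by apply: ap_cob; apply: (qis_inj qgf cx).
- have [x cx hx] := qis_surj qgf cz.
  by exists (ap f x); [apply: ap_cocycle|rewrite -/(ap _ _) -ap_mor_comp].
Qed.

Lemma bij_qis M N (f : mor M N) :
  (forall X p (x : M X p), ap f x = 0 -> x = 0) ->
  (forall X p (y : N X p), exists x : M X p, ap f x = y) -> mod_qis f.
Proof.
move=> finj fsurj X p; split=> [x cx [q [e [y]]]|y cy].
- have [x' <-] := fsurj X q y; rewrite -ap_d -/(ap _ _) => /eqP.
  rewrite eq_sym -subr_eq0 -linB_ap => /eqP /finj /subr0_eq ->.
  exact: cobI.
- have [x fx] := fsurj X p y; exists x.
    by apply: (finj); rewrite ap_d fx.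
  by rewrite -/(ap _ _) fx subrr; apply: cob0.
Qed.

Lemma qis_id M : mod_qis (mor_id M).
Proof.
apply: bij_qis => X p x; first by rewrite ap_mor_id.
by exists x; rewrite ap_mor_id.
Qed.

Lemma iso_qis M N (f : mor M N) (g : mor N M) :
  mor_comp g f = mor_id M -> mor_comp f g = mor_id N -> mod_qis f.
Proof.
move=> gf fg; apply: bij_qis => X p x.
- by move=> fx; rewrite -(ap_mor_id x) -gf ap_mor_comp fx lin0_ap.
- by exists (ap g x); rewrite -ap_mor_comp fg ap_mor_id.
Qed.

(** The differential of a degree -1 map [h] is [d h + h d]. The intermediate degrees are free, so
    that the formula applies whatever form they take. *)
Lemma homotopicP M N (f g : mor M N) : homotopic f g <->
  exists h : modhom M N (-1), forall X p (x : M X p) p0 p1 (e0 : p + -1 = p0)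
     (c0 : p0 + 1 = p) (c1 : p + 1 = p1) (e1 : p1 + -1 = p),
     ap f x - ap g x = cd _ c0 (gm (h X) e0 x) + gm (h X) e1 (cd _ c1 x).
Proof.
split.
- move=> /(cobP (addNr 1)) [h hE]; exists h => X p x p0 p1 e0 c0 c1 e1.
  have : gm (mdiff (addNr 1) h X) (addr0 p) x = ap f x - ap g x.
    have hE' : mdiff (addNr 1) h = mor_hom f - mor_hom g := hE.
    by rewrite hE'.
  by rewrite (gdiffE (addNr 1) (h X) (addr0 p) e0 c0 c1 e1) sgN sg1 scaleN1r opprK => <-.
- case=> h hE; exists (-1), (addNr 1), h.
  apply: (@apP _ _ M N) => X p x /=.
  have E1 : p + -1 + 1 = p by lia.
  have E2 : p + 1 + -1 = p by lia.
  rewrite {1}/ap (gdiffE (addNr 1) (h X) (addr0 p) erefl E1 erefl E2) sgN sg1 scaleN1r opprK.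
  by rewrite -(hE X p x _ _ erefl E1 erefl E2).
Qed.

End Qis.

(** * Isomorphisms in the derived category *)

Section DerivedIsos.
Variables (k : comPzRingType) (C : dgcat k).
Implicit Types M N L : dgmod C.

(* The relation between cocycles induced by a word: the invariant showing that
   isomorphisms in the localization induce bijections on cohomology. *)
Fixpoint drel M N (u : dword M N) : forall X p, M X p -> N X p -> Prop :=
  match u in dword M N return forall X p, M X p -> N X p -> Prop with
  | dw_mor M N f => fun X p x y => [/\ cocycle x, cocycle y & coboundary (y - ap f x)]
  | dw_inv M N f _ => fun X p y x => [/\ cocycle x, cocycle y & coboundary (y - ap f x)]
  | dw_comp M N L u v => fun X p x z => exists y, drel v x y /\ drel u y z
  end.

Lemma drel_cocycle M N (u : dword M N) X p (x : M X p) (y : N X p) :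
  drel u x y -> cocycle x /\ cocycle y.
Proof.
elim: u x y => {M N} [M N f|M N f qf|M N L u IHu v IHv] x y /=.
- by case.
- by case.
- by case=> z [/IHv [? ?] /IHu [? ?]].
Qed.

(** Makes [drel] a relation between cohomology classes, as the equations of the localization hold on
    cocycles only up to coboundaries. *)
Lemma drel_coh M N (u : dword M N) X p (x x' : M X p) (y y' : N X p) :
  drel u x y -> cocycle x' -> cocycle y' ->
  coboundary (x' - x) -> coboundary (y' - y) -> drel u x' y'.
Proof.
elim: u x x' y y' => {M N} [M N f|M N f qf|M N L u IHu v IHv] x x' y y' /=.
- case=> cx cy h cx' cy' hx hy; split=> //.
  rewrite (_ : y' - _ = (y' - y) + (y - ap f x) - (ap f (x' - x))).
    by apply: cobB; [exact: cobD | exact: ap_cob].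
  by rewrite addrA subrK linB_ap opprB addrA subrK.
- case=> cx cy h cx' cy' hx hy; split=> //.
  rewrite (_ : x' - _ = (x' - x) + (x - ap f y) - (ap f (y' - y))).
    by apply: cobB; [exact: cobD | exact: ap_cob].
  by rewrite addrA subrK linB_ap opprB addrA subrK.
- case=> z [hv hu] cx' cy' hx hy; exists z.
  have [_ cz] := drel_cocycle hv.
  have hz : coboundary (z - z) by rewrite subrr; apply: cob0.
  by split; [exact: IHv hv cx' cz hx hz | exact: IHu hu cz cy' hz hy].
Qed.

(** Each generator of the congruence is checked on cohomology: homotopic maps agree there, and a
    formal inverse is the relation of its quasi-isomorphism read backwards. *)
Lemma deq_drel M N (u v : dword M N) : deq u v ->
  forall X p (x : M X p) (y : N X p), drel u x y <-> drel v x y.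
Proof.
have coh0 (K : cochain k) p (x : K p) : coboundary (x - x) by rewrite subrr; apply: cob0.
elim=> {M N u v}.
- by [].
- by move=> M N u v _ IH X p x y; rewrite IH.
- by move=> M N u v w _ IH1 _ IH2 X p x y; rewrite IH1.
- move=> M N L u u' v v' _ IHu _ IHv X p x y /=.
  by split=> -[z [hv hu]]; exists z; split; [apply/IHv|apply/IHu|apply/IHv|apply/IHu].
- move=> M N L K u v w X p x y /=; split.
  + by case=> z [hw [t [hv hu]]]; exists t; split => //; exists z.
  + by case=> z [[t [hw hv]] hu]; exists t; split => //; exists z.
- move=> M N u X p x y /=; split.
  + case=> z [hu [cz cy h]]; rewrite ap_id in h.
    by apply: (drel_coh hu) => //; have [] := drel_cocycle hu.
  + move=> hu; have [cx cy] := drel_cocycle hu.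
    by exists y; split=> //; split=> //; rewrite ap_id.
- move=> M N u X p x y /=; split.
  + case=> z [[cx cz h] hu]; rewrite ap_id in h.
    have [_ cy] := drel_cocycle hu; apply: (drel_coh hu) => //.
    by rewrite -opprB; apply: cobN.
  + move=> hu; have [cx cy] := drel_cocycle hu.
    by exists x; split=> //; split=> //; rewrite ap_id.
- move=> M N f g [q [e [h hE]]] X p x y /=.
  have fg : cocycle x -> coboundary (ap f x - ap g x).
    move=> cx; have [|h' h'E] := (homotopicP f g).1; first by exists q, e, h.
    have e0 : p + -1 = p - 1 by [].
    have c0 : p - 1 + 1 = p by lia.
    have e1 : p + 1 + -1 = p by lia.
    (* On a cocycle only the term [d h] of the homotopy survives. *)
    rewrite (h'E X p x _ _ e0 c0 erefl e1) cx (lin0 (gm_lin _ _)) addr0.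
    exact: cobI.
  split=> -[cx cy h1]; split=> //.
  + by rewrite -(subrK (ap f x) y) -addrA; apply: cobD => //; apply: fg.
  + rewrite -(subrK (ap g x) y) -addrA; apply: cobD => //.
    by rewrite -opprB; apply/cobN/fg.
- move=> M N L g f X p x y /=; split.
  + case=> z [[cx cz h1] [_ cy h2]]; split=> //.
    rewrite ap_comp -(subrK (ap g z) y) -addrA; apply: cobD => //.
    by rewrite -linB_ap; apply: ap_cob.
  + case=> cx cy; rewrite ap_comp => h.
    by exists (ap f x); split; split=> //; apply: ap_cocycle.
- move=> M N f qf X p x y /=; split.
  + case=> z [[cx cz h1] [cy _ h2]]; split=> //; rewrite ap_id.
    apply: (qis_inj qf); first exact: cocycleB.
    rewrite linB_ap (_ : _ - _ = (z - ap f x) - (z - ap f y)); first exact: cobB.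
    by rewrite opprB [RHS]addrC addrA subrK.
  + case=> cx cy; rewrite ap_id => h; exists (ap f x); split; split=> //;
      try exact: ap_cocycle.
    by rewrite -linB_ap; apply: ap_cob; rewrite -opprB; apply: cobN.
- move=> M N f qf X p x y /=; split.
  + case=> z [[cz cx h1] [_ cy h2]]; split=> //; rewrite ap_id.
    rewrite (_ : _ - _ = (y - ap f z) - (x - ap f z)); first exact: cobB.
    by rewrite opprB addrA subrK.
  + case=> cx cy; rewrite ap_id => h; have [z cz hz] := qis_surj qf cx.
    exists z; split; split=> //.
    rewrite (_ : _ - _ = (y - x) + (x - ap f z)); first exact: cobD.
    by rewrite addrA subrK.
Qed.

(** The relation of the word [v] inverts [f] on cohomology. It is not known to be linear, so
    injectivity is read off by evaluating the first equation at two pairs. *)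
Lemma inverse_qis M N (f : mor M N) (v : dword N M) :
  deq (dw_comp v (dw_mor f)) (dw_mor (mor_id M)) ->
  deq (dw_comp (dw_mor f) v) (dw_mor (mor_id N)) -> mod_qis f.
Proof.
move=> /deq_drel vf /deq_drel fv X p; split=> [x cx|y cy]; rewrite -?/(ap _ _).
- move=> hx.
  have [|y [[_ cy hy] hv]] := (vf X p x x).2.
    by split=> //=; rewrite ap_id subrr; apply: cob0.
  (* Since [f x] is a coboundary, [v] relates 0 to [x]; as [f 0 = 0], the composite of [v] and [f],
     which is the identity, relates 0 to [x] too. *)
  have h0 : drel v (0 : N X p) x.
    apply: (drel_coh hv) => //; try exact: cocycle0; last by rewrite subrr; apply: cob0.
    rewrite sub0r; apply: cobN; rewrite -(subrK (ap f x) y); exact: cobD.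
  have [|_ _] := (vf X p 0 x).1; last by rewrite ap_id subr0.
  exists 0; split=> //; split; try exact: cocycle0.
  by rewrite lin0_ap subr0; apply: cob0.
- have [|x [hv [cx _ hx]]] := (fv X p y y).2; last by exists x.
  by split=> //=; rewrite ap_id subrr; apply: cob0.
Qed.

Lemma diso_refl M : diso M M.
Proof. by exists (dw_mor (mor_id M)), (dw_mor (mor_id M)); split; apply: deq_idl. Qed.

Lemma diso_sym M N : diso M N -> diso N M.
Proof. by move=> [u [v [vu uv]]]; exists v, u. Qed.

Lemma deq_cancel M N L (u : dword M N) (v : dword N M) (u' : dword N L) (v' : dword L N) :
  deq (dw_comp v u) (dw_mor (mor_id M)) -> deq (dw_comp v' u') (dw_mor (mor_id N)) ->
  deq (dw_comp (dw_comp v v') (dw_comp u' u)) (dw_mor (mor_id M)).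
Proof.
move=> vu vu'; apply: deq_trans vu; apply: deq_trans (deq_assoc _ _ _) _.
apply: deq_congr (deq_refl _) _; apply: deq_trans (deq_sym (deq_assoc _ _ _)) _.
exact: deq_trans (deq_congr vu' (deq_refl _)) (deq_idl _).
Qed.

Lemma diso_trans M N L : diso M N -> diso N L -> diso M L.
Proof.
move=> [u [v [vu uv]]] [u' [v' [vu' uv']]].
by exists (dw_comp u' u), (dw_comp v v'); split; apply: deq_cancel.
Qed.

Lemma qis_diso M N (f : mor M N) : mod_qis f -> diso M N.
Proof.
by move=> qf; exists (dw_mor f), (dw_inv qf); split; [apply: deq_invl|apply: deq_invr].
Qed.

(** Unlike [diso], this is directed and provides an actual morphism, from which cones and maps of
    hom complexes can be formed. *)
Definition qisto M N : Prop := exists f : mor M N, mod_qis f.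

Lemma qisto_diso M N : qisto M N -> diso M N.
Proof. by move=> [f]; apply: qis_diso. Qed.

Lemma qisto_trans M N L : qisto M N -> qisto N L -> qisto M L.
Proof. by move=> [f qf] [g qg]; exists (mor_comp g f); apply: qis_comp. Qed.

Lemma mod_iso_diso M N : mod_iso M N -> diso M N.
Proof. by move=> [f [g [gf fg]]]; apply: (@qis_diso _ _ f); apply: iso_qis gf fg. Qed.

End DerivedIsos.

(** * Transport along equalities of degrees *)

Lemma gm_transp (k : comPzRingType) (K N : cochain k) n (f : gmap K N n) p p' q
    (E : p = p') (e : p' + n = q) (e' : p + n = q) (x : K p) :
  gm f e (transp E x) = gm f e' x.
Proof. by case: p' / E e => e; rewrite (eq_irrelevance e e'). Qed.

Lemma transp_id (k : comPzRingType) (K : cochain k) p (E : p = p) (x : K p) : transp E x = x.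
Proof. by rewrite (eq_irrelevance E erefl). Qed.

Lemma transp_transp (k : comPzRingType) (K : cochain k) p q r (E : p = q) (E' : q = r) (x : K p) :
  transp E' (transp E x) = transp (etrans E E') x.
Proof. by case: r / E'. Qed.

Lemma transp_lin (k : comPzRingType) (K : cochain k) p q (E : p = q) :
  linear (@transp k K p q E).
Proof. by case: q / E. Qed.

Lemma cd_transp (k : comPzRingType) (K : cochain k) p p' q (E : p = p') (e : p' + 1 = q)
    (e' : p + 1 = q) (x : K p) : cd K e (transp E x) = cd K e' x.
Proof. by case: p' / E e => e; rewrite (eq_irrelevance e e'). Qed.

Lemma transp_cd (k : comPzRingType) (K : cochain k) p q q' (E : q = q') (e : p + 1 = q)
    (e' : p + 1 = q') (x : K p) : transp E (cd K e x) = cd K e' x.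
Proof. by case: q' / E e' => e'; rewrite (eq_irrelevance e e'). Qed.

Lemma transp_gm (k : comPzRingType) (K N : cochain k) n (f : gmap K N n) p q q'
    (E : q = q') (e : p + n = q) (e' : p + n = q') (x : K p) :
  transp E (gm f e x) = gm f e' x.
Proof. by case: q' / E e' => e'; rewrite (eq_irrelevance e e'). Qed.

Section ActTransport.
Variables (k : comPzRingType) (C : dgcat k) (M : dgmod C).

Lemma act_transp X Y p q q' r (E : q = q') (e : p + q' = r) (e' : p + q = r)
    (u : hom C X Y p) (x : M X q) : act M e u (transp E x) = act M e' u x.
Proof. by case: q' / E e => e; rewrite (eq_irrelevance e e'). Qed.

Lemma transp_act X Y p q r r' (E : r = r') (e : p + q = r) (e' : p + q = r')
    (u : hom C X Y p) (x : M X q) : transp E (act M e u x) = act M e' u x.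
Proof. by case: r' / E e' => e'; rewrite (eq_irrelevance e e'). Qed.
End ActTransport.

(** * Algebra of composites and differentials *)

Section Compositions.
Variables (k : comPzRingType) (C : dgcat k).
Implicit Types M N L K : dgmod C.

Lemma mcomp_irr M N L m n r (e e' : n + m = r) (g : modhom N L n) (f : modhom M N m) :
  mcomp e g f = mcomp e' g f.
Proof. by rewrite (eq_irrelevance e e'). Qed.

Lemma mcompE M N L m n r (er : n + m = r) (g : modhom N L n) (f : modhom M N m)
    X p q (e : p + r = q) q' (e1 : p + m = q') (e2 : q' + n = q) (x : M X p) :
  gm (mcomp er g f X) e x = gm (g X) e2 (gm (f X) e1 x).
Proof. exact: gcompE. Qed.

Lemma mdiffE M N n n' (en : n + 1 = n') (f : modhom M N n) X p q (e : p + n' = q)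
    p' q' (e1 : p + n = q') (e2 : q' + 1 = q) (e3 : p + 1 = p')
    (e4 : p' + n = q) (x : M X p) :
  gm (mdiff en f X) e x = cd _ e2 (gm (f X) e1 x) - sg k n *: gm (f X) e4 (cd _ e3 x).
Proof. exact: gdiffE. Qed.

Definition mcomp0l M N L m n r (er : n + m = r) (f : modhom M N m) :
  mcomp er (0 : modhom N L n) f = 0 := lin0 (mcomp_linl er f).
Definition mcomp0r M N L m n r (er : n + m = r) (g : modhom N L n) :
  mcomp er g (0 : modhom M N m) = 0 := lin0 (mcomp_linr er g).
Definition mcompNl M N L m n r (er : n + m = r) (f : modhom M N m) (g : modhom N L n) :
  mcomp er (- g) f = - mcomp er g f := linN (mcomp_linl er f) g.
Definition mcompNr M N L m n r (er : n + m = r) (g : modhom N L n) (f : modhom M N m) :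
  mcomp er g (- f) = - mcomp er g f := linN (mcomp_linr er g) f.
Definition mcompZl M N L m n r (er : n + m = r) (f : modhom M N m) a (g : modhom N L n) :
  mcomp er (a *: g) f = a *: mcomp er g f := linZ (mcomp_linl er f) a g.
Definition mcompZr M N L m n r (er : n + m = r) (g : modhom N L n) a (f : modhom M N m) :
  mcomp er g (a *: f) = a *: mcomp er g f := linZ (mcomp_linr er g) a f.
Definition mcompDl M N L m n r (er : n + m = r) (f : modhom M N m) (g g' : modhom N L n) :
  mcomp er (g + g') f = mcomp er g f + mcomp er g' f := linD (mcomp_linl er f) g g'.
Definition mcompBl M N L m n r (er : n + m = r) (f : modhom M N m) (g g' : modhom N L n) :
  mcomp er (g - g') f = mcomp er g f - mcomp er g' f := linB (mcomp_linl er f) g g'.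
Definition mcompBr M N L m n r (er : n + m = r) (g : modhom N L n) (f f' : modhom M N m) :
  mcomp er g (f - f') = mcomp er g f - mcomp er g f' := linB (mcomp_linr er g) f f'.
Definition mdiffD M N n n' (e : n + 1 = n') (f g : modhom M N n) :
  mdiff e (f + g) = mdiff e f + mdiff e g := linD (@homM_lin k C M N n n' e) f g.
Definition mdiffN M N n n' (e : n + 1 = n') (f : modhom M N n) :
  mdiff e (- f) = - mdiff e f := linN (@homM_lin k C M N n n' e) f.
Definition mdiffB M N n n' (e : n + 1 = n') (f g : modhom M N n) :
  mdiff e (f - g) = mdiff e f - mdiff e g := linB (@homM_lin k C M N n n' e) f g.
Definition mdiffZ M N n n' (e : n + 1 = n') a (f : modhom M N n) :
  mdiff e (a *: f) = a *: mdiff e f := linZ (@homM_lin k C M N n n' e) a f.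
Definition mdiff0 M N n n' (e : n + 1 = n') :
  mdiff e (0 : modhom M N n) = 0 := lin0 (@homM_lin k C M N n n' e).

Lemma mor_mdiff M N (f : mor M N) n (e : 0 + 1 = n) : mdiff e f = 0.
Proof. by case: n / e; apply: mor_closed. Qed.

Lemma mdiff_comp_l M N L m n r n' r' (er : n + m = r) (en : n + 1 = n')
    (er' : r + 1 = r') (e1 : n' + m = r') (em : m + 1 = m + 1)
    (g : modhom N L n) (f : modhom M N m) :
  mdiff em f = 0 -> mdiff er' (mcomp er g f) = mcomp e1 (mdiff en g) f.
Proof.
move=> Df; have e2 : n + (m + 1) = r' by lia.
by rewrite (mdiff_comp er em en er' e1 e2) Df mcomp0r scaler0 addr0.
Qed.

Lemma mdiff_comp_r M N L m n r m' r' (er : n + m = r) (em : m + 1 = m')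
    (er' : r + 1 = r') (e2 : n + m' = r') (en : n + 1 = n + 1)
    (g : modhom N L n) (f : modhom M N m) :
  mdiff en g = 0 -> mdiff er' (mcomp er g f) = sg k n *: mcomp e2 g (mdiff em f).
Proof.
move=> Dg; have e1 : n + 1 + m = r' by lia.
by rewrite (mdiff_comp er em en er' e1 e2) Dg mcomp0l add0r.
Qed.

Lemma mdiff_comp_ml M N L m r m' r' (er : 0 + m = r) (em : m + 1 = m')
    (er' : r + 1 = r') (e2 : 0 + m' = r')
    (g : mor N L) (f : modhom M N m) :
  mdiff er' (mcomp er g f) = mcomp e2 g (mdiff em f).
Proof. by rewrite (mdiff_comp_r er em er' e2 f (mor_mdiff g erefl)) sg0 scale1r. Qed.

Lemma mdiff_comp_mr M N L n r n' r' (er : n + 0 = r) (en : n + 1 = n')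
    (er' : r + 1 = r') (e1 : n' + 0 = r')
    (g : modhom N L n) (f : mor M N) :
  mdiff er' (mcomp er g f) = mcomp e1 (mdiff en g) f.
Proof. exact: (mdiff_comp_l _ _ _ _ _ (mor_mdiff f erefl)). Qed.

End Compositions.

(** * Projections and inclusions of a mapping cone *)

Section ConeMaps.
Variables (k : comPzRingType) (C : dgcat k) (M N : dgmod C) (f : mor M N).

(** As graded maps, these projections and inclusions split the cone. [cpr1] and [cin2] are closed,
    while the differentials of [cpr2] and [cin1] recover [f]; later computations with cones use
    these rules instead of elements. *)
Definition cpr1 : modhom (mcone f) M 1.
Proof.
unshelve eexists (fun X => @GMap k (mcone f X) (M X) 1 (fun p q e z => transp e z.1) _).
  by move=> p q e a x y; rewrite transp_lin.
move=> X Y p q r s t e e1 e2 e3 u x /=.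
by case: s / e1 e3 => e3; case: t / e2 e3 => e3 /=; rewrite mul1r (eq_irrelevance e3 (shift_e 1 e)).
Defined.

Lemma cpr1E X p (e : p + 1 = p + 1) (z : mcone f X p) : gm (cpr1 X) e z = z.1.
Proof. exact: transp_id. Qed.

Definition cpr2 : modhom (mcone f) N 0.
Proof. by apply: (@mkmodhom k C (mcone f) N (fun X p z => z.2)). Defined.

Lemma cpr2E X p (z : mcone f X p) : ap cpr2 z = z.2.
Proof. exact: ap_mkmodhom. Qed.

Fact cin1_e (p q : int) : p + -1 = q -> p = q + 1.
Proof. lia. Qed.

Definition cin1 : modhom M (mcone f) (-1).
Proof.
unshelve eexists (fun X => @GMap k (M X) (mcone f X) (-1)
  (fun p q e x => (transp (cin1_e e) x, 0)) _).
  move=> p q e a x y; rewrite transp_lin; congr pair.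
  by rewrite /= scaler0 addr0.
move=> X Y p q r s t e e1 e2 e3 u x /=.
congr pair => /=; last by rewrite (lin0 (ax_linr (actP N) e3 u)) scaler0.
have E : p + q = s + 1 by lia.
rewrite (act_transp _ _ E) (transp_act _ _ E) scalerA mulNr mul1r sgN.
by case: (sgP k p) => ->; rewrite ?mulrNN mulr1 scale1r.
Defined.

Lemma cin1E X p (e : p + 1 + -1 = p) (x : M X (p + 1)) :
  gm (cin1 X) e x = ((x, 0) : mcone f X p).
Proof. by rewrite /= transp_id. Qed.

Definition cin2 : mor N (mcone f).
Proof.
apply: (@mkmor k C N (mcone f) (fun X p y => (0, y))) => //.
- by move=> X p a x y; congr pair; rewrite /= scaler0 addr0.
- move=> X Y p q r e u x; congr pair => /=.
  by rewrite (lin0 (ax_linr (actP M) _ _)) scaler0.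
- move=> X p q e x; congr pair => /=; first by rewrite (lin0 (cd_lin _ _)) oppr0.
  by rewrite (lin0 (gm_lin _ _)) add0r.
Defined.

Lemma cin2E X p (y : N X p) : ap cin2 y = ((0, y) : mcone f X p).
Proof. exact: ap_mkmor. Qed.

Lemma ap_coneE X p q (e : p + 1 = q) (z : mcone f X p) :
  cd _ e z = (- cd (M X) (shift_d 1 e) z.1,
                   gm (f X) (cone_e e) z.1 + cd (N X) e z.2).
Proof. by []. Qed.

Lemma cd_cone X p (z : mcone f X p) :
  cd _ (erefl (p + 1)) z = (- cd (M X) erefl z.1, ap f z.1 + cd (N X) erefl z.2).
Proof.
rewrite ap_coneE (eq_irrelevance (shift_d 1 erefl) erefl).
by congr pair; rewrite apE.
Qed.

Lemma cpr1_d n (e : 1 + 1 = n) : mdiff e cpr1 = 0.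
Proof.
case: n / e; apply: modhomP => X; apply: gmapP => p q e z.
have E : p + 1 + 1 = q by lia.
rewrite (mdiffE erefl cpr1 e erefl E erefl E) cpr1E.
case: q / E e => e; rewrite cpr1E cd_cone sg1 scaleN1r opprK /=.
exact: subrr.
Qed.

Lemma cpr2_d n (e : 0 + 1 = n) (e' : 0 + 1 = n) : mdiff e cpr2 = - mcomp e' f cpr1.
Proof.
case: n / e e' => e'; apply: modhomP => X; apply: gmapP => p q e z.
have E : p + 1 = q by lia.
rewrite (mdiffE erefl cpr2 e (addr0 p) E E (addr0 q)).
case: q / E e => e; rewrite [gm _ _ _]cpr2E [gm _ (addr0 (p + 1)) _]cpr2E cd_cone sg0 scale1r /=.
rewrite -[RHS]/(- gm (mcomp e' f cpr1 X) e z).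
rewrite (mcompE e' f cpr1 e erefl (addr0 _)) cpr1E -/(ap f z.1).
by rewrite opprD (addrC (- _)) (addrA (cd _ _ _)) subrr add0r.
Qed.

Lemma cin1_d n (e : -1 + 1 = n) (e' : 0 + 0 = n) : mdiff e cin1 = mcomp e' cin2 f.
Proof.
have En : n = 0 by rewrite -e'.
move: e e'; subst n => e e'; apply: modhomP => X; apply: gmapP => p q e1 x.
have E : p = q by lia.
move: e1; subst q => e1.
have E1 : p + -1 + 1 = p by lia.
have E2 : p + 1 + -1 = p by lia.
rewrite (mdiffE e cin1 e1 erefl E1 erefl E2).
rewrite (mcompE e' cin2 f e1 (addr0 p) (addr0 p)) -/(ap f x) -/(ap cin2 _) cin2E.
rewrite cin1E sgN sg1 scaleN1r opprK [gm _ _ _]/= ap_coneE; congr pair => /=.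
  by rewrite (cd_transp _ _ erefl) addNr.
rewrite (lin0 (cd_lin _ _)) !addr0.
rewrite (gm_transp _ _ _ (addr0 p)) //.
Qed.

(** The identity of the cone is the sum of [cin1 cpr1] and [cin2 cpr2]. *)
Lemma cone_decomp L n (phi : modhom (mcone f) L n) n' (e1 : n + -1 = n') (e2 : n' + 1 = n)
    (e3 : n + 0 = n) :
  phi = mcomp e2 (mcomp e1 phi cin1) cpr1 + mcomp e3 (mcomp e3 phi cin2) cpr2.
Proof.
apply: modhomP => X; apply: gmapP => p q e z.
have E1 : p + 1 + n' = q by lia.
have E2 : p + 1 + -1 = p by lia.
rewrite mhDE gmDE (mcompE e2 _ cpr1 e erefl E1) (mcompE e1 phi cin1 E1 E2 e).
rewrite (mcompE e3 _ cpr2 e (addr0 p) e) (mcompE e3 phi cin2 e (addr0 p) e).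
rewrite cpr1E cin1E -/(ap cpr2 _) cpr2E -/(ap cin2 _) cin2E -(linD (gm_lin _ _)).
congr gm; case: z => x y; congr pair => /=; by rewrite ?addr0 ?add0r.
Qed.

Lemma cpr1_in1 (e : 1 + -1 = 0) : mcomp e cpr1 cin1 = mid M.
Proof.
apply: apP => X p x; have E : p + -1 + 1 = p by lia.
rewrite ap_id {1}/ap (mcompE e cpr1 cin1 (addr0 p) erefl E) /=.
by rewrite transp_transp transp_id.
Qed.

Lemma cpr2_in2 (e : 0 + 0 = 0) : mcomp e cpr2 cin2 = mid N.
Proof. by apply: apP => X p x; rewrite ap_id ap_comp cpr2E cin2E. Qed.

Lemma cpr1_in2 (e : 1 + 0 = 1) : mcomp e cpr1 cin2 = 0.
Proof.
apply: modhomP => X; apply: gmapP => p q e' x.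
case: q / e'; rewrite (mcompE e cpr1 cin2 erefl (addr0 p) erefl) -/(ap _ _) cin2E cpr1E.
by [].
Qed.

End ConeMaps.

(** * Lifting out of h-projective modules *)

Section HProjective.
Variables (k : comPzRingType) (C : dgcat k).
Implicit Types M N L P : dgmod C.

(** For a cocycle [(x, y)], injectivity on cohomology bounds [x], as [f x = - d y], and surjectivity
    corrects that primitive of [x] by a cocycle so that [y] is bounded as well. *)
Lemma mcone_acyclic M N (f : mor M N) : mod_qis f -> mod_acyclic (mcone f).
Proof.
move=> qf X p [x y]; rewrite /cocycle cd_cone /= => -[/eqP].
rewrite oppr_eq0 => /eqP cx hxy.
have hfx : ap f x = - cd (N X) erefl y by rewrite -[LHS](addrK (cd (N X) erefl y)) hxy sub0r.
have [x0 x0E] : exists x0 : M X p, cd _ erefl x0 = x.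
  apply: cobP; apply: (qis_inj qf cx); rewrite hfx -(linN (cd_lin _ _)); exact: cobI.
have cy : cocycle (y + ap f x0).
  by rewrite /cocycle (linD (cd_lin _ _)) -ap_d x0E hfx subrr.
have [x1 cx1 /(cobP (subrK 1 p)) [y1 y1E]] := qis_surj qf cy.
pose e := subrK 1 p; exists (p - 1), e.
have E : p = p - 1 + 1 by lia.
exists ((transp E (x1 - x0) : M X (p - 1 + 1)), y1).
rewrite ap_coneE /= (cd_transp _ _ erefl) (gm_transp _ _ _ (addr0 p)) -/(ap f _).
rewrite y1E (linB (cd_lin _ _)) linB_ap x0E [cd _ _ x1]cx1 sub0r opprK.
by congr pair; rewrite addrC -[in RHS](subrK (ap f x1 - ap f x0) y) opprB !addrA.
Qed.

Fact cpair_e (p q n n1 : int) : n + 1 = n1 -> p + n = q -> p + n1 = q + 1.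
Proof. lia. Qed.

Definition cpair P M N (f : mor M N) n n1 (en : n + 1 = n1)
  (a : modhom P M n1) (b : modhom P N n) : modhom P (mcone f) n.
Proof.
unshelve eexists (fun X => @GMap k (P X) (mcone f X) n
  (fun p q e x => (gm (a X) (cpair_e en e) x, gm (b X) e x)) _).
  by move=> p q e c x y; rewrite !gm_lin.
move=> X Y p q r s t e e1 e2 e3 u x /=; congr pair => /=.
  rewrite (mh_act a e _ (cpair_e en e2) (shift_e 1 e3)) scalerA.
  by congr (_ *: _); rewrite -en !sgE.
exact: mh_act.
Defined.

Lemma cpairE P M N (f : mor M N) n n1 (en : n + 1 = n1)
    (a : modhom P M n1) (b : modhom P N n) X p q (e : p + n = q) (e1 : p + n1 = q + 1) x :
  gm (cpair f en a b X) e x = (gm (a X) e1 x, gm (b X) e x).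
Proof. by rewrite /= (eq_irrelevance e1 (cpair_e en e)). Qed.

Lemma cpr1_pair P M N (f : mor M N) n n1 (en : n + 1 = n1) (e : 1 + n = n1)
    (a : modhom P M n1) (b : modhom P N n) : mcomp e (cpr1 f) (cpair f en a b) = a.
Proof.
apply: modhomP => X; apply: gmapP => p q e' x.
have E : p + n + 1 = q by lia.
rewrite (mcompE e (cpr1 f) _ e' erefl E) /= (transp_gm _ _ _ e') //.
Qed.

Lemma cpr2_pair P M N (f : mor M N) n n1 (en : n + 1 = n1) (e : 0 + n = n)
    (a : modhom P M n1) (b : modhom P N n) : mcomp e (cpr2 f) (cpair f en a b) = b.
Proof.
apply: modhomP => X; apply: gmapP => p q e' x.
by rewrite (mcompE e (cpr2 f) _ e' e' (addr0 q)) -/(ap _ _) cpr2E.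
Qed.

Lemma cpair_eta P M N (f : mor M N) n n1 (en : n + 1 = n1) (e : 1 + n = n1) (e' : 0 + n = n)
    (phi : modhom P (mcone f) n) :
  cpair f en (mcomp e (cpr1 f) phi) (mcomp e' (cpr2 f) phi) = phi.
Proof.
apply: modhomP => X; apply: gmapP => p q e1 x.
have E : p + n1 = q + 1 by lia.
rewrite (cpairE _ _ _ _ _ E) (mcompE e _ _ E e1 erefl) (mcompE e' _ _ e1 e1 (addr0 q)).
by rewrite cpr1E -/(ap _ _) cpr2E -surjective_pairing.
Qed.

Lemma cone_ext P M N (f : mor M N) n n1 (en : 1 + n = n1) (e : 0 + n = n)
    (phi psi : modhom P (mcone f) n) :
  mcomp en (cpr1 f) phi = mcomp en (cpr1 f) psi ->
  mcomp e (cpr2 f) phi = mcomp e (cpr2 f) psi -> phi = psi.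
Proof.
move=> h1 h2; have en' : n + 1 = n1 by lia.
by rewrite -(cpair_eta en' en e phi) h1 h2 cpair_eta.
Qed.

Lemma cpair_d P M N (f : mor M N) n n1 n2 (en : n + 1 = n1) (en' : n1 + 1 = n2)
    (e : 0 + n1 = n1) (a : modhom P M n1) (b : modhom P N n) :
  mdiff en (cpair f en a b) = cpair f en' (- mdiff en' a) (mcomp e f a + mdiff en b).
Proof.
have E1 : 1 + n1 = n2 by lia.
have E2 : 1 + n = n1 by lia.
have E3 : 0 + n = n by lia.
have E4 : 0 + 1 = 1 :> int by [].
apply: (cone_ext (en := E1) (e := e)).
- rewrite cpr1_pair.
  have := mdiff_comp_r E2 en en' E1 (cpair f en a b) (cpr1_d f erefl).
  by rewrite cpr1_pair sg1 scaleN1r => ->; rewrite opprK.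
- rewrite cpr2_pair.
  have := mdiff_comp E3 en E4 en E2 e (cpr2 f) (cpair f en a b).
  rewrite cpr2_pair (cpr2_d f E4 E4) sg0 scale1r mcompNl (mcompA _ E2 _ e) cpr1_pair => ->.
  by rewrite addrA subrr add0r.
Qed.

(** The pair [(0, v)] is a closed map into the acyclic cone of [f]. Of a map bounding it, the first
    component is the lift and the second is, up to sign, the homotopy. *)
Lemma hproj_lift P M N (f : mor M N) (v : mor P N) : hproj_mod P -> mod_qis f ->
  exists u : mor P M, homotopic (mor_comp f u) v.
Proof.
move=> hP qf; have aK := mcone_acyclic qf.
have E1 : 0 + 1 = 1 :> int by []. have E2 : 1 + 1 = 2 :> int by [].
have Em : -1 + 1 = 0 :> int by [].
pose psi := cpair f E1 0 v.
have cpsi : @cocycle k (homM P (mcone f)) 0 psi.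
  apply: (@cocycleI k (homM P (mcone f)) 0 psi 1 E1).
  rewrite /= (cpair_d _ E1 E2 erefl) mdiff0 mcomp0r (mor_mdiff v E1) oppr0 add0r.
  by apply: (@cone_ext P M N f 1 2 erefl erefl); rewrite mcomp0r ?cpr1_pair ?cpr2_pair.
have [th thE] := @cobP _ (homM P (mcone f)) 0 psi (-1) Em (hP _ aK 0 psi cpsi).
have e1 : 1 + -1 = 0 :> int by [].
have e2 : 0 + -1 = -1 :> int by [].
have cu : @cocycle k (homM P M) 0 (mcomp e1 (cpr1 f) th).
  apply: (@cocycleI k (homM P M) 0 _ 1 E1) => /=.
  rewrite (mdiff_comp_r e1 Em E1 (addr0 1) th (cpr1_d f erefl)).
  by rewrite (_ : mdiff Em th = psi) // cpr1_pair scaler0.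
exists (Mor cu); exists (-1), Em, (- mcomp e2 (cpr2 f) th) => /=.
rewrite mdiffN (mdiff_comp e2 Em E1 Em e1 (addr0 0)).
rewrite (_ : mdiff Em th = psi) // sg0 scale1r cpr2_pair (cpr2_d f E1 E1).
by rewrite mcompNl (mcompA _ e1 _ (addr0 0)) opprD opprK.
Qed.

(** If [h] bounds [f u], then [(u, - h)] is a closed map of degree -1 into the acyclic cone; the
    first component of a map bounding it bounds [u] up to sign. *)
Lemma hproj_null P M N (f : mor M N) (u : mor P M) : hproj_mod P -> mod_qis f ->
  @coboundary k (homM P N) 0 (mor_comp f u) -> @coboundary k (homM P M) 0 u.
Proof.
move=> hP qf; have aK := mcone_acyclic qf.
have E1 : -1 + 1 = 0 :> int by []. have E2 : 0 + 1 = 1 :> int by [].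
have Em : -2 + 1 = -1 :> int by [].
move=> /(cobP E1) [h hE].
pose psi := cpair f E1 u (- h).
have cpsi : @cocycle k (homM P (mcone f)) (-1) psi.
  apply: (@cocycleI k (homM P (mcone f)) (-1) psi 0 E1).
  rewrite /= (cpair_d _ E1 E2 (addr0 0)) (mor_mdiff u E2) mdiffN oppr0.
  rewrite (_ : mdiff E1 h = mcomp (addr0 0) f u) // subrr.
  by apply: (@cone_ext P M N f 0 1 erefl erefl); rewrite mcomp0r ?cpr1_pair ?cpr2_pair.
have [th thE] := @cobP _ (homM P (mcone f)) (-1) psi (-2) Em (hP _ aK (-1) psi cpsi).
have e1 : 1 + -2 = -1 :> int by [].
have e2 : 1 + -1 = 0 :> int by [].
exists (-1), E1, (- mcomp e1 (cpr1 f) th) => /=.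
rewrite mdiffN (mdiff_comp_r e1 Em E1 e2 th (cpr1_d f erefl)).
by rewrite (_ : mdiff Em th = psi) // cpr1_pair sg1 scaleN1r opprK.
Qed.

(** Out of an h-projective module [hproj_lift] evaluates each formal inverse, so no calculus of
    fractions is needed. *)
Lemma dword_lift P M N (u : dword M N) : hproj_mod P -> forall f : mor P M,
  exists g : mor P N, deq (dw_comp u (dw_mor f)) (dw_mor g).
Proof.
move=> hP; elim: u => {M N} [M N h|M N h qh|M N L u IHu v IHv] f.
- by exists (mor_comp h f); apply: deq_comp.
- have [g hg] := hproj_lift f hP qh; exists g.
  apply: deq_trans (deq_congr (deq_refl _) (deq_sym (deq_htpy hg))) _.
  apply: deq_trans (deq_congr (deq_refl _) (deq_sym (deq_comp _ _))) _.
  apply: deq_trans (deq_sym (deq_assoc _ _ _)) _.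
  exact: deq_trans (deq_congr (deq_invl _) (deq_refl _)) (deq_idl _).
- have [g vg] := IHv f; have [g' ug] := IHu g; exists g'.
  apply: deq_trans (deq_assoc _ _ _) _.
  exact: deq_trans (deq_congr (deq_refl _) vg) ug.
Qed.

(** The passage from the localization back to actual morphisms: the word [u] equals the class of a
    morphism, which [inverse_qis] shows to be a quasi-isomorphism. *)
Lemma diso_qis P M : hproj_mod P -> diso P M -> qisto P M.
Proof.
move=> hP [u [v [vu uv]]].
have [f uf] := dword_lift u hP (mor_id P); exists f.
have {}uf := deq_trans (deq_sym (deq_idr u)) uf.
apply: (@inverse_qis _ _ _ _ f v).
- exact: deq_trans (deq_congr (deq_refl _) (deq_sym uf)) vu.
- exact: deq_trans (deq_congr (deq_sym uf) (deq_refl _)) uv.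
Qed.

End HProjective.

Section ActionLinearity.
Variables (k : comPzRingType) (C : dgcat k) (M : dgmod C).
Variables (X Y : C) (p q r : int) (e : p + q = r).

Definition actDr (u : hom C X Y p) x y : act M e u (x + y) = act M e u x + act M e u y :=
  linD (ax_linr (actP M) e u) x y.
Definition actZr (u : hom C X Y p) c x : act M e u (c *: x) = c *: act M e u x :=
  linZ (ax_linr (actP M) e u) c x.
Definition act0r (u : hom C X Y p) : act M e u 0 = 0 := lin0 (ax_linr (actP M) e u).
Definition actDl x (u v : hom C X Y p) : act M e (u + v) x = act M e u x + act M e v x :=
  linD (ax_linl (actP M) e x) u v.
Definition actZl x c (u : hom C X Y p) : act M e (c *: u) x = c *: act M e u x :=
  linZ (ax_linl (actP M) e x) c u.
End ActionLinearity.

(** * Functoriality of the cone up to homotopy *)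

Section ConeFunctoriality.
Variables (k : comPzRingType) (C : dgcat k) (M N M' N' : dgmod C).
Variables (f : mor M N) (f' : mor M' N') (a : mor M M') (b : mor N N').

Fact cmap_e (p : int) : p + 1 + -1 = p.
Proof. lia. Qed.

Variable h : modhom M N' (-1).
Hypothesis hE : forall X p (x : M X p) p0 p1 (e0 : p + -1 = p0)
     (c0 : p0 + 1 = p) (c1 : p + 1 = p1) (e1 : p1 + -1 = p),
     ap b (ap f x) - ap f' (ap a x) = cd _ c0 (gm (h X) e0 x) + gm (h X) e1 (cd _ c1 x).

Definition cmap : mor (mcone f) (mcone f').
Proof.
apply: (@mkmor k C (mcone f) (mcone f')
    (fun X p z => (ap a z.1, ap b z.2 + gm (h X) (cmap_e p) z.1))).
- move=> X p c [x y] [x' y']; congr pair => /=; first exact: ap_lin.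
  by rewrite (ap_lin b) gm_lin scalerDr addrACA.
- move=> X Y p q r e u [x y]; congr pair => /=; first by rewrite linZ_ap ap_act.
  rewrite actDr ap_act; congr (_ + _).
  rewrite (linZ (gm_lin _ _)) (mh_act h _ _ (cmap_e q) e) scalerA mulNr mul1r sgN.
  by case: (sgP k p) => ->; rewrite ?mulrNN mulr1 scale1r.
- move=> X p q e [x y]; case: q / e; rewrite !cd_cone /=.
  congr pair; first by rewrite linN_ap ap_d.
  rewrite linD_ap ap_d (linD (cd_lin _ _)) (linN (gm_lin _ _)).
  have /eqP := hE x (cmap_e p) erefl erefl (cmap_e _).
  by rewrite subr_eq => /eqP ->; zmod.
Defined.

Lemma ap_cmap X p (z : mcone f X p) :
  ap cmap z = (ap a z.1, ap b z.2 + gm (h X) (cmap_e p) z.1).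
Proof. exact: ap_mkmor. Qed.

(** The five lemma for the long exact sequences of the two cones, unwound on elements with the
    homotopy [h] carried along. *)
Lemma cmap_qis : mod_qis a -> mod_qis b -> mod_qis cmap.
Proof.
move=> qa qb X p; split=> [[x y] cz [q [e]]|[x' y']]; rewrite -/(ap _ _).
- case: p / e x y cz => x y; rewrite /cocycle cd_cone => -[/eqP].
  rewrite oppr_eq0 => /eqP cx hxy [z']; simpl in cx, hxy.
  rewrite cd_cone ap_cmap; case: z' => x' y' -[] /= /esym ax' /esym hy'.
  have [x1 x1E] : exists x1 : M X (q + 1), cd _ erefl x1 = x.
    by apply: cobP; apply: (qis_inj qa cx); rewrite ax' -(linN (cd_lin _ _)); apply: cobI.
  have c2 : cocycle (ap a x1 + x').
    by rewrite /cocycle (linD (cd_lin _ _)) -ap_d x1E ax' addNr.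
  have [x2 cx2 /(cobP erefl) [x3 x3E]] := qis_surj qa c2.
  (* Correcting the primitive [x1] of [x] by the cocycle [x2] turns [a t + x'] into a coboundary;
     this makes [b (y + f t)] a coboundary too. *)
  pose t := x1 - x2.
  have dt : cd _ erefl t = x by rewrite (linB (cd_lin _ _)) x1E [cd _ _ x2]cx2 subr0.
  have x'E : x' = cd _ erefl x3 - ap a t by rewrite x3E linB_ap; zmod.
  have /eqP hht := hE t (cmap_e q) erefl erefl (cmap_e _); rewrite dt subr_eq in hht.
  have cyt : cocycle (y + ap f t).
    by rewrite /cocycle (linD (cd_lin _ _)) -ap_d dt -[RHS]hxy; zmod.
  have [|y1 y1E] := @cobP _ _ _ (y + ap f t) _ erefl (qis_inj qb cyt _).
    rewrite linD_ap.
    move/eqP: hht => ->.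
    rewrite (_ : ap b y + _ = cd _ erefl y' + ap f' (x' + ap a t)
      + cd _ erefl (gm (h X) (cmap_e q) t)); last first.
      by rewrite linD_ap (_ : ap f' x' = ap b y + gm (h X) (cmap_e (q + 1)) x - cd _ erefl y'); [zmod | rewrite hy'; zmod].
    rewrite x'E subrK ap_d -!(linD (cd_lin _ _)); exact: cobI.
  exists q, erefl, (- t, y1); rewrite cd_cone /= (linN (cd_lin _ _)) linN_ap dt y1E opprK.
  by congr pair; zmod.
- rewrite /cocycle cd_cone => -[/eqP]; rewrite oppr_eq0 => /eqP cx' hxy'.
  simpl in cx', hxy'; have e := subrK 1 p.
  have [x cx /(cobP erefl) [x1 x1E]] := qis_surj qa cx'.
  have hx : ap b (ap f x) = cd _ erefl (gm (h X) (cmap_e p) x - y' - ap f' x1).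
    have /eqP := hE x (cmap_e p) erefl erefl (cmap_e _).
    rewrite [cd _ _ x]cx (lin0 (gm_lin _ _)) addr0 subr_eq => /eqP ->.
    rewrite !(linB (cd_lin _ _)) -ap_d x1E linB_ap.
    rewrite (_ : cd _ _ y' = - ap f' x'); first by zmod.
    by rewrite -[RHS]addr0 -hxy'; zmod.
  have [y yE] : exists y : N X p, cd _ erefl y = - ap f x.
    apply: cobP; apply: (qis_inj qb); first by apply/cocycleN/ap_cocycle.
    by rewrite linN_ap hx; apply/cobN/cobI.
  pose w := y' - ap b y - gm (h X) (cmap_e p) x + ap f' x1.
  have cw : cocycle w.
    rewrite /cocycle (_ : w = - (gm (h X) (cmap_e p) x - y' - ap f' x1) - ap b y); last by rewrite /w; zmod.
    by rewrite (linB (cd_lin _ _)) (linN (cd_lin _ _)) -hx -ap_d yE linN_ap; zmod.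
  have [y0 cy0 /(cobP e) [y1 y1E]] := qis_surj qb cw.
  exists (x, y + y0).
    rewrite /cocycle cd_cone /= [cd _ _ x]cx oppr0; congr pair.
    by rewrite (linD (cd_lin _ _)) yE [cd _ _ y0]cy0; zmod.
  exists (p - 1), e; have E : p = p - 1 + 1 by lia.
  exists (- (transp E x1 : M' X (p - 1 + 1)), y1).
  rewrite -/(ap cmap _) ap_cmap ap_coneE; congr pair => /=.
    by rewrite (linN (cd_lin _ _)) opprK (cd_transp _ _ erefl).
  rewrite (linN (gm_lin _ _)) (gm_transp _ _ _ (addr0 p)) -/(ap f' x1) y1E linD_ap /w.
  by zmod.
Qed.

End ConeFunctoriality.

(** Replaces a map by one between given resolutions. The lift [c] closes the square only up to
    homotopy, which is what [cmap] allows for. *)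
Lemma cmap_lift (k : comPzRingType) (C : dgcat k) (R M R' M' : dgmod C)
    (a : mor R M) (b : mor R' M') (f : mor M M') :
  hproj_mod R -> mod_qis a -> mod_qis b -> exists c : mor R R', qisto (mcone c) (mcone f).
Proof.
move=> hR qa qb; have [c /homotopicP [h hE]] := hproj_lift (mor_comp f a) hR qb.
have hE' X p (x : R X p) p0 p1 (e0 : p + -1 = p0)
   (c0 : p0 + 1 = p) (c1 : p + 1 = p1) (e1 : p1 + -1 = p) :
   ap b (ap c x) - ap f (ap a x) = cd _ c0 (gm (h X) e0 x) + gm (h X) e1 (cd _ c1 x).
  by rewrite -(hE X p x p0 p1 e0 c0 c1 e1) !ap_mor_comp.
by exists c, (cmap hE'); apply: cmap_qis.
Qed.

(** * Shifts *)

Section Shift.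
Variables (k : comPzRingType) (C : dgcat k).
Implicit Types M N : dgmod C.

Lemma sgK p (V : lmodType k) (x : V) : sg k p *: (sg k p *: x) = x.
Proof. by rewrite scalerA; case: (sgP k p) => ->; rewrite ?mulrNN mulr1 scale1r. Qed.

Lemma scaler_sg_eq0 p (V : lmodType k) (x : V) : sg k p *: x = 0 -> x = 0.
Proof. by move=> h; rewrite -(sgK p x) h scaler0. Qed.

Lemma cshift_cocycle (K : cochain k) n p (x : K (p + n)) :
  @cocycle k (cshift K n) p x <-> cocycle x.
Proof.
rewrite {1}/cocycle /=; split.
  by move=> /scaler_sg_eq0 /cocycleI.
by move=> /cocycleE ->; rewrite scaler0.
Qed.

Lemma cshift_coboundary (K : cochain k) n p (x : K (p + n)) :
  @coboundary k (cshift K n) p x <-> coboundary x.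
Proof.
split=> [[q [e [y]]]|h].
  by case: p / e x => x /= <-; apply: cobZ; apply: cobI.
have [y yE] := cobP (shift_d n (subrK 1 p)) h.
by exists (p - 1), (subrK 1 p), (sg k n *: y); rewrite /= (linZ (cd_lin _ _)) yE sgK.
Qed.

Definition shift_mor M N (f : mor M N) n : mor (mshift M n) (mshift N n).
Proof.
apply: (@mkmor k C (mshift M n) (mshift N n) (fun X p x => @ap k C M N f X (p + n) x)).
- by move=> X p a x y; exact: (@ap_lin k C M N f X (p + n) a x y).
- by move=> X Y p q r e u x /=; rewrite linZ_ap ap_act.
- by move=> X p q e x /=; rewrite linZ_ap ap_d.
Defined.

Lemma ap_shift_mor M N (f : mor M N) n X p (x : M X (p + n)) :
  ap (shift_mor f n) (x : mshift M n X p) = ap f x.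
Proof. exact: ap_mkmor. Qed.

Lemma shift_qis M N (f : mor M N) n : mod_qis f -> mod_qis (shift_mor f n).
Proof.
move=> qf X p; split=> [x /cshift_cocycle cx|y /cshift_cocycle cy]; rewrite -/(ap _ _).
  by rewrite ap_shift_mor => /cshift_coboundary h; apply/cshift_coboundary/(qis_inj qf cx).
have [x cx h] := qis_surj qf cy.
exists x; first exact/cshift_cocycle.
by rewrite -/(ap _ _) ap_shift_mor; apply/cshift_coboundary.
Qed.

Lemma qisto_shift M N n : qisto M N -> qisto (mshift M n) (mshift N n).
Proof. by move=> [f qf]; exists (shift_mor f n); apply: shift_qis. Qed.

Lemma shift_shift_diso M m n : m + n = 0 -> diso (mshift (mshift M m) n) M.
Proof.
move=> mn.
have E (p : int) : p + n + m = p by lia.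
unshelve eapply (@qis_diso k C _ _).
  apply: (@mkmor k C (mshift (mshift M m) n) M (fun X p x => transp (E p) x)).
  - by move=> X p a x y; exact: (@transp_lin k (M X) _ _ (E p) a x y).
  - move=> X Y p q r e u x /=; rewrite !(linZ (@transp_lin k (M Y) _ _ (E r))) scalerA.
    have e' : p + (q + n + m) = r by rewrite E.
    rewrite (transp_act _ _ e') (act_transp _ _ e') -sgD -mulrDl addrC mn mul0r.
    by rewrite scale1r.
  - move=> X p q e x /=; rewrite !(linZ (@transp_lin k (M X) _ _ (E q))) scalerA.
    have e' : p + n + m + 1 = q by rewrite E.
    by rewrite (transp_cd _ _ e') (cd_transp _ _ e') -sgD addrC mn scale1r.
apply: bij_qis => X p x.
- rewrite ap_mkmor => h.
  have e : p = p + n + m by rewrite E.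
  have : transp e (transp (E p) (x : M X (p + n + m))) = 0.
    by rewrite h (lin0 (transp_lin _)).
  by rewrite transp_transp transp_id.
- exists (transp (esym (E p)) x); rewrite ap_mkmor transp_transp; exact: transp_id.
Qed.

Fact munsh_e (p q n m : int) : n + m = 0 -> p + m = q -> p = q + n.
Proof. lia. Qed.

(** The identity of the underlying graded modules as an isomorphism of degree [n]. The signs in the
    differential and the action of [mshift] are those for which it is closed, so shifts can be
    treated by composing with it and with its inverse [munsh]. *)
Definition msh M n : modhom (mshift M n) M n.
Proof.
unshelve eexists (fun X => @GMap k (mshift M n X) (M X) n (fun p q e x => transp e x) _).
  by move=> p q e a x y; exact: (@transp_lin k (M X) _ _ e a x y).
move=> X Y p q r s t e e1 e2 e3 u x /=.
case: s / e1 e3 => e3; case: t / e2 e3 => e3 /=.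
by rewrite (eq_irrelevance e3 (shift_e n e)).
Defined.

Definition munsh M n m (nm : n + m = 0) : modhom M (mshift M n) m.
Proof.
unshelve eexists (fun X => @GMap k (M X) (mshift M n X) m
   (fun p q e x => transp (munsh_e nm e) x) _).
  by move=> p q e a x y; exact: (@transp_lin k (M X) _ _ (munsh_e nm e) a x y).
move=> X Y p q r s t e e1 e2 e3 u x /=.
have E : p + q = s + n by lia.
rewrite (act_transp _ _ E) (transp_act _ _ E) scalerA.
have -> : m = - n by lia.
rewrite mulNr sgN.
by case: (sgP k (n * p)) => ->; rewrite ?mulrNN mulr1 scale1r.
Defined.

Lemma msh_unsh M n m (nm : n + m = 0) : mcomp nm (msh M n) (munsh M nm) = mid M.
Proof.
apply: apP => X p x; have E : p + m + n = p by lia.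
by rewrite ap_id {1}/ap (mcompE nm _ _ (addr0 p) erefl E) /= transp_transp transp_id.
Qed.

Lemma munsh_sh M n m (nm : n + m = 0) (e : m + n = 0) :
  mcomp e (munsh M nm) (msh M n) = mid (mshift M n).
Proof.
apply: apP => X p x; have E : p + n + m = p by lia.
rewrite ap_id {1}/ap (mcompE e _ _ (addr0 p) erefl E) /=; exact: (@transp_id k (M X)).
Qed.

Lemma msh_d M n n' (e : n + 1 = n') : mdiff e (msh M n) = 0.
Proof.
apply: modhomP => X; apply: gmapP => p q e' x.
have E1 : p + n + 1 = q by lia.
have E2 : p + 1 + n = q by lia.
rewrite (mdiffE e _ e' erefl E1 erefl E2) /= (linZ (transp_lin _)) sgK.
by rewrite (transp_cd _ _ E1) subrr.
Qed.

Lemma munsh_d M n m (nm : n + m = 0) m' (e : m + 1 = m') : mdiff e (munsh M nm) = 0.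
Proof.
apply: modhomP => X; apply: gmapP => p q e' x.
have E1 : p + m + 1 = q by lia.
have E2 : p + 1 + m = q by lia.
rewrite (mdiffE e _ e' erefl E1 erefl E2) /=.
have -> : sg k m = sg k n by have -> : m = - n by [lia]; rewrite sgN.
have E : p + 1 = q + n by lia.
by rewrite (cd_transp _ _ E) (transp_cd _ _ E) subrr.
Qed.

End Shift.

(** * Closure properties of h-projective modules *)

Section HProjClosure.
Variables (k : comPzRingType) (C : dgcat k).
Implicit Types M N P : dgmod C.

Lemma hproj_shift M n : hproj_mod M -> hproj_mod (mshift M n).
Proof.
move=> hM N aN p phi cphi.
have nm : n + - n = 0 by lia.
have e1 : p + - n = p - n by [].
have cx : @cocycle k (homM M N) (p - n) (mcomp e1 phi (munsh M nm)).
  rewrite /cocycle /=.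
  have E : p + 1 + - n = p - n + 1 by lia.
  rewrite (mdiff_comp_l e1 erefl erefl E (em := erefl) _ (munsh_d _ _ _)).
  by rewrite (_ : mdiff erefl phi = 0) ?mcomp0l.
have e2 : p - n - 1 + 1 = p - n by lia.
have [psi psiE] := @cobP _ (homM M N) _ _ _ e2 (hM N aN _ _ cx).
have e3 : p - n - 1 + n = p - 1 by lia.
have e4 : p - n + n = p by lia.
exists (p - 1), (subrK 1 p), (mcomp e3 psi (msh M n)) => /=.
rewrite (mdiff_comp_l e3 e2 _ e4 (em := erefl) _ (msh_d _ _)).
rewrite (_ : mdiff e2 psi = mcomp e1 phi (munsh M nm)) // (mcompA _ (addNr n) _ (addr0 p)).
by rewrite munsh_sh mcompm1.
Qed.

Lemma hproj_retract M N (f : mor M N) (g : mor N M) :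
  mor_comp f g = mor_id N -> hproj_mod M -> hproj_mod N.
Proof.
move=> fg hM L aL p phi cphi.
have e : p + 0 = p := addr0 p.
have cx : @cocycle k (homM M L) p (mcomp e phi f).
  rewrite /cocycle /= (mdiff_comp_mr e erefl erefl (addr0 _)).
  by rewrite (_ : mdiff erefl phi = 0) ?mcomp0l.
have e2 : p - 1 + 1 = p := subrK 1 p.
have [psi psiE] := @cobP _ (homM M L) _ _ _ e2 (hM L aL _ _ cx).
exists (p - 1), e2, (mcomp (addr0 _) psi g) => /=.
rewrite (mdiff_comp_mr _ e2 _ e) (_ : mdiff e2 psi = mcomp e phi f) //.
rewrite (mcompA _ (addr0 0) _ e).
by rewrite -[mcomp (addr0 0) f g]/(mor_hom (mor_comp f g)) fg mcompm1.
Qed.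

Section ConeExtension.
Variables (M N L : dgmod C) (f : mor M N) (p p1 : int) (phi : modhom (mcone f) L p).
Variables (e0 : p + 0 = p) (e1 : p1 + 1 = p) (e2 : p1 + 0 = p1) (e4 : p + -1 = p1).
Hypothesis phi_closed : mdiff erefl phi = 0.
Variable b : modhom N L p1.
Hypothesis bE : mdiff e1 b = mcomp e0 phi (cin2 f).

(* What remains to be bounded on [M] once [phi] is bounded by [b] on [N]. *)
Definition cone_rest : modhom M L p1 :=
  mcomp e4 phi (cin1 f) - sg k p *: mcomp e2 b f.

Lemma cone_rest_closed : mdiff e1 cone_rest = 0.
Proof.
have E0 : 0 + 0 = 0 :> int by [].
have E : p + 1 + -1 = p by lia.
rewrite mdiffB mdiffZ (mdiff_comp e4 (addNr 1) erefl e1 E e0) (cin1_d f _ E0).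
rewrite phi_closed mcomp0l add0r.
by rewrite (mdiff_comp_mr e2 e1 e1 e0) bE (mcompA _ E0 _ e0) subrr.
Qed.

(** Kept apart from [hproj_cone] because cones of diagrams use the same formula at every object,
    with [a] and [b] natural. *)
Lemma cone_extend p2 (e3 : p2 + 1 = p1) (a : modhom M L p2) :
  mdiff e3 a = cone_rest -> mdiff e1 (mcomp e3 a (cpr1 f) + mcomp e2 b (cpr2 f)) = phi.
Proof.
move=> aE; rewrite mdiffD (mdiff_comp_l e3 e3 e1 e1 (em := erefl) _ (cpr1_d _ _)) aE.
rewrite (mdiff_comp e2 (add0r 1) e1 e1 e0 e1) bE (cpr2_d f _ (add0r 1)).
rewrite mcompBl mcompZl mcompNr (mcompA e2 (add0r 1) e1 e1) [RHS](cone_decomp phi e4 e1 e0).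
have -> : sg k p = - sg k p1 by rewrite -[X in sg k X = _]e1 !sgE mulrN1.
by rewrite scaleNr scalerN; zmod.
Qed.
End ConeExtension.

Lemma hproj_cone M N (f : mor M N) : hproj_mod M -> hproj_mod N -> hproj_mod (mcone f).
Proof.
move=> hM hN L aL p phi cphi.
have e0 : p + 0 = p := addr0 p.
have e1 : p - 1 + 1 = p := subrK 1 p.
have e2 : p - 1 + 0 = p - 1 := addr0 _.
have e3 : p - 1 - 1 + 1 = p - 1 by lia.
have e4 : p + -1 = p - 1 by [].
have cb : @cocycle k (homM N L) p (mcomp e0 phi (cin2 f)).
  rewrite /cocycle /= (mdiff_comp_mr e0 erefl erefl (addr0 _)).
  by rewrite (_ : mdiff erefl phi = 0) ?mcomp0l.
have [b bE] := @cobP _ (homM N L) _ _ _ e1 (hN L aL _ _ cb).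
have ca : @cocycle k (homM M L) (p - 1) (cone_rest phi e2 e4 b).
  apply: (@cocycleI k (homM M L) _ _ p e1); exact: cone_rest_closed bE.
have [a aE] := @cobP _ (homM M L) _ _ _ e3 (hM L aL _ _ ca).
exists (p - 1), e1, (mcomp e3 a (cpr1 f) + mcomp e2 b (cpr2 f)).
exact: (cone_extend bE aE).
Qed.

(** Applied to representables, this makes every weight its own h-projective resolution. *)
Lemma pretr_hproj T (G : T -> dgmod C) : (forall t, hproj_mod (G t)) ->
  forall W, pretr_closure G W -> hproj_mod W.
Proof.
move=> hG W; elim=> {W}.
- exact: hG.
- by move=> M n _; apply: hproj_shift.
- by move=> M N f _ hM _ hN; apply: hproj_cone.
- by move=> M N [f [g [gf fg]]] _; apply: hproj_retract fg.
Qed.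

End HProjClosure.

(** * The Yoneda lemma for dg-modules *)

Section Yoneda.
Variables (k : comPzRingType) (D : dgcat k).
Implicit Types M N : dgmod D.

(** The sign is the Koszul sign for exchanging [x], of degree [p], and [a], of degree [q]. *)
Definition yon M (i : D) p (x : M i p) : modhom (corep i) M p.
Proof.
unshelve eexists (fun Y => @GMap k (corep i Y) (M Y) p
  (fun q r e a => sg k (p * q) *: act M e (a : hom D i Y q) x) _).
  by move=> q r e c a b; rewrite (ax_linl (actP M) e x) scalerDr !scalerA [c * _]mulrC.
move=> X Y q n r s t e e1 e2 e3 f a /=.
rewrite actZr scalerA (ax_comp (actP M) e e2 e1 e3).
by congr (_ *: _); rewrite -e mulrDr sgD.
Defined.

Lemma yonE M i p (x : M i p) Y q r (e : q + p = r) (a : hom D i Y q) :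
  gm (yon x Y) e a = sg k (p * q) *: act M e a x.
Proof. by []. Qed.

Lemma yon_lin M i p : linear (@yon M i p).
Proof.
move=> c x y; apply: modhomP => Y; apply: gmapP => q r e a.
rewrite -[RHS]/(c *: gm (yon x Y) e a + gm (yon y Y) e a) !yonE.
by rewrite actDr actZr scalerDr !scalerA [c * _]mulrC.
Qed.

Lemma yon_d M i p q (e : p + 1 = q) (x : M i p) : mdiff e (yon x) = yon (cd _ e x).
Proof.
apply: modhomP => Y; apply: gmapP => n r e' a.
have E1 : n + p + 1 = r by lia.
have E2 : n + 1 + p = r by lia.
rewrite (mdiffE e (yon x) e' erefl E1 erefl E2) !yonE (linZ (cd_lin _ _)).
rewrite (ax_d (actP M) erefl erefl e E1 E2 e') scalerDr !scalerA.
have -> : sg k p * sg k (p * (n + 1)) = sg k (p * n).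
  rewrite mulrDr mulr1 sgD mulrCA.
  by case: (sgP k p) => ->; rewrite ?(mulrNN, mulr1).
have -> : sg k (q * n) = sg k (p * n) * sg k n by rewrite -e mulrDl mul1r sgD.
by rewrite [cd (corep i Y) _ a]/=; zmod.
Qed.

Lemma yon_id M i p (x : M i p) (e : 0 + p = p) : gm (yon x i) e (idm D i) = x.
Proof. by rewrite yonE mulr0 scale1r (ax_id (actP M)). Qed.

Lemma yon_eta M i p (phi : modhom (corep i) M p) (e : 0 + p = p) :
  yon (gm (phi i) e (idm D i)) = phi.
Proof.
apply: modhomP => Y; apply: gmapP => q r e' a.
rewrite yonE -(mh_act phi (addr0 q) e' e e' a (idm D i : corep i i 0)).
by congr gm; exact: compm1.
Qed.

(** By Yoneda the hom complex from [corep i] to [N] is [N i], which is acyclic by hypothesis. *)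
Lemma hproj_corep (i : D) : hproj_mod (corep i).
Proof.
move=> N aN p phi cphi; rewrite -(yon_eta phi (add0r p)) in cphi *.
set x := gm _ _ _ in cphi *.
have cx : cocycle x.
  have : gm (yon (cd _ erefl x) i) (add0r _) (idm D i) = 0.
    by rewrite -yon_d (_ : mdiff erefl (yon x) = 0).
  by rewrite yon_id.
have [y yE] := cobP (subrK 1 p) (aN i p x cx).
by exists (p - 1), (subrK 1 p), (yon y); rewrite -yE; apply: yon_d.
Qed.
End Yoneda.

(** * [hom_weight] as a contravariant functor of the weight *)

Section HomWeight.
Variables (k : comPzRingType) (C D : dgcat k) (F : dgbimod C D).
Implicit Types M N W : dgmod D.

Definition hw_map M N (f : mor M N) : mor (hom_weight N F) (hom_weight M F).
Proof.
apply: (@mkmor k C (hom_weight N F) (hom_weight M F)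
  (fun X p (phi : modhom N (slicel F X) p) => mcomp (addr0 p) phi f)).
- by move=> X p; exact: mcomp_linl.
- by move=> X Y p q r e u phi /=; rewrite (mcompA e (addr0 q) _ e).
- by move=> X p q e phi /=; rewrite (mdiff_comp_mr (addr0 p) e e (addr0 q)).
Defined.

Lemma ap_hw_map M N (f : mor M N) X p (phi : modhom N (slicel F X) p) (e : p + 0 = p) :
  ap (hw_map f) (phi : hom_weight N F X p) = mcomp e phi f.
Proof. by rewrite ap_mkmor (mcomp_irr _ e). Qed.

Lemma gm_hw_map M N (f : mor M N) X p q (phi : modhom N (slicel F X) p) (e : p + 0 = q) :
  gm (hw_map f X) e (phi : hom_weight N F X p) = mcomp e phi f.
Proof.
have E : p = q by lia.
by move: e; subst q => e; rewrite apE (ap_hw_map f phi e).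
Qed.

(** Lifting the identity gives [g] with [f g] homotopic to 1. Then [f (g f - 1)] equals
    [(f g - 1) f], which is null-homotopic, and [hproj_null] cancels [f]. *)
Lemma hproj_inverse M N (f : mor M N) : hproj_mod M -> hproj_mod N -> mod_qis f ->
  exists g : mor N M, homotopic (mor_comp f g) (mor_id N) /\ homotopic (mor_comp g f) (mor_id M).
Proof.
move=> hM hN qf; have [g hg] := hproj_lift (mor_id N) hN qf; exists g; split=> //.
have cfgf : @cocycle k (homM M M) 0 (mcomp (addr0 0) g f - mid M).
  exact: (@cocycleB k (homM M M) 0 _ _ (mor_closed (mor_comp g f)) (mor_closed (mor_id M))).
apply: (@hproj_null k D M M N f (Mor cfgf) hM qf).
have e : -1 + 1 = 0 :> int by [].
have [h hE] := cobP e hg; have {}hE : mdiff e h = mcomp (addr0 0) f g - mid N := hE.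
exists (-1), e, (mcomp (addr0 (-1)) h f) => /=.
rewrite (mdiff_comp_mr (addr0 _) e e (addr0 0)) hE mcompBl mcompBr.
by rewrite (mcompA (addr0 0) (addr0 0) (addr0 0) (addr0 0)) mcomp1m mcompm1.
Qed.

Lemma hw_qis M N (f : mor M N) : hproj_mod M -> hproj_mod N -> mod_qis f ->
  mod_qis (hw_map f).
Proof.
move=> hM hN qf; have [g [fg gf]] := hproj_inverse hM hN qf.
have e : -1 + 1 = 0 :> int by [].
have [h hE] := cobP e fg; have {fg}hE : mdiff e h = mcomp (addr0 0) f g - mid N := hE.
have [h' h'E] := cobP e gf; have {gf}h'E : mdiff e h' = mcomp (addr0 0) g f - mid M := h'E.
(* Precomposition with a map homotopic to the identity changes a closed [psi] by a coboundary only;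
   both homotopies [h] and [h'] are used through this. *)
have null L (phi : modhom L L 0) (th : modhom L L (-1)) X p (psi : modhom L (slicel F X) p) :
    mdiff e th = phi - mid L -> mdiff erefl psi = 0 ->
    @coboundary k (homM L (slicel F X)) p (mcomp (addr0 p) psi phi - psi).
  move=> thE cpsi.
  have -> : mcomp (addr0 p) psi phi - psi = mcomp (addr0 p) psi (mdiff e th).
    by rewrite thE mcompBr mcompm1.
  have e1 : p + -1 = p - 1 by [].
  exists (p - 1), (subrK 1 p), (sg k p *: mcomp e1 psi th) => /=.
  by rewrite mdiffZ (mdiff_comp_r e1 e _ (addr0 p) _ cpsi) sgK.
move=> X p; split=> [phi cphi|psi cpsi]; rewrite -/(ap _ _).
- rewrite (ap_hw_map f phi (addr0 p)) => hphi.
  have [chi chiE] := cobP (subrK 1 p) hphi.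
  have {}chiE : mdiff (subrK 1 p) chi = mcomp (addr0 p) phi f := chiE.
  have -> : phi = mcomp (addr0 p) (mcomp (addr0 p) phi f) g
      - (mcomp (addr0 p) phi (mcomp (addr0 0) f g) - phi).
    by rewrite (mcompA _ (addr0 0) _ (addr0 p)); zmod.
  apply: cobB; last exact: null hE cphi.
  exists (p - 1), (subrK 1 p), (mcomp (addr0 _) chi g) => /=.
  by rewrite (mdiff_comp_mr _ (subrK 1 p) _ (addr0 p)) chiE.
- exists (mcomp (addr0 p) psi g).
    rewrite /cocycle /= (mdiff_comp_mr _ erefl _ (addr0 _)).
    by rewrite (_ : mdiff erefl psi = 0) ?mcomp0l.
  rewrite -/(ap _ _) (ap_hw_map f _ (addr0 p)) (mcompA _ (addr0 0) _ (addr0 p)).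
  by rewrite -opprB; apply: cobN; apply: null h'E cpsi.
Qed.

(** Precomposition with the closed map [msh] commutes with the differentials of the hom complexes;
    the factor [sg k (n * p)] absorbs the sign that the shift by [- n] puts on the differential and
    on the action. *)
Lemma hw_shift W n : qisto (mshift (hom_weight W F) (- n)) (hom_weight (mshift W n) F).
Proof.
have e p : p + - n + n = p by lia.
have e' p : p + - n = p - n by lia.
unshelve eapply ex_intro.
  apply: (@mkmor k C (mshift (hom_weight W F) (- n)) (hom_weight (mshift W n) F)
    (fun X p (psi : modhom W (slicel F X) (p + - n)) => sg k (n * p) *: mcomp (e p) psi (msh W n))).
  - move=> X p a psi psi' /=.
    by rewrite (mcomp_linl (e p) (msh W n) a psi psi') scalerDr !scalerA [a * _]mulrC.
  - move=> X Y p q r E u psi /=.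
    rewrite mcompZl mcompZr !scalerA (mcompA _ (e q) _ E); congr (_ *: _).
    rewrite -E mulrDr sgD mulNr sgN mulrC mulrCA mulrA; case: (sgP k (n * p)) => ->; ring.
  - move=> X p q E psi /=.
    rewrite mdiffZ mcompZl scalerA.
    rewrite (mdiff_comp_l (e p) (shift_d (- n) E) _ (e q) (em := erefl) _ (msh_d _ _)).
    congr (_ *: _); rewrite -E mulrDr sgD mulr1 sgN.
    by case: (sgP k n) => ->; rewrite ?(mulrN1, mulNr, opprK, mulr1).
apply: bij_qis => X p.
- move=> psi; rewrite ap_mkmor => /scaler_sg_eq0 h.
  have e0 : p + - n + 0 = p + - n := addr0 _.
  rewrite -[psi](mcompm1 e0) -(msh_unsh W (subrr n)) -(mcompA (e p) _ erefl).
  by rewrite h mcomp0l.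
- move=> phi; exists (sg k (n * p) *: mcomp erefl phi (munsh W (subrr n))).
  rewrite ap_mkmor mcompZl sgK (mcompA _ (addNr n) _ (addr0 p)).
  by rewrite munsh_sh mcompm1.
Qed.

(** A closed map out of the cone of [f] is a closed map on [N] together with, up to sign, a
    null-homotopy on [M] of its composite with [f]. Hence the homotopy fibre of [hw_map f], which is
    its cone shifted by -1. *)
Lemma hw_cone M N (f : mor M N) :
  qisto (mshift (mcone (hw_map f)) (-1)) (hom_weight (mcone f) F).
Proof.
have e1 (p : int) : p + -1 + 1 + 0 = p by lia.
have e2 (p : int) : p + -1 + 1 = p by lia.
unshelve eapply ex_intro.
  apply: (@mkmor k C (mshift (mcone (hw_map f)) (-1)) (hom_weight (mcone f) F)
    (fun X p (z : modhom N (slicel F X) (p + -1 + 1) * modhom M (slicel F X) (p + -1)) =>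
      mcomp (e1 p) z.1 (cpr2 f) - sg k p *: mcomp (e2 p) z.2 (cpr1 f))).
  - move=> X p a [x1 x2] [y1 y2] /=.
    rewrite (mcomp_linl (e1 p) (cpr2 f) a x1 y1) (mcomp_linl (e2 p) (cpr1 f) a x2 y2).
    rewrite !scalerDr scalerN !scalerA [a * _]mulrC; zmod.
  - move=> X Y p q r E u [x1 x2] /=.
    rewrite mcompBr !mcompZl !mcompZr !scalerA.
    rewrite (mcompA _ (e1 q) _ E) (mcompA _ (e2 q) _ E) mulN1r sgN.
    have -> : sg k r = sg k p * sg k q by rewrite -E sgD.
    by case: (sgP k p) => ->; rewrite ?(mulN1r, mulrN1, opprK, mul1r, mulr1, scale1r).
  - move=> X p q E [x1 x2].
    rewrite -[cd (hom_weight _ _ _) _ _]/(mdiff E (mcomp (e1 p) x1 (cpr2 f) - sg k p *: mcomp (e2 p) x2 (cpr1 f))).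
    rewrite [LHS]/= gm_hw_map mdiffB mdiffZ.
    rewrite (mdiff_comp_l (e2 p) (shift_d (-1) E) E (e2 q) (em := erefl) _ (cpr1_d _ _)).
    have e3 : p + -1 + 1 + 1 = q by lia.
    rewrite (mdiff_comp (e1 p) (add0r 1) (shift_d 1 (shift_d (-1) E)) E (e1 q) e3).
    rewrite (cpr2_d f (add0r 1) (add0r 1)) mcompNr !mcompZl mcompNl mcompDl.
    rewrite (mcompA _ (add0r 1) _ e3) sgN sg1.
    have -> : sg k (p + -1 + 1) = sg k p by rewrite (e2 p).
    have -> : sg k q = - sg k p by rewrite -E sgD sg1 mulrN1.
    rewrite !scaleN1r opprK !scaleNr !scalerN !scalerDr; zmod.
apply: bij_qis => X p.
- case=> x1 x2; rewrite ap_mkmor /= => h.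
  have e3 : p + 0 = p + -1 + 1 by lia.
  have e4 : p + -1 + 1 + 0 = p + -1 + 1 := addr0 _.
  have x10 : x1 = 0.
    rewrite -[x1](mcompm1 e4) -(cpr2_in2 f (addr0 0)) -(mcompA (e1 p) _ e3).
    rewrite -[mcomp (e1 p) _ _](subrK (sg k p *: mcomp (e2 p) x2 (cpr1 f))) h add0r mcompZl.
    by rewrite (mcompA (e2 p) (addr0 1) e3 erefl) cpr1_in2 mcomp0r scaler0.
  have x20 : x2 = 0.
    move: h; rewrite x10 mcomp0l sub0r => /eqP; rewrite oppr_eq0 => /eqP /scaler_sg_eq0 h.
    rewrite -[x2](mcompm1 (addr0 _)) -(cpr1_in1 f (subrr 1)) -(mcompA (e2 p) _ erefl).
    by rewrite h mcomp0l.
  by rewrite x10 x20.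
- move=> phi.
  have e3 : p + 0 = p + -1 + 1 by lia.
  exists ((mcomp e3 phi (cin2 f), - (sg k p *: mcomp erefl phi (cin1 f)))).
  rewrite ap_mkmor /= mcompNl mcompZl scalerN sgK opprK.
  rewrite [RHS](cone_decomp phi erefl (e2 p) (addr0 p)) addrC; congr (_ + _).
  by rewrite (mcompA e3 (addr0 0) _ (addr0 p)) (mcompA _ (addr0 0) _ (addr0 p)).
Qed.

(** The formula for [g] belongs to the conclusion because [cone_eval] needs these maps to form
    strictly commuting squares. *)
Lemma hw_yon (i : D) : exists2 g : mor (slicer F i) (hom_weight (corep i) F),
  mod_qis g & forall X p (x : F X i p), ap g x = yon (x : slicel F X i p).
Proof.
unshelve eexists.
  apply: (@mkmor k C (slicer F i) (hom_weight (corep i) F)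
    (fun X p (x : F X i p) => yon (x : slicel F X i p))).
  - by move=> X p; exact: (@yon_lin k D (slicel F X) i p).
  - move=> X Y p q r e u x; apply: modhomP => Z; apply: gmapP => n s e' a.
    have E : n + q + p = s by lia.
    rewrite [RHS](mcompE e (morl F u) (yon (x : slicel F X i q)) e' erefl E) !yonE.
    rewrite [RHS](linZ (ax_linr (actlP F Z) (op_e E) u)).
    rewrite [X in _ = _ *: X](actlr erefl (op_e E) e e' u a x) scalerA; congr (_ *: _).
    by rewrite -e mulrDl sgD mulrC.
  - by move=> X p q e x; rewrite /= yon_d.
- apply: bij_qis => X p.
  + move=> x; rewrite ap_mkmor => h.
    by rewrite -(@yon_id _ _ (slicel F X) _ _ x (add0r p)) h.
  + move=> phi; exists (gm (phi i) (add0r p) (idm D i)).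
    by rewrite ap_mkmor yon_eta.
- by move=> X p x; rewrite ap_mkmor.
Qed.

End HomWeight.

(** * Weights that compute shifts and cones *)

Section HomWeightEvaluation.
Variables (k : comPzRingType) (C D : dgcat k).

Definition morr_mor (F : dgbimod C D) (i j : D) (a : hom D i j 0) (ca : cocycle a) :
  mor (slicer F i) (slicer F j).
Proof.
exists (morr F a); rewrite /cocycle /= morr_d.
have -> : cd _ erefl a = 0 := ca.
exact: (lin0 (@morr_lin _ _ _ F _ _ _)).
Defined.

Lemma ap_morr (F : dgbimod C D) (i j : D) (a : hom D i j 0) X p (x : F X i p) (e : 0 + p = p) :
  ap (morr F a) (x : slicer F i X p) = actr F e a x.
Proof. by rewrite /ap /= (eq_irrelevance (op_e (addr0 p)) e). Qed.

Definition ymor (i j : D) (a : hom D i j 0) (ca : cocycle a) : mor (corep j) (corep i).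
Proof.
exists (@yon k D (corep i) j 0 a); rewrite /cocycle /= yon_d.
have -> : cd (corep i j) erefl (a : corep i j 0) = 0 := ca.
exact: (lin0 (@yon_lin _ _ _ _ _)).
Defined.

Lemma shift_eval (F : dgbimod C D) i n :
  diso (hom_weight (mshift (corep i) (- n)) F) (mshift (slicer F i) n).
Proof.
apply: diso_sym; have [g qg _] := hw_yon F i.
apply: (@diso_trans _ _ _ (mshift (hom_weight (corep i) F) n)).
  by apply: qisto_diso; apply: qisto_shift; exists g.
by have := hw_shift F (corep i) (- n); rewrite opprK => /qisto_diso.
Qed.

(** The shift by -1 in the weight cancels the one in [hw_cone], and [ymor] reverses [a] because
    [hom_weight] is contravariant. *)
Lemma cone_eval (F : dgbimod C D) i j (a : hom D i j 0) (ca : cocycle a) :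
  diso (hom_weight (mshift (mcone (ymor ca)) (-1)) F) (mcone (morr_mor F ca)).
Proof.
apply: diso_sym; have [gi qi giE] := hw_yon F i; have [gj qj gjE] := hw_yon F j.
apply: (@diso_trans _ _ _ (mcone (hw_map F (ymor ca)))).
  unshelve eapply (qis_diso (@cmap_qis _ _ _ _ _ _ _ _ gi gj 0 _ qi qj)).
  move=> X p x p0 p1 e0 c0 c1 e1.
  rewrite (lin0 (cd_lin _ _)) addr0.
  rewrite giE (ap_morr _ _ (add0r p)) gjE (ap_hw_map (ymor ca) _ (addr0 p)).
  apply/eqP; rewrite subr_eq0; apply/eqP.
  have e : 0 + p = p := add0r p.
  rewrite -[RHS](yon_eta _ e); congr yon.
  rewrite (mcompE (addr0 p) _ (ymor ca) e (addr0 0) e).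
  rewrite [gm (ymor ca j) _ _]yon_id yonE mulr0 scale1r.
  by rewrite (eq_irrelevance e (add0r p)).
apply: (@diso_trans _ _ _ (mshift (mshift (mcone (hw_map F (ymor ca))) (-1)) 1)).
  by apply: diso_sym; apply: shift_shift_diso.
apply: (@diso_trans _ _ _ (mshift (hom_weight (mcone (ymor ca)) F) 1)).
  by apply: qisto_diso; apply: qisto_shift; apply: hw_cone.
by have := hw_shift F (mcone (ymor ca)) (-1); rewrite opprK => /qisto_diso.
Qed.

End HomWeightEvaluation.

(** * Families of modules closed under shifts and cones *)

(** Cones are required for all closed degree 0 maps between members, whatever their origin, so that
    maps obtained by lifting qualify. *)
Definition dclosed (k : comPzRingType) (C : dgcat k) (T : Type) (R : T -> dgmod C) : Prop :=
  (forall t n, exists t', diso (R t') (mshift (R t) n))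
  /\ (forall t t' (f : mor (R t) (R t')), exists t'', diso (R t'') (mcone f)).

Section ClosedFamilies.
Variables (k : comPzRingType) (C D : dgcat k) (F : dgbimod C D).

Lemma diso_hom_weight (W W' : dgmod D) : hproj_mod W -> hproj_mod W' -> diso W W' ->
  diso (hom_weight W F) (hom_weight W' F).
Proof.
move=> hW hW' /(diso_qis hW) [f qf].
by apply: diso_sym; apply: qis_diso; apply: hw_qis qf.
Qed.

Lemma pretr_hom_weight (T : Type) (R : T -> dgmod C) :
  (forall t, hproj_mod (R t)) -> dclosed R ->
  (forall i, exists t, diso (R t) (slicer F i)) ->
  forall W, pretr_closure (@corep k D) W -> exists t, diso (R t) (hom_weight W F).
Proof.
move=> hR [Rsh Rcone] gen W; elim=> {W}.
- move=> i; have [t it] := gen i; exists t; apply: diso_trans it _.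
  by have [g qg _] := hw_yon F i; apply: qis_diso qg.
- move=> M n _ [t it]; have [t' it'] := Rsh t (- n); exists t'.
  apply: diso_trans it' _; apply: diso_trans (qisto_diso (hw_shift F M n)).
  by apply/qisto_diso/qisto_shift/diso_qis.
- move=> M N f _ [t it] _ [t' it'].
  have [b qb] := diso_qis (hR _) it; have [a qa] := diso_qis (hR _) it'.
  (* [hw_map F f] is exchanged for a map between members of the family; this is where their
     h-projectivity is needed. *)
  have [c qc] := cmap_lift (hw_map F f) (hR _) qa qb.
  have [t1 it1] := Rcone _ _ c; have [t2 it2] := Rsh t1 (-1); exists t2.
  apply: diso_trans it2 _; apply: diso_trans (qisto_diso (hw_cone F f)).
  apply: qisto_diso; apply: qisto_shift.
  apply: qisto_trans qc; apply: diso_qis it1; exact: hR.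
- move=> M N [f [g [gf fg]]] cM [t it]; exists t; apply: diso_trans it _.
  have hM := pretr_hproj (@hproj_corep k D) cM.
  by apply: diso_hom_weight (mod_iso_diso _) => //; [apply: hproj_retract fg _ | exists f, g].
Qed.

(** A map of slices comes from a morphism of [D], so its cone is the value of [hom_weight] on a
    shifted cone of corepresentables; the hypothesis makes that weight corepresentable. *)
Lemma dclosed_dual :
  (forall i j (f : mor (slicer F i) (slicer F j)),
     exists (a : hom D i j 0) (ca : cocycle a), f = morr_mor F ca) ->
  dclosed (@corep k D) -> dclosed (slicer F).
Proof.
move=> full [sh cone].
have key i W : hproj_mod W -> diso (corep i) W -> diso (slicer F i) (hom_weight W F).
  move=> hW iW; have [g qg _] := hw_yon F i; apply: diso_trans (qis_diso qg) _.
  by apply: diso_hom_weight iW => //; apply: hproj_corep.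
split.
- move=> i n; have [j ij] := sh i (- n); exists j.
  apply: diso_trans (shift_eval F i n); apply: key ij.
  by apply: hproj_shift; apply: hproj_corep.
- move=> i j f; have [a [ca ->]] := full _ _ f.
  have [l il] := cone _ _ (ymor ca); have [m im] := sh l (-1); exists m.
  apply: diso_trans (cone_eval F ca); apply: key.
    by apply/hproj_shift/hproj_cone; apply: hproj_corep.
  apply: diso_trans im _; apply/qisto_diso/qisto_shift/diso_qis => //.
  exact: hproj_corep.
Qed.

End ClosedFamilies.

(** * Duality between representables and corepresentables *)

Section Flip.
Variables (k : comPzRingType) (C D : dgcat k) (F : dgbimod C D).

Definition flip : dgbimod D C.
Proof.
refine (@DGBimod k D C (fun Y X => F X Y)
  (fun X Y Y' p q r e f x => actr F e f x)
  (fun Y X X' p q r e g x => actl F e g x) (fun X => actrP F X) (fun Y => actlP F Y) _).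
move=> Y Y' X X' p q n qn pn s e1 e2 e3 e4 g f x.
rewrite (actlr e3 e4 e1 e2) scalerA sgMC.
by case: (sgP k (q * p)) => ->; rewrite ?mulrNN mulr1 scale1r.
Defined.
End Flip.

Section Representables.
Variables (k : comPzRingType) (A : dgcat k).

(** The data agree by conversion and the axioms by proof irrelevance. Having an equality lets
    results on [corep] be transferred by rewriting. *)
Lemma rep_corep : @rep k A = @corep k (opcat A).
Proof. by apply: funext => X; congr DGMod; apply: Prop_irrelevance. Qed.

Lemma hproj_rep (X : A) : hproj_mod (rep X).
Proof. by rewrite rep_corep; apply: (@hproj_corep k (opcat A)). Qed.

(** The Leibniz rule for [1 1 = 1] reads [d 1 = d 1 + d 1]. *)
Lemma idm_cocycle (X : A) : cocycle (idm A X).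
Proof.
rewrite /cocycle; have := compd (addr0 0) erefl erefl erefl (addr0 _) (add0r _) (idm A X) (idm A X).
rewrite comp1m compm1 comp1m scale1r => /eqP.
by rewrite -subr_eq0 opprD addrA subrr sub0r oppr_eq0 => /eqP.
Qed.

Lemma mor_eq (C : dgcat k) (M N : dgmod C) (f g : mor M N) : mor_hom f = mor_hom g -> f = g.
Proof.
case: f g => [f cf] [g cg] /= fg; subst g; congr Mor; exact: Prop_irrelevance.
Qed.

Lemma rep_full (X Y : A) (f : mor (rep X) (rep Y)) :
  exists (a : hom A X Y 0) (ca : cocycle a), f = morr_mor (diag A) ca.
Proof.
pose a : hom A X Y 0 := ap f (idm A X : rep X X 0).
have aE : morr (diag A) a = f.
  apply: (@apP _ _ (rep X) (rep Y)) => Z p x.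
  rewrite (ap_morr a x (add0r p)) /= /a.
  transitivity (ap f (act (rep X) (addr0 p) (x : hom (opcat A) X Z p) (idm A X : rep X X 0))).
    by rewrite ap_act [RHS]/= /opcomp mulr0 scale1r (eq_irrelevance (op_e (addr0 p)) (add0r p)).
  by congr (ap f _); rewrite /= /opcomp mulr0 scale1r comp1m.
have ca : cocycle a := ap_cocycle f (idm_cocycle X : cocycle (idm A X : rep X X 0)).
by exists a, ca; apply: mor_eq.
Qed.

Lemma corep_full (X Y : A) (f : mor (corep X) (corep Y)) :
  exists (a : hom (opcat A) X Y 0) (ca : cocycle a), f = morr_mor (flip (diag A)) ca.
Proof.
pose a : hom A Y X 0 := ap f (idm A X : corep X X 0).
have aE : morr (flip (diag A)) (a : hom (opcat A) X Y 0) = f.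
  apply: (@apP _ _ (corep X) (corep Y)) => Z p x.
  rewrite (@ap_morr _ _ _ (flip (diag A)) X Y a Z p x (add0r p)) /= /a.
  rewrite /opcomp mul0r scale1r.
  transitivity (ap f (act (corep X) (addr0 p) x (idm A X : corep X X 0))).
    by rewrite ap_act [RHS]/= (eq_irrelevance (op_e (add0r p)) (addr0 p)).
  by congr (ap f _); rewrite /= compm1.
have ca : cocycle a := ap_cocycle f (idm_cocycle X : cocycle (idm A X : corep X X 0)).
by exists a, ca; apply: mor_eq.
Qed.

Lemma dclosed_rep_corep : dclosed (@rep k A) <-> dclosed (@corep k A).
Proof.
split=> [|h].
- rewrite rep_corep => h.
  exact: (@dclosed_dual k A (opcat A) (flip (diag A)) corep_full h).
- exact: (@dclosed_dual k (opcat A) A (diag A) rep_full h).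
Qed.

(** By [rep_full] closed degree 0 maps between representables are the [rep_mor], so both conditions
    on cones concern the same maps. *)
Lemma pretriangulatedE : pretriangulated A <-> inhabited A /\ dclosed (@rep k A).
Proof.
split=> [[iA [sh cone]]|[iA [sh cone]]]; split=> //; split=> //.
move=> X Y f; have [a [ca ->]] := rep_full f.
have -> : morr_mor (diag A) ca = rep_mor ca by apply: mor_eq.
exact: cone.
Qed.

End Representables.

(** * Homotopy limits in a pretriangulated dg-category *)

Lemma mod_resolution_refl (k : comPzRingType) (C : dgcat k) (W : dgmod C) :
  hproj_mod W -> mod_resolution W W.
Proof. by move=> hW; split=> //; exists (mor_id W); apply: qis_id. Qed.

Lemma pretriangulated_wholim (k : comPzRingType) (A I : dgcat k) : pretriangulated A ->
  forall F : dgbimod (opcat A) I, quasi_functor F ->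
  forall W : dgmod I, in_pretr_op W -> exists X : A, is_wholim W F X.
Proof.
move=> /pretriangulatedE [_ cA] F qF W cW.
have hW := pretr_hproj (@hproj_corep k I) cW.
have gen i : exists X, diso (rep X) (slicer F i).
  by have [X iX] := qF i; exists X; apply: diso_sym.
have [X iX] := pretr_hom_weight (@hproj_rep k A) cA gen cW.
by exists X; exists W => //; apply: mod_resolution_refl.
Qed.

(** * The basis of a linearized category, and diagrams *)

Section Deltas.
Variables (k : comPzRingType) (I : fincat).
Local Notation K := (linearization k I).

Definition ldelta (i j : I) p (v : lbasis i j p) : lhom k i j p := [ffun u => (u == v)%:R].

Lemma lhom_ext (i j : I) p (V : lmodType k) (h h' : lhom k i j p -> V) :
  linear h -> linear h' -> (forall v, h (ldelta v) = h' (ldelta v)) -> forall g, h g = h' g.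
Proof.
move=> lh lh' hh' g.
have -> : g = \sum_v g v *: ldelta v.
  apply/ffunP => u; rewrite sum_ffunE (bigD1 u) //= big1 => [|v nv].
    by rewrite addr0 !ffunE (eqxx u); exact: (esym (mulr1 _)).
  by rewrite !ffunE (eq_sym u) (negbTE nv) scaler0.
apply: (big_ind (fun x => h x = h' x)) => [|x y hx hy|v _].
- by rewrite (lin0 lh) (lin0 lh').
- by rewrite (linD lh) (linD lh') hx hy.
- by rewrite (linZ lh) (linZ lh') hh'.
Qed.

Definition delta (i j : I) (a : fhom I i j) : hom K i j 0 :=
  ldelta (exist _ a (eqxx 0) : lbasis i j 0).

Lemma ldeltaE (i j : I) (v : lbasis i j 0) : ldelta v = delta (val v).
Proof. by congr ldelta; apply: val_inj. Qed.

Lemma deltaE (i j : I) (a : fhom I i j) (u : lbasis i j 0) : delta a u = (val u == a)%:R.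
Proof. by rewrite ffunE -(inj_eq val_inj). Qed.

Lemma delta_id (i : I) : delta (fid I i) = idm K i.
Proof. by apply/ffunP => u; rewrite deltaE. Qed.

Lemma delta_comp (i j l : I) (b : fhom I j l) (a : fhom I i j) (e : 0 + 0 = 0) :
  comp K e (delta b) (delta a) = delta (fcomp b a).
Proof.
apply/ffunP => w; rewrite deltaE ffunE.
rewrite (bigD1 (exist _ b (eqxx 0) : lbasis j l 0)) //= [X in _ + X]big1 => [|v nv].
  rewrite (bigD1 (exist _ a (eqxx 0) : lbasis i j 0)) //= big1 => [|u nu].
    by rewrite !deltaE /= (eqxx a) (eqxx b) mul1r !addr0 (eq_sym (sval w)); case: eqP.
  by rewrite (deltaE a) -(inj_eq val_inj) /= in nu *; rewrite (negbTE nu) mulr0 if_same.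
rewrite big1 // => u _.
by rewrite (deltaE b) -(inj_eq val_inj) /= in nv *; rewrite (negbTE nv) mul0r if_same.
Qed.

Lemma delta_cocycle (i j : I) (a : fhom I i j) : cocycle (delta a).
Proof. by []. Qed.
End Deltas.

Section Diagrams.
Variables (k : comPzRingType) (C : dgcat k) (I : fincat).
Local Notation K := (linearization k I).

(** A bimodule over the linearization given by its arrows only. The functor laws are stated
    elementwise, which avoids composites in degree [0 + 0]. *)
Record diagram := Diagram {
  dob :> I -> dgmod C;
  dar : forall i j, fhom I i j -> mor (dob i) (dob j);
  dar_id : forall i X p (x : dob i X p), ap (dar (fid I i)) x = x;
  dar_comp : forall i j l (b : fhom I j l) (a : fhom I i j) X p (x : dob i X p),
    ap (dar (fcomp b a)) x = ap (dar b) (ap (dar a) x) }.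

Definition natural (P N : diagram) n (phi : forall i, modhom (P i) (N i) n) : Prop :=
  forall i j (a : fhom I i j) X p q (e : p + n = q) (x : P i X p),
    gm (phi j X) e (ap (dar P a) x) = ap (dar N a) (gm (phi i X) e x).

Definition diag_of (F : dgbimod C K) : diagram.
Proof.
refine (@Diagram (slicer F) (fun i j a => morr_mor F (delta_cocycle k a)) _ _).
- move=> i X p x; rewrite (ap_morr _ _ (add0r p)) delta_id; exact: (ax_id (actrP F X)).
- move=> i j l b a X p x; rewrite !(ap_morr _ _ (add0r p)) -(delta_comp k b a (addr0 0)).
  exact: (ax_comp (actrP F X)).
Defined.

Section BimodOf.
Variable P : diagram.

(** A basis element [v] exists in degree 0 only, hence [p = 0]. *)
Fact lact_e (i j : I) (p q r : int) (v : lbasis i j p) : p + q = r -> q + 0 = r.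
Proof. by case: v => a /= /eqP -> <-; rewrite add0r addr0. Qed.

Definition dact X (i j : I) p q r (e : p + q = r) (u : hom K i j p) (x : P i X q) : P j X r :=
  \sum_(v : lbasis i j p) (u : lhom k i j p) v *: gm (dar P (val v) X) (lact_e v e) x.

Lemma dact_linl X i j p q r (e : p + q = r) (x : P i X q) :
  linear (fun u : hom K i j p => dact e u x).
Proof.
move=> a u u'; rewrite /dact scaler_sumr -big_split; apply: eq_bigr => v _.
by rewrite !ffunE scalerDl scalerA.
Qed.

Lemma dact_linr X i j p q r (e : p + q = r) (u : hom K i j p) :
  linear (fun x : P i X q => dact e u x).
Proof.
move=> a x x'; rewrite /dact scaler_sumr -big_split; apply: eq_bigr => v _.
by rewrite gm_lin scalerDr !scalerA [a * _]mulrC.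
Qed.

Lemma dact_delta X i j q (e : 0 + q = q) (a : fhom I i j) (x : P i X q) :
  dact e (delta k a) x = ap (dar P a) x.
Proof.
rewrite /dact (bigD1 (exist _ a (eqxx 0) : lbasis i j 0)) //= big1 => [|v nv].
  by rewrite deltaE /= (eqxx a) scale1r addr0 apE.
by rewrite deltaE -(inj_eq val_inj) /= in nv *; rewrite (negbTE nv) scale0r.
Qed.

Definition bimod_of : dgbimod C K.
Proof.
refine (@DGBimod k C K (fun X j => P j X) (fun j X X' p q r e f x => act (P j) e f x)
  dact (fun j => actP (P j)) _ _).
- move=> X; split.
  + by move=> i j p q r e u; apply: dact_linr.
  + by move=> i j p q r e x; apply: dact_linl.
  + move=> i j l p q r pq qr s e1 e2 e3 e4 g f x.
    move: g; apply: lhom_ext => [c u u'|c u u'|v].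
    * by rewrite (comp_linl (d := K) e1 f) dact_linl.
    * by rewrite dact_linl.
    move: f; apply: lhom_ext => [c u u'|c u u'|w].
    * by rewrite (comp_linr (d := K) e1) dact_linl.
    * by rewrite dact_linl dact_linr.
    (* The basis elements [v] and [w] force both degrees to be 0, which leaves the functor law of
       the diagram. *)
    have p0 := eqP (valP v); have q0 := eqP (valP w).
    move: e1 e2 e3 e4 v w; subst p q => e1 e2 e3 e4 v w.
    have E1 : qr = r by lia.
    have E2 : pq = 0 by lia.
    have E3 : s = r by lia.
    move: e1 e2 e3 e4; subst qr pq s => e1 e2 e3 e4.
    by rewrite !ldeltaE delta_comp !dact_delta dar_comp.
  + by move=> i p e x; rewrite -delta_id dact_delta dar_id.
  + move=> i j p q r p' q' r' e ep eq er e1 e2 f x /=.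
    rewrite (lin0 (@dact_linl X i j _ _ _ e1 x)) add0r.
    move: f; apply: lhom_ext => [c u u'|c u u'|v].
    * by rewrite dact_linl cd_lin.
    * by rewrite dact_linl scalerDr !scalerA [c * _]mulrC.
    have p0 := eqP (valP v).
    move: e ep e1 e2 v; subst p => e ep e1 e2 v.
    have E1 : r = q by lia.
    have E2 : r' = q' by lia.
    move: e er e1 e2; subst r r' => e er e1 e2.
    by rewrite sg0 scale1r !ldeltaE !dact_delta (eq_irrelevance er eq) ap_d.
- move=> X X' i j p q n qn pn s e1 e2 e3 e4 f g x.
  move: g; apply: lhom_ext => [c u u'|c u u'|v].
  * by rewrite dact_linl actDr actZr.
  * by rewrite dact_linl scalerDr !scalerA [c * _]mulrC.
  have q0 := eqP (valP v).
  move: e1 e4 v; subst q => e1 e4 v.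
  have E1 : qn = n by lia.
  have E2 : pn = s by lia.
  move: e1 e2 e3 e4; subst qn pn => e1 e2 e3 e4.
  by rewrite mulr0 scale1r !ldeltaE !dact_delta (eq_irrelevance e3 e2) ap_act.
Defined.

Lemma bimod_of_delta X i j q (e : 0 + q = q) (a : fhom I i j) (x : P i X q) :
  actr bimod_of e (delta k a) (x : bimod_of X i q) = ap (dar P a) x.
Proof. exact: dact_delta. Qed.

End BimodOf.

Lemma bimodhom_of (M N : dgbimod C K) n (phi : forall i, modhom (slicer M i) (slicer N i) n) :
  @natural (diag_of M) (diag_of N) n phi ->
  exists psi : bimodhom M N n, forall i, psi i = phi i.
Proof.
move=> nat.
suff h : forall Y Y' p s (e1 : n + p = s) (e2 : p + n = s) (g : hom K Y Y' p),
    mcomp e1 (phi Y') (morr M g) = sg k (n * p) *: mcomp e2 (morr N g) (phi Y).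
  by exists (BimodHom h).
move=> i j p s e1 e2; apply: lhom_ext => [c u u'|c u u'|v].
- by rewrite morr_lin mcomp_linr.
- by rewrite morr_lin mcomp_linl scalerDr !scalerA [c * _]mulrC.
have p0 := eqP (valP v); move: e1 e2 v; subst p => e1 e2 v.
have E : s = n by lia.
move: e1 e2; subst s => e1 e2; rewrite mulr0 scale1r !ldeltaE.
apply: modhomP => X; apply: gmapP => p q e x.
rewrite (mcompE e1 _ _ e (addr0 p) e) (mcompE e2 _ _ e e (addr0 q)).
exact: nat.
Qed.

Lemma bimodhom_natural (M N : dgbimod C K) n (phi : bimodhom M N n) :
  @natural (diag_of M) (diag_of N) n phi.
Proof.
move=> i j a X p q e x.
have := bh_act phi (addr0 n) (add0r n) (delta k a); rewrite mulr0 scale1r => h.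
have : gm (mcomp (addr0 n) (phi j) (morr M (delta k a)) X) e x =
  gm (mcomp (add0r n) (morr N (delta k a)) (phi i) X) e x by rewrite h.
by rewrite (mcompE (addr0 n) _ _ e (addr0 p) e) (mcompE (add0r n) _ _ e e (addr0 q)).
Qed.

End Diagrams.

(** * The arrow category *)

Section Arrow.

Fact arrow_trans (i j l : bool) : j ==> l -> i ==> j -> i ==> l.
Proof. by case: i; case: j; case: l. Qed.

Definition arrow : fincat.
Proof.
refine (@FinCat bool (fun i j => {x : unit | i ==> j})
  (fun i => exist _ tt (implybb i))
  (fun i j l b a => exist _ tt (arrow_trans (valP b) (valP a))) _ _ _).
- by move=> *; apply: val_inj.
- by move=> i j [[] a]; apply: val_inj.
- by move=> i j [[] a]; apply: val_inj.
Defined.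

Lemma arrow_uniq (i j : arrow) (a b : fhom arrow i j) : a = b.
Proof. by case: a b => [[] a] [[] b]; apply: val_inj. Qed.

Lemma arrow_direct : finite_direct arrow.
Proof.
exists 1%N, (fun i : bool => inord i) => i j a na.
rewrite !inordK ?ltnS ?leq_b1 //.
case: i j a na => [] [] a na //=.
- by case: na; rewrite (arrow_uniq a (fid arrow true)).
- by case: a {na}.
- by case: na; rewrite (arrow_uniq a (fid arrow false)).
Qed.

Definition arr : fhom arrow false true := exist _ tt isT.

Section ArrowDiagram.
Variables (k : comPzRingType) (C : dgcat k) (M N : dgmod C) (f : mor M N).

Definition arrow_ob (i : arrow) : dgmod C := if i then N else M.

Definition arrow_ar (i j : arrow) : fhom arrow i j -> mor (arrow_ob i) (arrow_ob j) :=
  match i, j return fhom arrow i j -> mor (arrow_ob i) (arrow_ob j) with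
  | false, false => fun _ => mor_id M
  | false, true => fun _ => f
  | true, true => fun _ => mor_id N
  | true, false => fun a => False_rect _ (notF (valP a))
  end.

Definition arrow_diag : diagram C arrow.
Proof.
refine (@Diagram k C arrow arrow_ob arrow_ar _ _).
- by case=> X p x; rewrite ap_id.
- move=> [] [] [] b a X p x //=; rewrite ?ap_id //; try by case: a.
  all: by case: b.
Defined.
End ArrowDiagram.
End Arrow.

(** * Shifts and cones as homotopy limits *)

(** [is_rhom] provides an unspecified resolution of [W]; when [W] is h-projective it may be
    exchanged for [W] itself. *)
Lemma rhom_eval (k : comPzRingType) (C D : dgcat k) (W : dgmod D) (F : dgbimod C D) M :
  hproj_mod W -> is_rhom W F M -> diso M (hom_weight W F).
Proof.
move=> hW [P [hP [f qf]] MP]; apply: diso_trans MP _.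
exact: diso_hom_weight (qis_diso qf).
Qed.

Section ArrowWeights.
Variables (k : comPzRingType).
Local Notation K := (linearization k arrow).

Lemma arrow_cone_eval (C : dgcat k) (M N : dgmod C) (F : dgbimod C K) (f : mor (slicer F false) (slicer F true)) :
  (forall X p (e : 0 + p = p) (x : F X false p), actr F e (delta k arr) x = ap f x) ->
  diso (hom_weight (mshift (mcone (ymor (delta_cocycle k arr))) (-1)) F) (mcone f).
Proof.
move=> fE; have -> : f = morr_mor F (delta_cocycle k arr).
  by apply: morP => X p x; rewrite (ap_morr _ _ (add0r p)) fE.
exact: cone_eval.
Qed.

Lemma wholim_dclosed (A : dgcat k) :
  (forall F : dgbimod (opcat A) K, quasi_functor F ->
   forall W : dgmod K, in_pretr_op W -> exists X : A, is_wholim W F X) ->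
  dclosed (@rep k A).
Proof.
move=> lim.
have qF (X Y : A) (f : mor (rep X) (rep Y)) : quasi_functor (bimod_of (arrow_diag f)).
  by case; [exists Y|exists X]; apply: diso_refl.
split=> [X n|X Y f].
(* The shift involves the object [false] only; with the identity as diagram, the arrow category
   serves here as well. *)
- have cW : in_pretr_op (mshift (@corep k K false) (- n)) by apply/pretr_shift/pretr_gen.
  have [Z] := lim _ (qF _ _ (mor_id (rep X))) _ cW.
  move=> /(rhom_eval (pretr_hproj (@hproj_corep k K) cW)) h; exists Z.
  exact: diso_trans h (shift_eval _ _ _).
- have cW : in_pretr_op (mshift (mcone (ymor (delta_cocycle k arr))) (-1)).
    by apply/pretr_shift/pretr_cone; apply: pretr_gen.
  have [Z] := lim _ (qF _ _ f) _ cW.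
  move=> /(rhom_eval (pretr_hproj (@hproj_corep k K) cW)) h; exists Z.
  apply: diso_trans h _.
  apply: (@arrow_cone_eval _ (rep X) (rep Y) (bimod_of (arrow_diag f)) f) => Z' p e x.
  exact: bimod_of_delta.
Qed.
End ArrowWeights.

(** * Finite powers and coinduction *)

Section FinitePowers.
Variables (k : comPzRingType) (C : dgcat k).
Implicit Types M N S : dgmod C.

Definition cpow (T : finType) (K : cochain k) : cochain k.
Proof.
refine (@Cochain k (fun p => {ffun T -> K p}) (fun p q e x => [ffun t => cd K e (x t)]) _ _).
- by move=> p q e a x y; apply/ffunP => t; rewrite !ffunE cd_lin.
- by move=> p q r e e' x; apply/ffunP => t; rewrite !ffunE cdd.
Defined.

(** For finite [T] this is both a product and a coproduct: [coind] uses it as the former, [lan] as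
    the latter. *)
Definition mpow (T : finType) S : dgmod C.
Proof.
refine (@DGMod k C (fun X => cpow T (S X)) (fun X Y p q r e u x => [ffun t => act S e u (x t)]) _).
split.
- by move=> X Y p q r e u a x y; apply/ffunP => t; rewrite !ffunE actDr actZr.
- by move=> X Y p q r e x a u v; apply/ffunP => t; rewrite !ffunE actDl actZl.
- move=> X Y Z p q r pq qr s e1 e2 e3 e4 g f x; apply/ffunP => t; rewrite !ffunE.
  exact: (ax_comp (actP S)).
- by move=> X p e x; apply/ffunP => t; rewrite !ffunE; exact: (ax_id (actP S)).
- move=> X Y p q r p' q' r' e ep eq er e1 e2 f x; apply/ffunP => t; rewrite /= !ffunE.
  by rewrite (ax_d (actP S) e ep eq er e1 e2).
Defined.

Lemma mpow_acyclic T S : mod_acyclic S -> mod_acyclic (mpow T S).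
Proof.
move=> aS X p x cx.
have [y yE] : exists y : T -> S X (p - 1), forall t, cd _ (subrK 1 p) (y t) = x t.
  apply: (@fin_all_exists T (fun=> S X (p - 1)) (fun t y => cd _ (subrK 1 p) y = x t)) => t.
  apply: cobP; apply: aS.
  by have /ffunP/(_ t) := cx; rewrite !ffunE.
exists (p - 1), (subrK 1 p), [ffun t => y t : S X (p - 1)].
by apply/ffunP => t; rewrite !ffunE yE.
Qed.

Definition mproj (T : finType) S (t : T) : mor (mpow T S) S.
Proof.
apply: (@mkmor k C (mpow T S) S (fun X p (x : {ffun T -> S X p}) => x t)).
- by move=> X p a x y; rewrite !ffunE.
- by move=> X Y p q r e u x; rewrite /= ffunE.
- by move=> X p q e x; rewrite /= ffunE.
Defined.

Definition mtup (T : finType) S P n (b : T -> modhom P S n) : modhom P (mpow T S) n.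
Proof.
unshelve eexists (fun X => @GMap k (P X) (mpow T S X) n
  (fun p q e x => [ffun t => gm (b t X) e x]) _).
  by move=> p q e a x y; apply/ffunP => t; rewrite !ffunE gm_lin.
move=> X Y p q r s t e e1 e2 e3 u x; apply/ffunP => i; rewrite !ffunE.
exact: mh_act.
Defined.

Lemma mtup_d (T : finType) S P n n' (e : n + 1 = n') (b : T -> modhom P S n) :
  (forall t, mdiff e (b t) = 0) -> mdiff e (mtup b) = 0.
Proof.
move=> bd; apply: modhomP => X; apply: gmapP => p q e' x; apply/ffunP => t.
have E1 : p + n + 1 = q by lia.
have E2 : p + 1 + n = q by lia.
have : gm (mdiff e (b t) X) e' x = 0 by rewrite bd.
rewrite (mdiffE e (b t) e' erefl E1 erefl E2) => h.
by rewrite (mdiffE e (mtup b) e' erefl E1 erefl E2) !ffunE h.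
Qed.

Definition mpull (T T' : finType) S (g : T' -> T) : mor (mpow T S) (mpow T' S).
Proof.
apply: (@mkmor k C (mpow T S) (mpow T' S)
  (fun X p (x : {ffun T -> S X p}) => [ffun t => x (g t)])).
- by move=> X p a x y; apply/ffunP => t; rewrite !ffunE.
- by move=> X Y p q r e u x; apply/ffunP => t; rewrite !ffunE.
- by move=> X p q e x; apply/ffunP => t; rewrite !ffunE.
Defined.

Variable I : fincat.
Local Notation K := (linearization k I).

(** The right Kan extension of [N] along the object [i], right adjoint to evaluation at [i]. *)
Definition coind (i : I) N : diagram C I.
Proof.
refine (@Diagram k C I (fun j => mpow (fhom I j i) N)
  (fun j l a => mpull N (fun w : fhom I l i => fcomp w a)) _ _).
- by move=> j X p x; rewrite ap_mkmor; apply/ffunP => t; rewrite ffunE fcompm1.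
- by move=> j l m b a X p x; rewrite !ap_mkmor; apply/ffunP => t; rewrite !ffunE fcompA.
Defined.

(* The coinduced bimodule turns the lifting property of a bimodule into the one of
   its slices. *)
Lemma hproj_slicer (P : dgbimod C K) : hproj_bimod P -> forall i, hproj_mod (slicer P i).
Proof.
move=> hP i N aN p phi cphi.
pose B := bimod_of (coind i N).
pose Phi j : modhom (slicer P j) (slicer B j) p :=
  @mtup (fhom I j i) N (slicer P j) p (fun w => mcomp (addr0 p) phi (morr_mor P (delta_cocycle k w))).
have PhiE j X q r (e : q + p = r) (x : P X j q) w :
    (gm (Phi j X) e x : {ffun _}) w = gm (phi X) e (actr P (add0r q) (delta k w) x).
  rewrite ffunE (mcompE (addr0 p) phi _ e (addr0 q) e).
  by rewrite -/(ap _ _) (ap_morr _ _ (add0r q)).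
have natPhi : @natural _ _ _ (diag_of P) (diag_of B) p Phi.
  move=> j l a X q r e x; rewrite !(ap_morr _ _ (add0r _)).
  rewrite bimod_of_delta ap_mkmor; apply/ffunP => w; rewrite [RHS]ffunE !PhiE.
  rewrite -(delta_comp k w a (addr0 0)).
  by rewrite -(ax_comp (actrP P X) (addr0 0) (add0r q) (add0r q) (add0r q)).
have [psi psiE] := bimodhom_of natPhi.
have aB X j : acyclic (B X j) by apply: (@mpow_acyclic (fhom I j i) N aN X).
have [|chi chiE] := hP B aB _ _ _ (subrK 1 p) erefl psi.
  move=> j; rewrite psiE; apply: mtup_d => w.
  rewrite (mdiff_comp_mr (addr0 p) erefl _ (addr0 _)).
  by rewrite (_ : mdiff erefl phi = 0) ?mcomp0l.
(* Projecting to the component of the identity undoes the transposition that produced [Phi] from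
   [phi]. *)
exists (p - 1), (subrK 1 p), (mcomp (add0r _) (mproj N (fid I i)) (chi i)) => /=.
rewrite (mdiff_comp_ml _ (subrK 1 p) _ (add0r p)) chiE psiE.
apply: modhomP => X; apply: gmapP => q r e x.
rewrite (mcompE (add0r p) _ _ e e (addr0 r)) -/(ap _ _) ap_mkmor PhiE delta_id.
by congr gm; exact: (ax_id (actrP P X)).
Qed.

End FinitePowers.

(** * The opposite of a quasi-functor *)

Section Opposite.
Variables (k : comPzRingType) (A : dgcat k).

(** The Yoneda map from [A(X,-)] to the dual of [A(-,X)]. *)
Definition corep_dual : forall X : A, mor (corep X) (hom_weight (rep X) (flip (diag A))).
Proof.
move=> X; apply: (@mkmor k A (corep X) (hom_weight (rep X) (flip (diag A)))
  (fun Z p (u : hom A X Z p) => morr (diag A) u)).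
- by move=> Z p; exact: (@morr_lin k (opcat A) A (diag A) X Z p).
- move=> Z T p q r e v u; rewrite /= morr_comp.
  by apply: modhomP => Y; apply: gmapP.
- by move=> Z p q e u; rewrite /= morr_d.
Defined.

Lemma corep_dual_qis X : mod_qis (corep_dual X).
Proof.
have idE Z p (u : hom A X Z p) (e : 0 + p = p) : gm (morr (diag A) u X) e (idm A X : rep X X 0) = u.
  by rewrite /= compm1.
apply: bij_qis => Z p.
- by move=> u; rewrite ap_mkmor => h; rewrite -(idE Z p u (add0r p)) h.
- move=> phi; exists (gm (phi X) (add0r p) (idm A X : rep X X 0)); rewrite ap_mkmor.
  apply: modhomP => Y; apply: gmapP => q r e x /=.
  have := mh_act phi (addr0 q) e (add0r p) e (x : hom (opcat A) X Y q) (idm A X : rep X X 0).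
  rewrite /= /opcomp mulr0 scale1r comp1m => ->.
  by rewrite scalerA mulrC sgMC; case: (sgP k (p * q)) => ->; rewrite ?mulrNN mulr1 scale1r.
Qed.

Variables (D : dgcat k) (P : dgbimod (opcat A) D).

(** The identity on elements. It links [hom_bimod], which defines the opposite, with [hom_weight],
    whose invariance under quasi-isomorphisms is available. *)
Definition opposite_slice (i : D) :
  mor (hom_weight (slicer P i) (flip (diag A))) (slicer (hom_bimod P (diag A)) i).
Proof.
apply: (@mkmor k A (hom_weight (slicer P i) (flip (diag A))) (slicer (hom_bimod P (diag A)) i)
  (fun X p (phi : modhom (slicer P i) (rep X) p) => phi)) => //.
Defined.

Lemma opposite_slice_qis i : mod_qis (opposite_slice i).
Proof.
apply: bij_qis => X p x; first by rewrite ap_mkmor.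
by exists x; rewrite ap_mkmor.
Qed.

Definition opposite_rep (i : D) (X : A) (phi : mor (slicer P i) (rep X)) :
  mor (corep X) (slicer (hom_bimod P (diag A)) i) :=
  mor_comp (opposite_slice i) (mor_comp (hw_map (flip (diag A)) phi) (corep_dual X)).

Lemma opposite_repE i X (phi : mor (slicer P i) (rep X)) Z p (u : hom A X Z p) :
  ap (opposite_rep phi) (u : corep X Z p) = mcomp (addr0 p) (morr (diag A) u) phi.
Proof. by rewrite !ap_mor_comp !ap_mkmor. Qed.

(** An object that represents a slice of [P] corepresents the corresponding slice of the opposite,
    because dualizing preserves quasi-isomorphisms of h-projective modules. *)
Lemma opposite_rep_qis i X (phi : mor (slicer P i) (rep X)) :
  hproj_mod (slicer P i) -> mod_qis phi -> mod_qis (opposite_rep phi).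
Proof.
move=> hP qphi; apply: qis_comp; last exact: opposite_slice_qis.
apply: qis_comp; first exact: corep_dual_qis.
by apply: hw_qis => //; apply: hproj_rep.
Qed.

End Opposite.

(** * Shifts and cones as homotopy colimits *)

Section Colimits.
Variables (k : comPzRingType) (A : dgcat k).
Local Notation K := (linearization k arrow).

Lemma whocolim_dclosed :
  (forall F : dgbimod (opcat A) K, quasi_functor F ->
   forall W : dgmod (opcat K), in_pretr W -> exists X : A, is_whocolim W F X) ->
  dclosed (@corep k A).
Proof.
rewrite /in_pretr rep_corep => colim.
have qF (X Y : A) (f : mor (rep X) (rep Y)) : quasi_functor (bimod_of (arrow_diag f)).
  by case; [exists Y|exists X]; apply: diso_refl.
split=> [X n|X Y f].
- pose W := mshift (@corep k (opcat K) false) (- n).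
  have cW : pretr_closure (@corep k (opcat K)) W by apply/pretr_shift/pretr_gen.
  have [Z [G [P [hP [phi [cphi qphi]]] ->]]] := colim _ (qF _ _ (mor_id (rep X))) _ cW.
  move=> /(rhom_eval (pretr_hproj (@hproj_corep k (opcat K)) cW)) h; exists Z.
  apply: diso_trans h (diso_trans (shift_eval _ _ _) _).
  apply: diso_sym; apply: qisto_diso; apply: qisto_shift.
  exists (@opposite_rep k A K P false X (Mor (cphi false))).
  by apply: opposite_rep_qis; [apply: hproj_slicer | move=> T; apply: qphi].
- have [a [ca ->]] := corep_full f.
  (* A map from [corep X] to [corep Y] is induced by a morphism from [Y] to [X], so the arrow
     diagram runs from [rep Y] to [rep X]; the opposite turns it back. *)
  pose g : mor (rep Y) (rep X) := rep_mor (ca : cocycle (a : hom A Y X 0)).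
  pose W := mshift (mcone (@ymor k (opcat K) true false _ (delta_cocycle k arr))) (-1).
  have cW : pretr_closure (@corep k (opcat K)) W.
    by apply/pretr_shift/pretr_cone; apply: pretr_gen.
  have [Z [G [P [hP [phi [cphi qphi]]] ->]]] := colim _ (qF _ _ g) _ cW.
  move=> /(rhom_eval (pretr_hproj (@hproj_corep k (opcat K)) cW)) h; exists Z.
  apply: diso_trans h (diso_trans (cone_eval _ _) _).
  apply: diso_sym.
  pose phi0 : mor (slicer P false) (rep Y) := Mor (cphi false).
  pose phi1 : mor (slicer P true) (rep X) := Mor (cphi true).
  have q0 : mod_qis (opposite_rep phi0).
    by apply: opposite_rep_qis; [apply: hproj_slicer | move=> T; apply: qphi].
  have q1 : mod_qis (opposite_rep phi1).
    by apply: opposite_rep_qis; [apply: hproj_slicer | move=> T; apply: qphi].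
  (* The resolution is a map of bimodules, so this square commutes strictly and the cones are
     compared with zero homotopy. *)
  have nat : mcomp (addr0 0) phi1 (morr P (delta k arr)) = mcomp (addr0 0) g phi0.
    apply: apP => T p x; rewrite !ap_comp.
    have := bimodhom_natural phi arr (addr0 p) x.
    rewrite [RHS](ap_morr _ _ (add0r p)) => h; apply: etrans h _.
    exact: bimod_of_delta.
  unshelve eapply (qis_diso (@cmap_qis _ _ _ _ _ _ _ _ (opposite_rep phi1) (opposite_rep phi0) 0 _ q1 q0)).
  move=> T p x p0 p1 e0 c0 c1 e1.
  rewrite (lin0 (cd_lin _ _)) addr0 !opposite_repE.
  rewrite (@ap_morr _ _ _ (flip (diag A)) _ _ _ _ _ x (add0r p)).
  rewrite (@ap_morr _ _ _ (hom_bimod P (diag A)) _ _ _ _ _ _ (add0r p)).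
  apply/eqP; rewrite subr_eq0; apply/eqP.
  rewrite [RHS]/= mul0r scale1r [actr _ _ _ _]/= /opcomp mul0r scale1r morr_comp.
  rewrite (mcompA (op_e (add0r p)) (addr0 0) (addr0 p) (addr0 p)).
  rewrite (mcompA (addr0 p) (addr0 0) _ (addr0 p)).
  congr mcomp.
  by rewrite nat.
Qed.
End Colimits.

(** * Resolutions relative to a given morphism *)

Section RelativeResolutions.
Variables (k : comPzRingType) (C : dgcat k).
Implicit Types M N P S : dgmod C.

Definition resolvable M : Prop := exists2 R, hproj_mod R & qisto R M.

Lemma hproj_resolvable M : hproj_mod M -> resolvable M.
Proof. by move=> hM; exists M => //; exists (mor_id M); apply: qis_id. Qed.

Lemma resolvable_cone M N (f : mor M N) : resolvable M -> resolvable N -> resolvable (mcone f).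
Proof.
move=> [R hR [a qa]] [R' hR' [b qb]]; have [c ?] := cmap_lift f hR qa qb.
by exists (mcone c) => //; apply: hproj_cone.
Qed.

(* A quasi-isomorphism [rho] from the shift of [S] to the cone of [phi] amounts to
   a map [gamma] from [S] to [P] and an extension of [phi] to its cone. *)
Lemma cone_of_shift S P M (phi : mor P M) (rho : mor (mshift S 1) (mcone phi)) : mod_qis rho ->
  exists (gamma : mor S P) (ext : mor (mcone gamma) M),
  mod_qis ext /\ forall X p (x : P X p), ap ext (ap (cin2 gamma) x) = ap phi x.
Proof.
move=> qrho.
have E0 : 1 + 0 = 1 :> int by []. have E1 : 1 + -1 = 0 :> int by [].
have E2 : 1 + 1 + -1 = 0 + 1 :> int by [].
have cg : @cocycle k (homM S P) 0 (mcomp E1 (mcomp E0 (cpr1 phi) rho) (munsh S E1)).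
  rewrite /cocycle /=.
  rewrite (mdiff_comp_l E1 erefl erefl E2 (em := erefl) _ (munsh_d _ _ _)).
  by rewrite (mdiff_comp_mr E0 erefl erefl (addr0 _)) cpr1_d !mcomp0l.
pose gamma : mor S P := Mor cg.
have gammaE X p (l : S X (p + 1)) : ap gamma l = (ap rho (l : mshift S 1 X p)).1.
  have e : p + 1 + -1 = p by lia.
  rewrite {1}/ap (mcompE E1 _ (munsh S E1) (addr0 (p + 1)) e erefl).
  rewrite (mcompE E0 (cpr1 phi) rho erefl (addr0 p) erefl) cpr1E.
  by rewrite -/(ap rho _) /= transp_id.
have rho_d X p (l : S X (p + 1)) :
    ap rho (cd _ erefl l : mshift S 1 X (p + 1)) = - cd _ erefl (ap rho (l : mshift S 1 X p)).
  rewrite -ap_d -linN_ap; congr (ap rho _).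
  by rewrite [in RHS]/= (eq_irrelevance (shift_d 1 erefl) erefl) sg1 scaleN1r opprK.
have rho_dN X p (l : S X (p + 1)) :
    ap rho (- cd _ erefl l : mshift S 1 X (p + 1)) = cd _ erefl (ap rho (l : mshift S 1 X p)).
  by rewrite (@linN_ap k C _ _ rho X (p + 1)) rho_d opprK.
(* With [r] the second component of [rho], closedness of [rho] gives [phi gamma = - (d r + r d)];
   hence [- r] is the homotopy by which [phi] extends to the cone of [gamma]. *)
pose h X p (z : mcone gamma X p) : M X p := ap phi z.2 - (ap rho (z.1 : mshift S 1 X p)).2.
have [ext extE] : exists ext : mor (mcone gamma) M, forall X p z, @ap k C _ _ ext X p z = h X p z.
  unshelve eexists (@mkmor k C (mcone gamma) M h _ _ _); last by move=> X p z; rewrite ap_mkmor.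
  - move=> X p a [l x] [l' x']; rewrite /h /=.
    by rewrite (ap_lin phi) (@ap_lin k C _ _ rho X p a l l') /= scalerBr; zmod.
  - move=> X Y p q r e u [l x]; rewrite /h /= ap_act actDr; congr (_ + _).
    have := ap_act rho e u (l : mshift S 1 X q); rewrite /= mul1r => ->.
    by rewrite /= (linN (ax_linr (actP M) e u)).
  - move=> X p q e [l x]; rewrite /h; case: q / e; rewrite cd_cone.
    rewrite [ap rho _]rho_dN cd_cone /= gammaE linD_ap ap_d (linB (cd_lin _ _)).
    by zmod.
exists gamma, ext; split; last first.
  move=> X p x; rewrite extE cin2E /h /=.
  by rewrite (@lin0_ap k C _ _ rho X p) subr0.
move=> X p; split=> [[l x] cz [q [e [m]]]|m cm].
- rewrite -/(ap _ _) extE; case: p / e l x cz => l x.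
  have [q' qE] : exists q', q' + 1 = q by exists (q - 1); lia.
  case: q / qE m l x => m l x; rewrite /cocycle cd_cone => -[/eqP].
  rewrite oppr_eq0 => /eqP cl hx; rewrite /h /= => hm.
  simpl in cl, hx; rewrite gammaE in hx.
  set q := q' + 1 in m l x cl hx hm *.
  (* That [ext (l, x)] is the coboundary of [m] and that [(l, x)] is a cocycle together say that
     [(x, - m)] bounds [rho l]. *)
  have rhol : ap rho (l : mshift S 1 X (q + 1)) = cd (mcone phi X) erefl ((x, - m) : mcone phi X q).
    rewrite cd_cone /= (linN (cd_lin _ _)) hm [LHS]surjective_pairing; congr pair; last by zmod.
    by rewrite -[RHS]add0r -hx; zmod.
  have cl' : @cocycle k (mshift S 1 X) (q + 1) l.
    by rewrite /cocycle /= (eq_irrelevance (shift_d 1 erefl) erefl) cl scaler0.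
  have [|l1 l1E] := @cobP _ (mshift S 1 X) (q + 1) l q erefl (qis_inj qrho cl' _).
    by rewrite rhol; apply: cobI.
  have cw : cocycle (ap rho l1 - ((x, - m) : mcone phi X q)).
    by rewrite /cocycle (linB (cd_lin _ _)) -ap_d l1E rhol subrr.
  have [l2 cl2 /(cobP (erefl : q' + 1 = q)) [[y m2]]] := qis_surj qrho cw.
  rewrite cd_cone => -[] ym _; simpl in ym.
  pose t : S X (q + 1) := (l1 : S X (q + 1)) - l2.
  have tE : - cd (S X) erefl t = l.
    have cl2' : cd (mshift S 1 X) erefl l2 = 0 := cl2.
    have : cd (mshift S 1 X) erefl (l1 - l2) = l by rewrite (linB (cd_lin _ _)) l1E cl2' subr0.
    by rewrite /= (eq_irrelevance (shift_d 1 erefl) erefl) sg1 scaleN1r.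
  exists q, erefl, ((t, y) : mcone gamma X q).
  rewrite cd_cone /= tE gammaE; congr pair.
  rewrite (@linB_ap k C _ _ rho X q l1 l2) /=.
  have -> : cd (P X) erefl y = - ((ap rho l1).1 - x - (ap rho l2).1) by rewrite -ym opprK.
  by zmod.
- have c0m : cocycle ((0, m) : mcone phi X p).
    by rewrite /cocycle cd_cone /= (lin0 (cd_lin _ _)) lin0_ap oppr0 [cd _ _ m]cm addr0.
  have [l cl [q [e [[x m']]]]] := qis_surj qrho c0m.
  case: p / e m cm c0m l cl => m cm c0m l cl.
  rewrite -/(ap rho l) cd_cone => -[] h1 h2; simpl in h1, h2.
  have dl : cd (S X) erefl (l : S X (q + 1 + 1)) = 0.
    have : cd (mshift S 1 X) erefl l = 0 := cl.
    by rewrite /= (eq_irrelevance (shift_d 1 erefl) erefl) => /scaler_sg_eq0.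
  exists ((- (l : S X (q + 1 + 1)), x) : mcone gamma X (q + 1)).
    rewrite /cocycle cd_cone /= (linN (cd_lin _ _)) dl !oppr0 linN_ap gammaE.
    congr pair; rewrite -[cd _ _ x]opprK h1 sub0r opprK; exact: addNr.
  exists q, erefl, m'; rewrite -/(ap ext _) extE /h /= (@linN_ap k C _ _ rho X (q + 1)) /=.
  have -> : cd (M X) erefl m' = m - (ap rho l).2 - ap phi x by rewrite -h2; zmod.
  by zmod.
Qed.

(** [S] is a resolution of the cone of [phi] shifted by -1, that is, of the homotopy fibre of [phi]:
    attaching it to [P] kills the difference between [P] and [M]. *)
Lemma relative_resolution P M (phi : mor P M) : resolvable P -> resolvable M ->
  exists S (gamma : mor S P) (ext : mor (mcone gamma) M),
  [/\ hproj_mod S, mod_qis ext & forall X p (x : P X p), ap ext (ap (cin2 gamma) x) = ap phi x].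
Proof.
move=> rP rM; have [R hR qR] := resolvable_cone phi rP rM.
have [rho qrho] : qisto (mshift (mshift R (-1)) 1) (mcone phi).
  apply: qisto_trans qR; apply: diso_qis; last exact: shift_shift_diso.
  by do 2 apply: hproj_shift.
have [gamma [ext [qext extE]]] := cone_of_shift qrho.
by exists (mshift R (-1)), gamma, ext; split=> //; apply: hproj_shift.
Qed.

End RelativeResolutions.

Lemma mdiff_closed (k : comPzRingType) (C : dgcat k) (M N : dgmod C) n n' n''
    (e : n + 1 = n') (e' : n + 1 = n'') (f : modhom M N n) :
  mdiff e f = 0 -> mdiff e' f = 0.
Proof. by case: n' / e; case: n'' / e'. Qed.

(** * Cones and left Kan extensions of diagrams *)

Section DiagramResolutions.
Variables (k : comPzRingType) (C : dgcat k) (I : fincat).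
Implicit Types P N L F : diagram C I.

Definition hproj_diag P : Prop := forall N, (forall i, mod_acyclic (N i)) ->
  forall n n' (e : n + 1 = n') (phi : forall i, modhom (P i) (N i) n'), natural phi ->
  (forall i, mdiff erefl (phi i) = 0) ->
  exists psi : forall i, modhom (P i) (N i) n, natural psi /\ forall i, mdiff e (psi i) = phi i.

Section DiagramCone.
Variables (L P : diagram C I) (g : forall i, mor (L i) (P i)).
Hypothesis g_nat : natural g.

Lemma ap_nat i j (a : fhom I i j) X p (x : L i X p) :
  ap (g j) (ap (dar L a) x) = ap (dar P a) (ap (g i) x).
Proof. exact: g_nat. Qed.

Definition dcone_ar i j (a : fhom I i j) : mor (mcone (g i)) (mcone (g j)).
Proof.
unshelve eapply (@cmap k C _ _ _ _ (g i) (g j) (dar L a) (dar P a) 0 _).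
by move=> X p x p0 p1 e0 c0 c1 e1; rewrite ap_nat subrr (lin0 (cd_lin _ _)) addr0.
Defined.

Lemma ap_dcone_ar i j (a : fhom I i j) X p (z : mcone (g i) X p) :
  ap (dcone_ar a) z = (ap (dar L a) z.1, ap (dar P a) z.2).
Proof. by rewrite ap_cmap addr0. Qed.

Definition dcone : diagram C I.
Proof.
refine (@Diagram k C I (fun i => mcone (g i)) dcone_ar _ _).
- by move=> i X p [x y]; rewrite ap_dcone_ar !dar_id.
- by move=> i j l b a X p [x y]; rewrite !ap_dcone_ar !dar_comp.
Defined.

Lemma ap_dcone i j (a : fhom I i j) X p (z : mcone (g i) X p) :
  ap (dar dcone a) z = (ap (dar L a) z.1, ap (dar P a) z.2).
Proof. exact: ap_dcone_ar. Qed.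

Lemma natural_in2 N n (phi : forall i, modhom (mcone (g i)) (N i) n) (e : n + 0 = n) :
  natural (P := dcone) phi -> natural (P := P) (fun i => mcomp e (phi i) (cin2 (g i))).
Proof.
move=> nphi i j a X p q e' x; rewrite !(mcompE e _ _ e' (addr0 p) e') -!/(ap _ _) !cin2E.
rewrite -nphi; congr gm.
by rewrite ap_dcone /= lin0_ap.
Qed.

Lemma natural_in1 N n m (phi : forall i, modhom (mcone (g i)) (N i) n) (e : n + -1 = m) :
  natural (P := dcone) phi -> natural (P := L) (fun i => mcomp e (phi i) (cin1 (g i))).
Proof.
move=> nphi i j a X p q e' x; have E : p - 1 + n = q by lia.
rewrite !(mcompE e _ _ e' erefl E) -nphi; congr gm.
rewrite ap_dcone /= lin0_ap; congr pair.
have E' : p = p - 1 + 1 by lia.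
by rewrite {2}/ap (gm_transp _ _ _ (etrans (addr0 p) E')) (transp_gm _ _ _ (etrans (addr0 p) E')).
Qed.

Lemma natural_cone N n m (e1 : m + 1 = n) (e2 : n + 0 = n) (a : forall i, modhom (L i) (N i) m)
    (b : forall i, modhom (P i) (N i) n) :
  natural a -> natural b ->
  natural (P := dcone) (fun i => mcomp e1 (a i) (cpr1 (g i)) + mcomp e2 (b i) (cpr2 (g i))).
Proof.
move=> na nb i j u X p q e x; rewrite !mhDE !gmDE linD_ap.
have E : p + 1 + m = q by lia.
rewrite !(mcompE e1 _ _ e erefl E) !(mcompE e2 _ _ e (addr0 p) e) !cpr1E -!/(ap _ _) !cpr2E.
by rewrite ap_dcone na nb.
Qed.

Lemma natural_g N n (b : forall i, modhom (P i) (N i) n) (e : n + 0 = n) :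
  natural b -> natural (fun i => mcomp e (b i) (g i)).
Proof.
move=> nb i j u X p q e' x; rewrite !(mcompE e _ _ e' (addr0 p) e') -!/(ap _ _).
by rewrite ap_nat nb.
Qed.

Lemma naturalB (M N : diagram C I) n (phi psi : forall i, modhom (M i) (N i) n) c :
  natural (P := M) phi -> natural (P := M) psi -> natural (P := M) (fun i => phi i - c *: psi i).
Proof.
move=> nphi npsi i j u X p q e x.
rewrite -[LHS]/(gm (phi j X) e _ - c *: gm (psi j X) e _).
rewrite -[gm ((phi i - _) X) _ _]/(gm (phi i X) e _ - c *: gm (psi i X) e _).
by rewrite nphi npsi linB_ap linZ_ap.
Qed.

(** The argument of [hproj_cone] at every object at once; [cone_rest] is natural in the object, so
    the hypotheses supply natural bounding maps. *)
Lemma hproj_dcone : hproj_diag L -> hproj_diag P -> hproj_diag dcone.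
Proof.
move=> hL hP N aN p1 p e1 phi nphi cphi.
have e0 : p + 0 = p := addr0 p.
have e2 : p1 + 0 = p1 := addr0 _.
have e3 : p1 - 1 + 1 = p1 by lia.
have e4 : p + -1 = p1 by lia.
have [|b [nb bE]] := hP N aN _ _ e1 _ (natural_in2 e0 nphi).
  move=> i; rewrite (mdiff_comp_mr e0 erefl erefl (addr0 _)).
  by rewrite [mdiff _ _]cphi mcomp0l.
have [||a [na aE]] := hL N aN _ _ e3 (fun i => cone_rest (phi i) e2 e4 (b i)).
- exact: naturalB (natural_in1 e4 nphi) (natural_g e2 nb).
- by move=> i; apply: mdiff_closed (cone_rest_closed e2 e4 (cphi i) (bE i)).
exists (fun i => mcomp e3 (a i) (cpr1 (g i)) + mcomp e2 (b i) (cpr2 (g i))); split.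
  exact: natural_cone.
by move=> i; apply: cone_extend (aE i).
Qed.

End DiagramCone.

Section Lan.
Variables (i : I) (S : dgmod C).

Definition mpush (T T' : finType) (g : T -> T') : mor (mpow T S) (mpow T' S).
Proof.
apply: (@mkmor k C (mpow T S) (mpow T' S)
  (fun X p (x : {ffun T -> S X p}) => [ffun t' => \sum_(t | g t == t') x t])).
- move=> X p a x y; apply/ffunP => t; rewrite !ffunE scaler_sumr -big_split /=.
  by apply: eq_bigr => v _; rewrite !ffunE.
- move=> X Y p q r e u x; apply/ffunP => t; rewrite !ffunE.
  rewrite (big_morph _ (actDr e u) (act0r _ _ u)).
  by apply: eq_bigr => v _; rewrite ffunE.
- move=> X p q e x; apply/ffunP => t; rewrite !ffunE.
  rewrite (big_morph _ (linD (cd_lin _ e)) (lin0 (cd_lin _ e))).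
  by apply: eq_bigr => v _; rewrite ffunE.
Defined.

(* The left Kan extension of [S] along the object [i]. *)
Definition lan : diagram C I.
Proof.
refine (@Diagram k C I (fun j => mpow (fhom I i j) S)
  (fun j l a => mpush (fun v : fhom I i j => fcomp a v)) _ _).
- move=> j X p x; rewrite ap_mkmor; apply/ffunP => t; rewrite ffunE.
  under eq_bigl => v do rewrite fcomp1m.
  by rewrite big_pred1_eq.
- move=> j l m b a X p x; rewrite !ap_mkmor; apply/ffunP => t; rewrite !ffunE.
  rewrite (partition_big (fcomp a) (fun u => fcomp b u == t)) /= => [|v].
    apply: eq_bigr => u /eqP bu; rewrite ffunE; apply: eq_bigl => v.
    by rewrite fcompA; have [->|_] := eqVneq (fcomp a v) u; rewrite ?andbF // bu (eqxx t).
  by rewrite fcompA.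
Defined.

Lemma ap_lan j l (a : fhom I j l) X p (x : lan j X p) w :
  (ap (dar lan a) x : {ffun _ -> S X p}) w = \sum_(v | fcomp a v == w) (x : {ffun _ -> S X p}) v.
Proof. by rewrite ap_mkmor ffunE. Qed.

Definition minj (T : finType) (t : T) : mor S (mpow T S).
Proof.
apply: (@mkmor k C S (mpow T S)
  (fun X p (x : S X p) => [ffun u => if u == t then x else 0])).
- move=> X p a x y; apply/ffunP => u; rewrite !ffunE; case: eqP => // _.
  by rewrite scaler0 addr0.
- move=> X Y p q r e u x; apply/ffunP => v; rewrite !ffunE; case: eqP => // _.
  by rewrite act0r.
- move=> X p q e x; apply/ffunP => v; rewrite !ffunE; case: eqP => // _.
  by rewrite (lin0 (cd_lin _ _)).
Defined.

Variable N : diagram C I.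

(* The transpose of a map out of [S]. *)
Definition lext n (s : modhom S (N i) n) j : modhom (lan j) (N j) n.
Proof.
unshelve eexists (fun X => @GMap k (lan j X) (N j X) n
  (fun p q e (x : {ffun fhom I i j -> S X p}) => \sum_v ap (dar N v) (gm (s X) e (x v))) _).
  move=> p q e a x y; rewrite scaler_sumr -big_split /=.
  by apply: eq_bigr => v _; rewrite !ffunE gm_lin linD_ap linZ_ap.
move=> X Y p q r s' t e e1 e2 e3 u x /=.
rewrite (big_morph _ (actDr e3 u) (act0r _ _ u)) scaler_sumr.
apply: eq_bigr => v _; rewrite ffunE (mh_act s e e1 e2 e3).
by rewrite linZ_ap ap_act.
Defined.

Lemma lextE n (s : modhom S (N i) n) j X p q (e : p + n = q) (x : lan j X p) :
  gm (lext s j X) e x = \sum_v ap (dar N v) (gm (s X) e ((x : {ffun _ -> S X p}) v)).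
Proof. by []. Qed.

Lemma lext_natural n (s : modhom S (N i) n) : natural (lext s).
Proof.
move=> j l a X p q e x; rewrite !lextE.
rewrite (big_morph _ (@linD_ap k C _ _ (dar N a) X q) (lin0_ap _ _ _)).
under [LHS]eq_bigr => w _.
  rewrite ap_lan (big_morph _ (linD (gm_lin (s X) e)) (lin0 (gm_lin (s X) e))).
  rewrite (big_morph _ (@linD_ap k C _ _ (dar N w) X q) (lin0_ap _ _ _)).
  over.
rewrite (exchange_big_dep predT) //=; apply: eq_bigr => v _.
by rewrite (big_pred1 (fcomp a v)) ?dar_comp // => w; rewrite eq_sym.
Qed.

Lemma lext_d n n' (e : n + 1 = n') (s : modhom S (N i) n) j :
  mdiff e (lext s j) = lext (mdiff e s) j.
Proof.
apply: modhomP => X; apply: gmapP => p q e' x.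
have E1 : p + n + 1 = q by lia.
have E2 : p + 1 + n = q by lia.
rewrite (mdiffE e (lext s j) e' erefl E1 erefl E2) !lextE.
rewrite (big_morph _ (linD (cd_lin _ E1)) (lin0 (cd_lin _ E1))) scaler_sumr -sumrB.
apply: eq_bigr => v _; rewrite (mdiffE e s e' erefl E1 erefl E2) linB_ap linZ_ap ap_d.
by rewrite /= ffunE.
Qed.

(** An element of [lan j] is the sum, over the arrows [v], of the images under [v] of its components
    placed at the identity of [i]; so a natural map is determined by its restriction to that copy of
    [S]. *)
Lemma lext_uniq n (phi : forall j, modhom (lan j) (N j) n) (e : n + 0 = n) : natural phi ->
  forall j, phi j = lext (mcomp e (phi i) (minj (fid I i))) j.
Proof.
move=> nphi j; apply: modhomP => X; apply: gmapP => p q e' x; rewrite lextE.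
have xE : x = \sum_v ap (dar lan v) (ap (minj (fid I i)) ((x : {ffun _ -> S X p}) v)) :> lan j X p.
  apply/ffunP => w; rewrite sum_ffunE.
  have vE v : (ap (dar lan v) (ap (minj (fid I i)) ((x : {ffun _ -> S X p}) v)) : {ffun _ -> S X p}) w
      = if v == w then (x : {ffun _ -> S X p}) v else 0.
    rewrite ap_lan big_mkcond (bigD1 (fid I i)) //= fcompm1 big1 => [|u nu].
      by rewrite ap_mkmor ffunE (eqxx (fid I i)) addr0.
    by case: ifP => // _; rewrite ap_mkmor ffunE (negbTE nu).
  under eq_bigr => v _ do rewrite vE.
  by rewrite -big_mkcond big_pred1_eq.
rewrite [in LHS]xE (big_morph _ (linD (gm_lin _ e')) (lin0 (gm_lin _ e'))).
apply: eq_bigr => v _; rewrite nphi (mcompE e _ _ e' (addr0 p) e').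
by [].
Qed.

End Lan.

Lemma hproj_lan i S : hproj_mod S -> hproj_diag (lan i S).
Proof.
move=> hS N aN n n' e phi nphi cphi.
have e0 : n' + 0 = n' := addr0 _.
pose th := mcomp e0 (phi i) (minj S (fid I i)).
have cth : @cocycle k (homM S (N i)) n' th.
  by rewrite /cocycle /= (mdiff_comp_mr e0 erefl _ (addr0 _)) cphi mcomp0l.
have [s sE] := cobP e (hS _ (aN i) _ _ cth).
exists (lext s); split; first exact: lext_natural.
by move=> j; rewrite lext_d [mdiff e s]sE [RHS](lext_uniq e0 nphi).
Qed.

End DiagramResolutions.

(** * Diagrams and bimodules *)

Section BimoduleOfDiagram.
Variables (k : comPzRingType) (C : dgcat k) (I : fincat) (P : diagram C I).
Local Notation K := (linearization k I).
Local Notation B := (bimod_of P).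

(** The slice repeats the data of [P i] in a rebuilt record, which is not convertible to [P i] for a
    variable [P]; the identity therefore becomes an explicit isomorphism. *)
Definition slice_to i : mor (slicer B i) (P i).
Proof. by apply: (@mkmor k C (slicer B i) (P i) (fun X p x => x)). Defined.

Definition slice_from i : mor (P i) (slicer B i).
Proof. by apply: (@mkmor k C (P i) (slicer B i) (fun X p x => x)). Defined.

Lemma slice_toK i : mor_comp (slice_from i) (slice_to i) = mor_id (slicer B i).
Proof. by apply: morP => X p x; rewrite ap_mor_comp !ap_mkmor ap_id. Qed.

Lemma slice_fromK i : mor_comp (slice_to i) (slice_from i) = mor_id (P i).
Proof. by apply: morP => X p x; rewrite ap_mor_comp !ap_mkmor ap_id. Qed.

Lemma natural_from (N : diagram C I) n (phi : forall i, modhom (slicer B i) (N i) n) (e : n + 0 = n) :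
  natural (P := diag_of B) phi -> natural (fun i => mcomp e (phi i) (slice_from i)).
Proof.
move=> nphi i j a X p q e' x.
rewrite !(mcompE e _ _ e' (addr0 p) e') -!/(ap _ _) !ap_mkmor -nphi; congr gm.
by rewrite (ap_morr _ _ (add0r p)) bimod_of_delta.
Qed.

Lemma natural_to (N : diagram C I) n (phi : forall i, modhom (P i) (N i) n) (e : n + 0 = n) :
  natural phi -> natural (P := diag_of B) (fun i => mcomp e (phi i) (slice_to i)).
Proof.
move=> nphi i j a X p q e' x.
rewrite !(mcompE e _ _ e' (addr0 p) e') -!/(ap _ _) !ap_mkmor -nphi; congr gm.
by rewrite (ap_morr _ _ (add0r p)) bimod_of_delta.
Qed.

Lemma hproj_bimod_of : hproj_diag P -> hproj_bimod B.
Proof.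
move=> hP N aN n n' n'' e e' phi cphi.
have e0 : n' + 0 = n' := addr0 _.
have [|psi [npsi psiE]] := hP (diag_of N) (fun i X => aN X i) n n' e _
    (natural_from e0 (bimodhom_natural phi)).
  move=> i; rewrite (mdiff_comp_mr e0 erefl _ (addr0 _)).
  by rewrite (mdiff_closed _ (cphi i)) mcomp0l.
have [chi chiE] := bimodhom_of (natural_to (addr0 n) npsi).
exists chi => i; rewrite chiE (mdiff_comp_mr _ e e e0) psiE (mcompA _ (addr0 0) _ e0).
by rewrite -[mcomp (addr0 0) _ _]/(mor_hom (mor_comp (slice_from i) (slice_to i))) slice_toK mcompm1.
Qed.

(** Makes the current approximation resolvable at the next object, as [relative_resolution]
    requires. *)
Lemma hproj_diag_ob : hproj_diag P -> forall i, hproj_mod (P i).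
Proof.
move=> /hproj_bimod_of /hproj_slicer hB i.
exact: hproj_retract (slice_fromK i) (hB i).
Qed.

Lemma diag_bimod_resolution (F : dgbimod C K) (phi : forall i, mor (P i) (slicer F i)) :
  hproj_diag P -> natural (N := diag_of F) phi -> (forall i, mod_qis (phi i)) ->
  bimod_resolution B F.
Proof.
move=> hP nphi qphi; split; first exact: hproj_bimod_of.
have [psi psiE] := bimodhom_of (natural_to (addr0 0) nphi).
exists psi; split=> [i|X i].
  by rewrite psiE; apply: (mor_closed (mor_comp (phi i) (slice_to i))).
rewrite psiE; apply: (@qis_comp _ _ _ _ _ (phi i) (slice_to i)) => //.
exact: iso_qis (slice_toK i) (slice_fromK i).
Qed.
End BimoduleOfDiagram.

(** * Attaching one object *)

Section Attach.
Variables (k : comPzRingType) (C : dgcat k) (I : fincat).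
Variables (P F : diagram C I) (phi : forall j, mor (P j) (F j)).
Hypothesis phi_nat : natural phi.
Variables (i : I) (S : dgmod C) (gamma : mor S (P i)) (ext : mor (mcone gamma) (F i)).
Hypothesis extE : forall X p (x : P i X p), ap ext (ap (cin2 gamma) x) = ap (phi i) x.

Lemma lext0 (N : diagram C I) n j : lext (0 : modhom S (N i) n) j = 0.
Proof.
apply: modhomP => X; apply: gmapP => p q e x; rewrite lextE gm0E.
by rewrite big1 // => v _; rewrite gm0E lin0_ap.
Qed.

Fact attach_closed j : @cocycle k (homM (lan i S j) (P j)) 0 (lext gamma j).
Proof. by rewrite /cocycle /= lext_d (mor_mdiff gamma) lext0. Qed.

Definition attach_map j : mor (lan i S j) (P j) := Mor (attach_closed j).

Lemma attach_nat : natural attach_map.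
Proof. exact: lext_natural. Qed.

Definition attach : diagram C I := dcone attach_nat.

(** On the cone of [gamma], [ext] consists of [phi i] and this null-homotopy of [phi i] after
    [gamma]. Its transpose extends [phi] over the attached cells at all objects. *)
Definition attach_homotopy : modhom S (F i) (-1) := mcomp (add0r (-1)) ext (cin1 gamma).

Lemma attach_homotopyE (e : -1 + 1 = 0) (e0 : 0 + 0 = 0) :
  mdiff e attach_homotopy = mcomp e0 (phi i) gamma.
Proof.
rewrite (mdiff_comp_ml _ e e e0) (cin1_d gamma e e0).
by apply: apP => X p x; rewrite !ap_comp extE.
Qed.

Fact attach_e : -1 + 1 = 0 :> int.
Proof. by []. Qed.

Definition attach_ext_hom j : modhom (attach j) (F j) 0 :=
  mcomp attach_e (lext attach_homotopy j) (cpr1 (attach_map j)) +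
  mcomp (addr0 0) (phi j) (cpr2 (attach_map j)).

Fact attach_ext_closed j : @cocycle k (homM (attach j) (F j)) 0 (attach_ext_hom j).
Proof.
have E1 : 0 + 1 = 0 + 1 :> int by [].
rewrite /cocycle /= mdiffD.
rewrite (mdiff_comp_l attach_e attach_e erefl E1 (em := erefl) _ (cpr1_d _ _)).
rewrite (mdiff_comp_ml _ erefl _ (add0r (0 + 1))) (cpr2_d _ erefl E1) lext_d.
rewrite (attach_homotopyE attach_e (addr0 0)) mcompNr.
rewrite -(mcompA (addr0 0) E1 E1 (add0r _)); apply/eqP; rewrite subr_eq0; apply/eqP.
congr (mcomp _ _ _); apply: modhomP => X; apply: gmapP => p q e x.
rewrite (mcompE (addr0 0) (phi j) _ e (addr0 p) e) lextE.
rewrite -[gm (attach_map j X) _ _]/(gm (lext gamma j X) (addr0 p) x) lextE.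
rewrite (big_morph _ (linD (gm_lin (phi j X) e)) (lin0 (gm_lin (phi j X) e))).
apply: eq_bigr => v _; rewrite phi_nat.
by rewrite (mcompE (addr0 0) (phi i) gamma e (addr0 p) e).
Qed.

Definition attach_ext j : mor (attach j) (F j) := Mor (attach_ext_closed j).

Lemma ap_attach_ext j X p (z : attach j X p) (e : p + 1 + -1 = p) :
  ap (attach_ext j) z = gm (lext attach_homotopy j X) e z.1 + ap (phi j) z.2.
Proof.
rewrite -[LHS]/(gm (mcomp attach_e (lext attach_homotopy j) (cpr1 (attach_map j)) X) (addr0 p) z
  + ap (mcomp (addr0 0) (phi j) (cpr2 (attach_map j))) z).
by rewrite (mcompE attach_e _ _ (addr0 p) erefl e) cpr1E ap_comp cpr2E.
Qed.

Lemma attach_ext_nat : natural attach_ext.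
Proof. exact: natural_cone (lext_natural _) phi_nat. Qed.

Lemma hproj_attach : hproj_mod S -> hproj_diag P -> hproj_diag attach.
Proof. by move=> hS hP; apply: hproj_dcone => //; apply: hproj_lan. Qed.

Lemma attach_qis_old j : (fhom I i j -> False) -> mod_qis (phi j) -> mod_qis (attach_ext j).
Proof.
move=> empty qphi.
have lan0 X p (x : lan i S j X p) : x = 0 by apply/ffunP => v; case: (empty v).
apply: (@qis_cancel _ _ _ _ _ (attach_ext j) (cin2 (attach_map j))).
  apply: bij_qis => X p.
    by move=> y; rewrite cin2E => -[].
  by case=> x y; exists y; rewrite cin2E (lan0 _ _ x).
have -> // : mor_comp (attach_ext j) (cin2 (attach_map j)) = phi j.
apply: morP => X p x; have e : p + 1 + -1 = p by lia.
by rewrite ap_mor_comp cin2E (ap_attach_ext _ e) (lin0 (gm_lin _ _)) add0r.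
Qed.

(** When [i] has no other endomorphism than the identity, the Kan extension is [S] at [i]; the
    attached cone there is that of [gamma], and [attach_ext] restricts to [ext]. *)
Lemma attach_qis_new : (forall a : fhom I i i, a = fid I i) -> mod_qis ext ->
  mod_qis (attach_ext i).
Proof.
move=> uniq qext.
have sumE n (N : diagram C I) (r : modhom S (N i) n) X p q (e : p + n = q) (s : S X p) :
    gm (lext r i X) e (ap (minj S (fid I i)) s) = gm (r X) e s.
  rewrite lextE (bigD1 (fid I i)) //= big1 => [|v nv]; last by rewrite (uniq v) eqxx in nv.
  by rewrite addr0 ap_mkmor ffunE eqxx dar_id.
have gE X p (s : S X p) : ap (attach_map i) (ap (minj S (fid I i)) s) = ap gamma s.
  exact: sumE.
have hE X p (x : S X p) p0 p1 (e0 : p + -1 = p0)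
   (c0 : p0 + 1 = p) (c1 : p + 1 = p1) (e1 : p1 + -1 = p) :
   ap (mor_id (P i)) (ap gamma x) - ap (attach_map i) (ap (minj S (fid I i)) x)
     = cd _ c0 (gm ((0 : modhom S (P i) (-1)) X) e0 x) + gm ((0 : modhom S (P i) (-1)) X) e1 (cd _ c1 x).
  by rewrite gE ap_mor_id subrr (lin0 (cd_lin _ _)) addr0.
apply: (@qis_cancel _ _ _ _ _ (attach_ext i) (cmap hE)).
  apply: cmap_qis; last exact: qis_id.
  apply: bij_qis => X p x.
    by rewrite ap_mkmor => /ffunP/(_ (fid I i)); rewrite !ffunE eqxx.
  exists ((x : {ffun fhom I i i -> S X p}) (fid I i)).
  by rewrite ap_mkmor; apply/ffunP => v; rewrite ffunE (uniq v) eqxx.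
have -> // : mor_comp (attach_ext i) (cmap hE) = ext.
apply: morP => X p [s x]; have e : p + 1 + -1 = p by lia.
rewrite ap_mor_comp (ap_attach_ext _ e) ap_cmap.
rewrite [X in X + _](sumE _ _ attach_homotopy X _ _ e s) [X in ap (phi i) X]addr0 ap_mor_id.
rewrite (mcompE (add0r (-1)) ext (cin1 gamma) e e (addr0 p)) cin1E -extE cin2E -linD_ap.
by congr (ap ext _); congr pair; rewrite /= ?addr0 ?add0r.
Qed.

End Attach.

(** * Resolutions over finite direct categories *)

Lemma is_fid_ob (I : fincat) (i j : I) (a : fhom I i j) : is_fid a -> i = j.
Proof. by case. Qed.

(** The equality [e] is universally quantified so that [is_fid] can be eliminated with free indices;
    afterwards [e] is trivial because equality of objects is decidable. *)
Lemma is_fid_eq (I : fincat) (i j : I) (a : fhom I i j) : is_fid a ->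
  forall e : j = i, match e in _ = l return fhom I i l with erefl => a end = fid I i.
Proof. by case=> l e; rewrite (eq_axiomK e). Qed.

Section Induction.
Variables (k : comPzRingType) (C : dgcat k) (I : fincat).
Local Notation K := (linearization k I).

Definition zcochain : cochain k.
Proof.
refine (@Cochain k (fun p => {ffun 'I_0 -> k^o}) (fun p q e x => 0) _ _).
- by move=> p q e a x y; rewrite scaler0 addr0.
- by [].
Defined.

Lemma zcochain0 p (x : zcochain p) : x = 0.
Proof. by apply/ffunP => -[]. Qed.

Definition zero_mod : dgmod C.
Proof.
refine (@DGMod k C (fun X => zcochain) (fun X Y p q r e u x => 0) _).
split=> //.
- by move=> X Y p q r e u a x y; rewrite scaler0 addr0.
- by move=> X Y p q r e x a u v; rewrite scaler0 addr0.
- by move=> X p e x; apply/esym/zcochain0.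
- by move=> X Y p q r p' q' r' e ep eq er e1 e2 u x; rewrite scaler0 addr0.
Defined.

Definition zdiag : diagram C I.
Proof. by refine (@Diagram k C I (fun=> zero_mod) (fun _ _ _ => mor_id zero_mod) _ _) => *; rewrite !ap_mor_id. Defined.

Lemma hproj_zdiag : hproj_diag zdiag.
Proof.
move=> N aN n n' e phi nphi cphi; exists (fun i => 0); split.
  by move=> i j a X p q e' x; rewrite !gm0E lin0_ap.
move=> i; rewrite mdiff0; apply: modhomP => X; apply: gmapP => p q e' x.
by rewrite (_ : x = 0) ?(lin0 (gm_lin _ _)) //; apply: zcochain0.
Qed.

Lemma finite_direct_resolution (F : diagram C I) :
  finite_direct I -> (forall i, resolvable (F i)) ->
  exists (P : diagram C I) (phi : forall i, mor (P i) (F i)),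
    [/\ hproj_diag P, natural phi & forall i, mod_qis (phi i)].
Proof.
move=> [n [d dI]] rF.
(* [D] is the set of objects treated so far. Its closure under sources of arrows excludes arrows
   from an untreated object into it. *)
suff main m : (m <= #|I|)%N -> exists (P : diagram C I) (phi : forall i, mor (P i) (F i)) (D : {set I}),
   [/\ hproj_diag P, natural phi, #|D| = m,
      forall i j, fhom I i j -> j \in D -> i \in D & forall i, i \in D -> mod_qis (phi i)].
  have [P [phi [D [hP nphi cD _ qphi]]]] := main _ (leqnn _).
  exists P, phi; split=> // i; apply: qphi.
  by have -> : D = setT by [apply/eqP; rewrite eqEcard subsetT /= cardsT cD]; rewrite inE.
elim: m => [_|m IH mI].
  unshelve eexists zdiag, (fun i => @mkmor k C zero_mod (F i) (fun X p x => 0) _ _ _), set0.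
  - by move=> X p a x y; rewrite scaler0 addr0.
  - by move=> X Y p q r e u x; rewrite act0r.
  - by move=> X p q e x; rewrite (lin0 (cd_lin _ _)).
  split; [exact: hproj_zdiag| |by rewrite cards0|by move=> i j _; rewrite inE|by move=> i; rewrite inE].
  move=> i j a X p q e x; have E : p = q by lia.
  by move: e; subst q => e; rewrite !apE !ap_mkmor lin0_ap.
have [P [phi [D [hP nphi cD dD qphi]]]] := IH (ltnW mI).
have [i0 i0D] : exists i0, i0 \notin D.
  apply/existsP; apply: contraLR mI => /existsPn h; rewrite -leqNgt -cD -cardsT.
  by apply/subset_leq_card/subsetP => x _; rewrite -[_ \in _]negbK; apply: h.
(* Minimality of [d i] puts the source of every non-identity arrow into [i] inside [D], so adding
   [i] preserves the closure of [D]. *)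
case: (@arg_minnP I i0 (fun i => i \notin D) (fun i => d i) i0D) => i iD imin.
have [S [gamma [ext [hS qext extE]]]] := relative_resolution (phi i)
  (hproj_resolvable (@hproj_diag_ob _ _ _ _ hP i)) (rF i).
exists (attach gamma), (attach_ext nphi extE), (i |: D); split.
- exact: hproj_attach.
- exact: attach_ext_nat.
- by rewrite cardsU1 iD cD.
- move=> l j a; rewrite !inE => /orP [/eqP jE|jD]; last by rewrite (dD _ _ a jD) orbT.
  move: a; rewrite jE => a; case: (pselect (is_fid a)) => [/is_fid_ob ->|/dI ltd].
    by rewrite eqxx.
  by apply/orP; right; apply: contraLR ltd => /imin; rewrite -leqNgt.
- move=> j; rewrite !inE => /orP [/eqP ->|jD].
    (* A non-identity endomorphism of [i] would give [d i < d i]. *)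
    apply: attach_qis_new => // a; case: (pselect (is_fid a)) => [|/dI]; last by rewrite ltnn.
    by move=> /is_fid_eq /(_ erefl).
  apply: attach_qis_old => [a|]; last exact: qphi.
  by move: iD; rewrite (dD _ _ a jD).
Qed.
End Induction.

(** * Homotopy colimits and the equivalences *)

Lemma pretriangulated_whocolim (k : comPzRingType) (A : dgcat k) (I : fincat) :
  pretriangulated A -> finite_direct I ->
  forall F : dgbimod (opcat A) (linearization k I), quasi_functor F ->
  forall W : dgmod (opcat (linearization k I)), in_pretr W -> exists X : A, is_whocolim W F X.
Proof.
move=> /pretriangulatedE [_ /dclosed_rep_corep cA] dI F qF W; rewrite /in_pretr rep_corep => cW.
have rF i : resolvable (slicer F i).
  have [X iX] := qF i; exists (rep X); first exact: hproj_rep.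
  by apply: diso_qis (diso_sym iX); apply: hproj_rep.
have [P [phi [hP nphi qphi]]] := finite_direct_resolution (F := diag_of F) dI rF.
have res := diag_bimod_resolution hP nphi qphi.
pose B := bimod_of P; have hB i : hproj_mod (slicer B i) by apply: hproj_slicer; case: res.
(* The opposite of the quasi-functor has corepresentable slices, so the argument for limits applies
   to it with [corep] as the closed family. *)
have gen i : exists X, diso (corep X) (slicer (hom_bimod B (diag A)) i).
  have [X iX] := qF i; exists X.
  have [psi qpsi] : qisto (slicer B i) (rep X).
    apply: diso_qis => //; apply: diso_trans iX.
    apply: diso_trans (qis_diso (qphi i)); apply: qis_diso.
    exact: iso_qis (slice_toK P i) (slice_fromK P i).
  by apply: qis_diso; apply: opposite_rep_qis qpsi.
have [X iX] := pretr_hom_weight (@hproj_corep k A) cA gen cW.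
exists X, (hom_bimod B (diag A)); first by exists B.
exists W => //; apply: mod_resolution_refl.
exact: (pretr_hproj (@hproj_corep k (opcat (linearization k I))) cW).
Qed.

Theorem proposition4p15 (k : comPzRingType) (A : dgcat k)
    (A_nonempty : inhabited A) (A_hproj : hproj_dgcat A) :
  (pretriangulated A <->
     (forall I : fincat, finite_direct I ->
      forall F : dgbimod (opcat A) (linearization k I), quasi_functor F ->
      forall W : dgmod (linearization k I), in_pretr_op W ->
      exists X : A, is_wholim W F X))
  /\
  (pretriangulated A <->
     (forall I : fincat, finite_direct I ->
      forall F : dgbimod (opcat A) (linearization k I), quasi_functor F ->
      forall W : dgmod (opcat (linearization k I)), in_pretr W ->
      exists X : A, is_whocolim W F X)).
Proof.
split; split.
- by move=> pA I _; apply: pretriangulated_wholim.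
- move=> lim; apply/pretriangulatedE; split=> //.
  by apply: wholim_dclosed; apply: lim arrow_direct.
- by move=> pA I; apply: pretriangulated_whocolim.
- move=> colim; apply/pretriangulatedE; split=> //; apply/dclosed_rep_corep.
  by apply: whocolim_dclosed; apply: colim arrow_direct.
Qed.
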